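(* Let $N\ge2$ and $R>0$. For all $u\in W^{1,2}(B_R)$, we have $$\int_{B_R}|\nabla u|^2\,dx-\mu_1\int_{B_R}|u-u_{B_R}|^2\,dx=\sum_{j=2}^{\infty}\left(\mu_j-\mu_{j-1}\right)\inf_{\Phi\in\mathcal{M}_{j-1}}\int_{B_R}|u-\Phi|^2\,dx$$ and $$\int_{B_R}|\nabla u|^2\,dx-\mu_1\int_{B_R}|u-u_{B_R}|^2\,dx=\mu_1\sum_{j=2}^{\infty}\left(\frac{1}{\mu_{j-1}}-\frac{1}{\mu_j}\right)\inf_{\Phi\in\mathcal{M}_{j-1}}\int_{B_R}|\nabla(u-\Phi)|^2\,dx,$$ where both series are convergent. Moreover, for every $m\ge2$ and all $u\in W^{1,2}(B_R)$, the partial sums satisfy the sharp inequalities $$\delta_{B_R}(u)\ge\sum_{j=2}^{m}\left(\mu_j-\mu_{j-1}\right)\inf_{\Phi\in\mathcal{M}_{j-1}}\int_{B_R}|u-\Phi|^2\,dx$$ and $$\delta_{B_R}(u)\ge\mu_1\sum_{j=2}^{m}\left(\frac{1}{\mu_{j-1}}-\frac{1}{\mu_j}\right)\inf_{\Phi\in\mathcal{M}_{j-1}}\int_{B_R}|\nabla(u-\Phi)|^2\,dx.$$ In each of these two inequalities, the last coefficient (that of the term $j=m$) cannot be improved, i.e. cannot be replaced by any larger constant, and equality holds if and only if $u\in\mathcal{M}_m$.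
   Context: $B_R=\{x\in\mathbb{R}^N: |x|<R\}$ and $u_{B_R}=\frac{1}{|B_R|}\int_{B_R}u\,dx$. All functions are real-valued. $0=\mu_0<\mu_1<\mu_2<\cdots$ are the distinct eigenvalues of the Neumann Laplacian on $B_R$ ($-\Delta u=\lambda u$ in $B_R$, $\partial_\nu u=0$ on $\partial B_R$), $E_k$ is the eigenspace of $\mu_k$ (so $E_0$ is the space of constants), and $\mathcal{M}_m=E_0\oplus E_1\oplus\cdots\oplus E_m$. The Poincaré deficit is $$\delta_{B_R}(u)=\int_{B_R}|\nabla u|^2\,dx-\mu_1\int_{B_R}|u-u_{B_R}|^2\,dx .$$ *)

(* Defs.v *)
From HB Require Import structures.
From mathcomp Require Import all_boot all_order all_algebra.
From mathcomp Require Import all_classical all_reals all_analysis.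
Set Implicit Arguments.
Unset Strict Implicit.
Unset Printing Implicit Defensive.
Import Order.TTheory GRing.Theory Num.Theory.
Import numFieldNormedType.Exports.
Local Open Scope classical_set_scope.
Local Open Scope ring_scope.

(* R^n is 'rV[R]_n, with the sigma-algebra generated by the coordinates, i.e.
   the Borel sigma-algebra. *)
Definition rv_coord (R : realType) n (i : 'I_n) (x : 'rV[R]_n) :
  measurableTypeR R := x 0 i.

Definition rv_display : measure_display. Proof. exact: default_measure_display. Qed.

HB.instance Definition _ (R : realType) (n : nat) :=
  @isMeasurable.Build rv_display 'rV[R]_n (g_sigma_preimage (@rv_coord R n))
    (@sigma_algebra0 _ _ _) (@sigma_algebraC _ _) (@sigma_algebra_bigcup _ _ _).

Section rv_measurable.
Context {R : realType}.

Lemma measurable_rv_coord n (i : 'I_n) :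
  measurable_fun [set: 'rV[R]_n] (rv_coord i).
Proof.
move=> _ Y mY; rewrite setTI; apply: sub_sigma_algebra => /=.
rewrite -bigcup_seq/=; exists i => /=; first by rewrite mem_index_enum.
by exists Y => //; rewrite setTI.
Qed.

Lemma measurable_fun_rvP d (T : measurableType d) n (f : T -> 'rV[R]_n) :
  (forall i, measurable_fun [set: T] (rv_coord i \o f)) ->
  measurable_fun [set: T] f.
Proof.
move=> mf _ A mA.
have : g_sigma_preimage (fun i => rv_coord i \o f) `<=` @measurable _ T.
  apply: smallest_sub; first exact: sigma_algebra_measurable.
  rewrite -bigcup_seq => B [i _] [C mC <-]; exact: mf.
case: n f mf A mA => [|n] f mf A mA sub.
  have : A = set0 \/ A = setT.
    have [[x Ax]|/set0P/negP/negPn/eqP->] := pselect (A !=set0); [right|by left].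
    by apply/seteqP; split => // y _; rewrite (thinmx0 y) -(thinmx0 x).
  by case=> ->; rewrite ?preimage_set0 ?preimage_setT ?setI0 ?setIT.
by apply: sub; rewrite g_sigma_preimage_comp; exists A.
Qed.

Definition rv_cons n (p : (measurableTypeR R * 'rV[R]_n)%type) : 'rV[R]_n.+1 :=
  row_mx (p.1)%:M p.2.

Definition rv_uncons n (x : 'rV[R]_n.+1) : (measurableTypeR R * 'rV[R]_n)%type :=
  (x 0 0, rsubmx (x : 'rV[R]_(1 + n))).

Lemma rv_consK n : cancel (@rv_cons n) (@rv_uncons n).
Proof.
move=> [a v]; rewrite /rv_uncons /rv_cons row_mxKr; congr pair.
have -> : 0 = lshift n 0 :> 'I_(1 + n) by exact: val_inj.
by rewrite (row_mxEl (a%:M : 'M[R]_1)) mxE eqxx mulr1n.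
Qed.

Lemma rv_unconsK n : cancel (@rv_uncons n) (@rv_cons n).
Proof.
move=> x; rewrite /rv_cons /rv_uncons /= -[RHS](@hsubmxK _ 1 1 n).
have -> : lsubmx (x : 'rV[R]_(1 + n)) = (x 0 0)%:M; last by [].
by apply/rowP => i; rewrite !mxE ord1 mulr1n; congr (x _ _); exact: val_inj.
Qed.

Lemma measurable_rv_cons n : measurable_fun setT (@rv_cons n).
Proof.
apply: measurable_fun_rvP => i; case: (split_ordP (i : 'I_(1 + n))) => j ->.
  rewrite (_ : _ \o _ = fst) //; apply/funext => p /=.
  by apply: (etrans (row_mxEl _ _ _ _)); rewrite ord1 mxE mulr1n.
rewrite (_ : _ \o _ = rv_coord j \o snd); last first.
  by apply/funext => p /=; exact: row_mxEr.
apply: measurableT_comp; [exact: measurable_rv_coord|exact: measurable_snd].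
Qed.

Lemma measurable_rv_uncons n : measurable_fun setT (@rv_uncons n).
Proof.
apply: measurable_fun_pair; first exact: (@measurable_rv_coord n.+1 0).
apply: measurable_fun_rvP => i.
rewrite (_ : _ \o _ = @rv_coord R n.+1 (rshift 1 i)); last first.
  by apply/funext => x; rewrite /rv_coord /= mxE.
exact: measurable_rv_coord.
Qed.

End rv_measurable.

Section leb_step.
Context {R : realType} (n : nat).
Variable m : {sigma_finite_measure set 'rV[R]_n -> \bar R}.

Definition leb_step : set 'rV[R]_n.+1 -> \bar R :=
  pushforward ((@lebesgue_measure R) \x m)%E (@rv_cons R n).

Let measurable_preim A : measurable A -> measurable (@rv_cons R n @^-1` A).
Proof.
by move=> mA; rewrite -[X in measurable X]setTI; exact: measurable_rv_cons.
Qed.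

Let leb_step0 : leb_step set0 = 0%E.
Proof. by rewrite /leb_step /pushforward preimage_set0 measure0. Qed.

Let leb_step_ge0 A : (0 <= leb_step A)%E.
Proof. by rewrite /leb_step /pushforward; exact: measure_ge0. Qed.

Let leb_step_sigma_additive : semi_sigma_additive leb_step.
Proof.
move=> F mF tF mUF; rewrite /leb_step /pushforward preimage_bigcup.
apply: measure_semi_sigma_additive.
- by move=> k; exact: measurable_preim.
- apply/trivIsetP => /= i j _ _ ij; rewrite -preimage_setI.
  by move/trivIsetP : tF => /(_ _ _ _ _ ij) ->//; rewrite preimage_set0.
- by rewrite -preimage_bigcup; exact: measurable_preim.
Qed.

HB.instance Definition _ := isMeasure.Build _ _ _ leb_step
  leb_step0 leb_step_ge0 leb_step_sigma_additive.

Let leb_step_sigma_finite : sigma_finite setT leb_step.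
Proof.
have /sigma_finiteP[F [FT ndF Fo]] := sigma_finiteT (@lebesgue_measure R).
have /sigma_finiteP[G [GT ndG Go]] := sigma_finiteT m.
exists (fun k => @rv_uncons R n @^-1` (F k `*` G k)).
  apply/seteqP; split => // x _.
  have [[j _ Fj] [k _ Gk]] : (\bigcup_k F k) (x 0 0) /\
      (\bigcup_k G k) (rsubmx (x : 'rV[R]_(1 + n))) by rewrite -FT -GT.
  exists (maxn j k) => //; split => /=.
  - by move: Fj; exact/subsetPset/ndF/leq_maxl.
  - by move: Gk; exact/subsetPset/ndG/leq_maxr.
move=> k; have [mF Fk] := Fo k; have [mG Gk] := Go k; split.
  by rewrite -[X in measurable X]setTI; apply: measurable_rv_uncons => //;
    exact: measurableX.
rewrite /leb_step /pushforward -comp_preimage.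
rewrite (_ : _ \o _ = id); last by apply/funext => p /=; rewrite rv_consK.
by rewrite preimage_id product_measure1E// lte_mul_pinfty// ge0_fin_numE.
Qed.

HB.instance Definition _ := Measure_isSigmaFinite.Build _ _ _ leb_step
  leb_step_sigma_finite.

End leb_step.

(* Lebesgue measure on R^n *)
Fixpoint leb (R : realType) n : {sigma_finite_measure set 'rV[R]_n -> \bar R} :=
  match n with
  | 0 => @dirac _ _ (0 : 'rV[R]_0) R
  | n'.+1 => leb_step (leb R n')
  end.

Section Neumann.
Context {R : realType} {n : nat}.
Implicit Types (B : set 'rV[R]_n) (u v phi : 'rV[R]_n -> R).

Definition dotv (x y : 'rV[R]_n) : R := \sum_(i < n) x 0 i * y 0 i.

(* The library norm of 'rV[R]_n is the sup norm; this is the Euclidean one. *)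
Definition enorm (x : 'rV[R]_n) : R := Num.sqrt (dotv x x).

Definition eball (r : R) : set 'rV[R]_n := [set x | enorm x < r].

Definition partial (i : 'I_n) phi : 'rV[R]_n -> R :=
  fun x => 'D_(delta_mx 0 i) phi x.

Definition smooth phi : Prop :=
  forall (s : seq 'I_n) (x : 'rV[R]_n), differentiable (foldr partial phi s) x.

Definition test_function B phi : Prop :=
  let supp := closure [set x | phi x != 0] in
  [/\ smooth phi, compact supp & supp `<=` B].

(* Functions are total on R^n, but only their values on B matter below: L2, W12
   and the eigenspaces are closed under measurable modification of a function
   off B and on null subsets of B. *)
Definition L2 B u : Prop :=
  measurable_fun B u /\ (leb R n).-integrable B (fun x => (u x ^+ 2)%:E).

Definition weak_gradient B u (G : 'rV[R]_n -> 'rV[R]_n) : Prop :=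
  forall i : 'I_n, L2 B (fun x => G x 0 i) /\
    forall phi, test_function B phi ->
      \int[leb R n]_(x in B) (u x * partial i phi x) =
      - \int[leb R n]_(x in B) (G x 0 i * phi x).

Definition W12 B u : Prop := L2 B u /\ exists G, weak_gradient B u G.

(* A choice of weak gradient; it is determined up to a null subset of B. *)
Definition wgrad B u : 'rV[R]_n -> 'rV[R]_n :=
  xget (fun=> 0) [set G | weak_gradient B u G].

Definition average B u : R :=
  (fine (leb R n B))^-1 * \int[leb R n]_(x in B) u x.

Definition sqnorm B u : R := \int[leb R n]_(x in B) (u x ^+ 2).

Definition dirichlet B u : R :=
  \int[leb R n]_(x in B) (enorm (wgrad B u x) ^+ 2).

(* -Delta phi = lambda phi in B with d_nu phi = 0 on the boundary, in the weak
   sense that defines the Neumann Laplacian on W^{1,2}(B). *)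
Definition neumann_eigenspace B (lambda : R) : set ('rV[R]_n -> R) :=
  [set phi | W12 B phi /\ forall v, W12 B v ->
    \int[leb R n]_(x in B) dotv (wgrad B phi x) (wgrad B v x) =
    lambda * \int[leb R n]_(x in B) (phi x * v x)].

Definition neumann_eigenvalue B (lambda : R) : Prop :=
  exists2 phi, neumann_eigenspace B lambda phi &
    ~ {ae leb R n, forall x, B x -> phi x = 0}.

(* mu lists the distinct eigenvalues in increasing order. *)
Definition neumann_spectrum B (mu : nat -> R) : Prop :=
  [/\ mu 0%N = 0, (forall k, mu k < mu k.+1) &
      forall lambda, neumann_eigenvalue B lambda <-> exists k, mu k = lambda].

(* M_m, the sum of the eigenspaces of mu 0, ..., mu m *)
Definition eigensum B (mu : nat -> R) (m : nat) : set ('rV[R]_n -> R) :=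
  [set Phi | exists2 e : nat -> 'rV[R]_n -> R,
     (forall k, (k <= m)%N -> neumann_eigenspace B (mu k) (e k)) &
     Phi = (fun x => \sum_(0 <= k < m.+1) e k x)].

Definition deficit B (mu : nat -> R) u : R :=
  dirichlet B u - mu 1%N * sqnorm B (fun x => u x - average B u).

Definition dist2 B (mu : nat -> R) m u : R :=
  inf [set sqnorm B (fun x => u x - Phi x) | Phi in eigensum B mu m].

Definition gdist2 B (mu : nat -> R) m u : R :=
  inf [set dirichlet B (fun x => u x - Phi x) | Phi in eigensum B mu m].

End Neumann.
Arguments eball {R} n r.

(* Main.v *)
From HB Require Import structures.
Require Import Defs.
From mathcomp Require Import all_boot all_order all_algebra.
From mathcomp Require Import all_classical all_reals all_analysis.
From mathcomp Require Import measurable_realfun lra ring.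
Set Implicit Arguments.
Unset Strict Implicit.
Unset Printing Implicit Defensive.
Import Order.TTheory GRing.Theory Num.Theory.
Import numFieldNormedType.Exports.
Local Open Scope classical_set_scope.
Local Open Scope ring_scope.

(** Write a(u, v) for the integral of grad u . grad v over B and b(u, v) for that
    of u v. Let P_k be the b-orthogonal projection onto E_k and let
    T_m u = u - P_0 u - ... - P_m u be the tail of order m. Distinct eigenspaces
    are orthogonal for both forms, so T_m u realizes both distances from u to M_m,
    and consecutive tails satisfy

      b(T_(j-1) u) = b(T_j u) + b(P_j u),
      a(T_(j-1) u) = a(T_j u) + mu_j b(P_j u)

    (b_tailS, a_tailS; here b(v) stands for b(v, v)). Since E_0 is the space of
    constants, T_0 u is u minus its average, and the deficit is
    a(T_0 u) - mu_1 b(T_0 u). The two relations then telescope to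

      deficit = sum_(2 <= j <= m) (mu_j - mu_(j-1)) b(T_(j-1) u)
                + (a(T_m u) - mu_m b(T_m u)),

    and eliminating b(P_j u) the other way gives the second expansion, with
    remainder mu_1 (a(T_m u) / mu_m - b(T_m u)) (deficit_sum_b, deficit_sum_a).
    Because a(T_m u) >= mu_(m+1) b(T_m u), the remainders are nonnegative, and they
    vanish exactly when T_m u is null, that is, when u lies in M_m. They are at
    most a(T_m u), which tends to 0. A nonzero element of E_m turns the partial
    sum up to m into an equality with a positive last term, hence sharpness.

    The spectral facts behind this, that a >= mu_(m+1) b on the orthogonal
    complement of M_m (perp_rayleigh), that mu is unbounded (mu_unbounded), and
    that a(T_m u) tends to 0 (a_tail_cvg0), hold for any pair of positive
    semidefinite forms such that b(v) = 0 implies a(v) = 0, with two further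
    properties: the space is complete for a + b, and for every e > 0 the form b is
    bounded by e a plus the squares of finitely many bounded functionals. Indeed the
    Rayleigh quotient then attains its infimum on the complement of M_m; a minimizer
    is an eigenvector, and mu lists all the eigenvalues.

    Completeness (W12_complete) is the Riesz-Fischer theorem together with the
    closedness of the weak gradient. The second property (cell_poincare) follows
    by cutting B into cells of small diameter d and applying to each of them a
    Poincare inequality whose constant is of order d^2 for all convex sets of
    diameter d (poincare_convex); the functionals are the means over the cells.
    That inequality comes from u(x + h) - u(x) being the integral of
    h . grad u(x + t h) over t in [0, 1], for every h and almost every x with x and
    x + h in B (difference_ae), an identity obtained by testing the definition of the
    weak gradient against all the translates phi(x - t h) and integrating over t.

    The argument is carried out for an open, convex and bounded set B; the ball
    enters in the last section. *)

(** * Affine changes of variables *)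

Section leb_integral.
Context {R : realType}.

Lemma integral_leb_cons n (f : 'rV[R]_n.+1 -> \bar R) :
  measurable_fun setT f -> (forall x, 0 <= f x)%E ->
  (\int[leb R n.+1]_x f x =
   \int[lebesgue_measure]_a \int[leb R n]_v f (rv_cons (a, v)))%E.
Proof.
move=> mf f0.
rewrite -(fubini_tonelli1 (f \o @rv_cons R n))//; last first.
  by move=> x; exact: f0.
  by apply: measurableT_comp => //; exact: measurable_rv_cons.
have := @ge0_integral_pushforward _ _ _ _ _ _ (@measurable_rv_cons R n)
  ((@lebesgue_measure R) \x leb R n)%E setT f measurableT mf.
rewrite preimage_setT => <- //.
Qed.

Let affine1 (c b : R) (x : measurableTypeR R) : measurableTypeR R := c * x + b.

Let measurable_affine1 c b : measurable_fun setT (affine1 c b).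
Proof. by apply: measurable_funD => //; exact: mulrl_measurable. Qed.

(** Lebesgue measure is determined by its values on intervals, and the rescaled
    image measure has the right values there. *)
Lemma lebesgue_affine (c b : R) (A : set (measurableTypeR R)) :
  c != 0 -> measurable A ->
  (lebesgue_measure A =
   `|c|%:E * pushforward lebesgue_measure (affine1 c b) A)%E.
Proof.
move=> c0 mA.
have [p pE] : exists p : {measure set (measurableTypeR R) -> \bar R},
    p = pushforward lebesgue_measure (affine1 c b) :> (set _ -> \bar R).
  have mf := measurable_affine1 c b.
  by exists (measure_function_pushforward__canonical__measure_function_Measure
    lebesgue_measure mf).
pose m := mscale (NngNum (normr_ge0 c)) p.
have mE X : m X = (`|c|%:E * pushforward lebesgue_measure (affine1 c b) X)%E.
  by rewrite -pE.
rewrite -mE; apply: lebesgue_measure_unique => // _ [[x y] _ <-].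
apply: etrans (esym (mE _)); rewrite /pushforward /=.
have [clt0|cgt0|ceq0] := ltgtP c 0; last by rewrite ceq0 eqxx in c0.
- have -> : affine1 c b @^-1` `]x, y]%classic = `[(y - b) / c, (x - b) / c[%classic.
    apply/seteqP; split => z /=; rewrite /affine1 !in_itv/= ler_ndivrMr// ltr_ndivlMr//; lra.
  rewrite !lebesgue_measure_itv/= !lte_fin ltr_nM2r ?invr_lt0//.
  rewrite ltrD2r; case: ifPn => _; rewrite ?mule0//.
  by rewrite -!EFinD -EFinM; congr EFin; rewrite (ltr0_norm clt0); field.
- have -> : affine1 c b @^-1` `]x, y]%classic = `](x - b) / c, (y - b) / c]%classic.
    apply/seteqP; split => z /=; rewrite /affine1 !in_itv/= ler_pdivlMr// ltr_pdivrMr//; lra.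
  rewrite !lebesgue_measure_itv/= !lte_fin ltr_pM2r ?invr_gt0//.
  rewrite ltrD2r; case: ifPn => _; rewrite ?mule0//.
  by rewrite -!EFinD -EFinM; congr EFin; rewrite (gtr0_norm cgt0); field.
Qed.

Lemma integral_lebesgue_affine (c b : R) (f : R -> \bar R) : c != 0 ->
  measurable_fun [set: measurableTypeR R] f -> (forall x, 0 <= f x)%E ->
  (\int[lebesgue_measure]_x f x =
   `|c|%:E * \int[lebesgue_measure]_x f ((c * x + b)%R))%E.
Proof.
move=> c0 mf f0.
have mcb := measurable_affine1 c b.
have := @ge0_integral_pushforward _ _ _ _ _ _ mcb lebesgue_measure setT f
  measurableT mf (fun x _ => f0 x).
rewrite preimage_setT => <-.
pose p := measure_function_pushforward__canonical__measure_function_Measure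
  lebesgue_measure mcb.
rewrite -[X in (_ = _ * X)%E]/(\int[p]_x f x)%E.
apply: etrans (@ge0_integral_mscale _ _ _ p setT measurableT
  (NngNum (normr_ge0 c)) f mf (fun x _ => f0 x)).
apply: eq_measure_integral => A mA _.
exact: lebesgue_affine.
Qed.

Lemma rv_consEl n (a : R) (v : 'rV[R]_n) (i : 'I_1) :
  rv_cons (a, v) 0 (lshift n i : 'I_(1 + n)) = a.
Proof. by apply: (etrans (row_mxEl _ _ _ _)); rewrite ord1 mxE mulr1n. Qed.

Lemma rv_consEr n (a : R) (v : 'rV[R]_n) i :
  rv_cons (a, v) 0 (rshift 1 i : 'I_(1 + n)) = v 0 i.
Proof. exact: row_mxEr. Qed.

Lemma rv_cons_affine n (c : R) (b : 'rV[R]_n.+1) a v :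
  c *: rv_cons (a, v) + b =
  rv_cons ((c * a + b 0 0)%R, c *: v + rsubmx (b : 'rV[R]_(1 + n))).
Proof.
rewrite -[LHS]rv_unconsK; congr rv_cons; rewrite /rv_uncons; congr pair.
  rewrite mxE [in X in X + _]mxE; congr (_ * _ + _).
  have -> : 0 = lshift n 0 :> 'I_(1 + n) by exact: val_inj.
  exact: rv_consEl.
rewrite linearD linearZ /=; congr (_ *: _ + _).
by rewrite /rv_cons/= row_mxKr.
Qed.

Lemma measurable_affine n (c : R) (b : 'rV[R]_n) :
  measurable_fun setT (fun x : 'rV[R]_n => c *: x + b).
Proof.
apply: measurable_fun_rvP => i.
rewrite (_ : _ \o _ = (fun x : 'rV[R]_n => c * rv_coord i x + b 0 i)); last first.
  by apply/funext => x; rewrite /rv_coord/= !mxE.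
apply: measurable_funD => //; apply: measurable_funM => //.
exact: measurable_rv_coord.
Qed.

(** By Tonelli the coordinates can be changed one at a time, so the factor
    |c| of the real line appears n times. *)
Lemma integral_leb_affine n (c : R) (b : 'rV[R]_n) (f : 'rV[R]_n -> \bar R) :
  c != 0 -> measurable_fun setT f -> (forall x, 0 <= f x)%E ->
  (\int[leb R n]_x f x =
   (`|c| ^+ n)%:E * \int[leb R n]_x f ((c *: x + b)%R))%E.
Proof.
move=> c0; elim: n => [|n IH] in b f *; move=> mf f0.
  rewrite expr0 mul1e; apply: eq_integral => x _; congr f.
  by rewrite [LHS]thinmx0 [RHS]thinmx0.
have mcons (g : 'rV[R]_n.+1 -> \bar R) : measurable_fun setT g ->
  measurable_fun setT (g \o @rv_cons R n).
  by move=> mg; apply: measurableT_comp => //; exact: measurable_rv_cons.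
have mfa : measurable_fun setT (fun x : 'rV[R]_n.+1 => f (c *: x + b)).
  apply: (@measurableT_comp _ _ _ _ _ _ f) => //; exact: measurable_affine.
rewrite !integral_leb_cons//.
pose F a := (\int[leb R n]_v f (rv_cons (a, v)))%E.
have mF : measurable_fun [set: measurableTypeR R] F.
  apply: (@measurable_fun_fubini_tonelli_F _ _ _ _ _ (leb R n) (f \o @rv_cons R n)).
    exact: mcons.
  by move=> x; exact: f0.
rewrite -/F (@integral_lebesgue_affine c (b 0 0) F)//; last first.
  by move=> x; apply: integral_ge0 => v _; exact: f0.
have -> : (fun x : R => F (c * x + b 0 0)) =
  (fun x => (`|c| ^+ n)%:E * \int[leb R n]_v f ((c *: rv_cons (x, v) + b)%R))%E.
  apply/funext => x; rewrite /F (IH (rsubmx (b : 'rV[R]_(1 + n)))); last 2 first.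
  - exact: (measurable_fun_pair2 (_ : measurableTypeR R) (mcons f mf)).
  - by move=> v; exact: f0.
  by congr (_ * _)%E; apply: eq_integral => v _; rewrite rv_cons_affine.
rewrite ge0_integralZl_EFin//; last 2 first.
- by move=> x _; apply: integral_ge0 => v _; exact: f0.
- apply: (@measurable_fun_fubini_tonelli_F _ _ _ _ _ (leb R n)
    (fun p : measurableTypeR R * 'rV[R]_n => f (c *: rv_cons p + b))).
    exact: (mcons (fun x : 'rV[R]_n.+1 => f (c *: x + b))).
  by move=> x; exact: f0.
by rewrite muleA -EFinM -exprS.
Qed.

Definition cube n (M : R) : set 'rV[R]_n := [set x | forall i, `|x 0 i| <= M].

Lemma measurable_coord_set n (i : 'I_n) (A : set (measurableTypeR R)) :
  measurable A -> measurable [set x : 'rV[R]_n | A (x 0 i)].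
Proof.
by move=> mA; rewrite -[X in measurable X]setTI; exact: measurable_rv_coord.
Qed.

Lemma measurable_coords_set n (A : 'I_n -> set (measurableTypeR R)) :
  (forall i, measurable (A i)) ->
  measurable [set x : 'rV[R]_n | forall i, A i (x 0 i)].
Proof.
move=> mA.
rewrite (_ : mkset _ =
    \bigcap_(i in [set` 'I_n]) [set x : 'rV[R]_n | A i (x 0 i)]); last first.
  by apply/seteqP; split => x /= Ax i; [move=> _|]; exact: Ax.
apply: fin_bigcap_measurable => // i _; exact: measurable_coord_set.
Qed.

Lemma measurable_cube n M : measurable (@cube n M).
Proof.
apply: (@measurable_coords_set n (fun=> [set y | `|y| <= M])) => i.
rewrite (_ : mkset _ = `[- M, M]%classic) ?measurable_itv//.
by apply/seteqP; split => x /=; rewrite in_itv/= ler_norml.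
Qed.

Lemma leb_cube_lty n M : (leb R n (@cube n M) < +oo)%E.
Proof.
elim: n => [|n IH]; first by rewrite /= diracE; case: (_ \in _); rewrite ?ltry.
rewrite /= /leb_step /pushforward.
rewrite (_ : _ @^-1` _ = [set y : measurableTypeR R | `|y| <= M] `*` @cube n M); last first.
  apply/seteqP; split => [[a v]|[a v]] /=.
    move=> H; split => [|i] /=.
      by have := H (lshift n 0 : 'I_(1 + n)); rewrite rv_consEl.
    by have := H (rshift 1 i : 'I_(1 + n)); rewrite rv_consEr.
  move=> [/= aM vM] i; case: (split_ordP (i : 'I_(1 + n))) => j ->.
    by rewrite rv_consEl.
  by rewrite rv_consEr.
have -> : [set y : measurableTypeR R | `|y| <= M] = `[- M, M]%classic.
  by apply/seteqP; split => x /=; rewrite in_itv/= ler_norml.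
rewrite product_measure1E//; last exact: measurable_cube.
have L : (lebesgue_measure ([set` `[- M, M]%R] : set (measurableTypeR R)) < +oo)%E.
  by rewrite lebesgue_measure_itv/=; case: ifP => _; rewrite ?ltry.
by apply: lte_mul_pinfty => //; rewrite ge0_fin_numE.
Qed.

End leb_integral.

(** * Boxes and Borel sets *)

Section boxes.
Context {R : realType} {n : nat}.
Implicit Types (a b x : 'rV[R]_n) (U : set 'rV[R]_n).

Definition obox a b : set 'rV[R]_n := [set x | forall i, a 0 i < x 0 i < b 0 i].
Definition cbox a b : set 'rV[R]_n := [set x | forall i, a 0 i <= x 0 i <= b 0 i].

Lemma oboxI a b a' b' : obox a b `&` obox a' b' =
  obox (\row_i Num.max (a 0 i) (a' 0 i)) (\row_i Num.min (b 0 i) (b' 0 i)).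
Proof.
apply/seteqP; split => x /=.
  move=> [H H'] i; rewrite !mxE gt_max lt_min.
  by have /andP[-> ->] := H i; have /andP[-> ->] := H' i.
move=> H; split => i; have := H i; rewrite !mxE gt_max lt_min;
  by move=> /andP[/andP[? ?] /andP[? ?]]; apply/andP.
Qed.

Lemma measurable_obox a b : measurable (obox a b).
Proof.
rewrite (_ : obox a b = [set x : 'rV[R]_n | forall i, `]a 0 i, b 0 i[%classic (x 0 i)]).
  by apply: (@measurable_coords_set R n (fun i => `]a 0 i, b 0 i[%classic)) => i; exact: measurable_itv.
by apply/seteqP; split => x /= H i; have := H i; rewrite in_itv.
Qed.

Lemma sub_obox_cbox a b : obox a b `<=` cbox a b.
Proof. by move=> x H i; have /andP[/ltW-> /ltW->] := H i. Qed.

(** The boxes with rational corners whose closure stays in U do the job; the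
    closed boxes are needed later, to have bump functions compactly supported in U. *)
Lemma open_box_cover U : open U -> exists F : nat -> set 'rV[R]_n,
  U = \bigcup_k F k /\
  forall k, F k = set0 \/ exists a b, F k = obox a b /\ cbox a b `<=` U.
Proof.
move=> oU.
pose rv (p : 'rV[rat]_n) : 'rV[R]_n := map_mx ratr p.
pose F k := if (unpickle k : option ('rV[rat]_n * 'rV[rat]_n)) is Some (p, q)
  then if `[< cbox (rv p) (rv q) `<=` U >] then obox (rv p) (rv q) else set0 else set0.
have FP k : F k = set0 \/ exists a b, F k = obox a b /\ cbox a b `<=` U.
  rewrite /F; case: unpickle => [[p q]|]; last by left.
  case: asboolP => sU; last by left.
  by right; exists (rv p), (rv q).
exists F; split => //; apply/seteqP; split => x.
  move=> Ux; have /nbhs_ballP[e /= e0 eU] := open_nbhs_nbhs (conj oU Ux).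
  have /choice[p Hp] : forall i, exists p : rat, x 0 i - e / 2 < ratr p < x 0 i.
    move=> i; have /rat_in_itvoo[p] : x 0 i - e / 2 < x 0 i by lra.
    by rewrite in_itv/= => Hp; exists p.
  have /choice[q Hq] : forall i, exists p : rat, x 0 i < ratr p < x 0 i + e / 2.
    move=> i; have /rat_in_itvoo[q] : x 0 i < x 0 i + e / 2 by lra.
    by rewrite in_itv/= => Hq; exists q.
  exists (pickle (\row_i p i, \row_i q i)) => //.
  rewrite /F pickleK asboolT; last first.
    move=> y Hy; apply: eU; split => // i j; rewrite [i]ord1.
    have := Hy j; rewrite !mxE => /andP[Hy1 Hy2].
    have /andP[? ?] := Hp j; have /andP[? ?] := Hq j.
    by rewrite /ball/= ltr_norml; apply/andP; split; lra.
  by move=> i; rewrite !mxE; have /andP[_ ->] := Hp i; have /andP[-> _] := Hq i.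
move=> [k _]; case: (FP k) => [->//|[a [b [-> sU]]]] /sub_obox_cbox; exact: sU.
Qed.

Definition oboxes : set (set 'rV[R]_n) := [set obox ab.1 ab.2 | ab in setT].

Lemma oboxes_open U : open U -> <<s oboxes >> U.
Proof.
move=> /open_box_cover[F [-> FP]].
apply: sigma_algebra_bigcup => k.
case: (FP k) => [->|[a [b [-> _]]]]; first exact: sigma_algebra0.
by apply: sub_sigma_algebra; exists (a, b).
Qed.

Lemma open_gt_coord (i : 'I_n) (y : R) : open [set x : 'rV[R]_n | y < x 0 i].
Proof.
apply: (@open_comp _ _ (fun x : 'rV[R]_n => x 0 i) [set z | y < z]).
  by move=> x _; exact: coord_continuous.
exact: open_gt.
Qed.

(** The half-spaces that generate the Borel sets are open, hence countable
    unions of open boxes. *)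
Lemma measurable_oboxes : @measurable _ 'rV[R]_n = <<s oboxes >>.
Proof.
apply/seteqP; split; last first.
  apply: smallest_sub; first exact: sigma_algebra_measurable.
  by move=> _ [[a b] _ <-]; exact: measurable_obox.
apply: smallest_sub; first exact: smallest_sigma_algebra.
rewrite -bigcup_seq => B [i _] [C mC <-]; rewrite setTI.
have : measurable_fun setT (fun x : g_sigma_algebraType oboxes =>
    (x : 'rV[R]_n) 0 i : measurableTypeR R).
  apply: (measurability _ (RGenOInfty.measurableE R)).
  move=> _ [_ [y ->] <-]; rewrite setTI.
  rewrite (_ : _ @^-1` _ = [set x : 'rV[R]_n | y < x 0 i]); last first.
    by apply/seteqP; split => x /=; rewrite in_itv/= andbT.
  by apply: (@oboxes_open [set x : 'rV[R]_n | y < x 0 i]); exact: open_gt_coord.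
by move=> /(_ measurableT C mC); rewrite setTI.
Qed.

Lemma open_measurable_rv U : open U -> measurable U.
Proof. by rewrite measurable_oboxes; exact: oboxes_open. Qed.

Lemma continuous_measurable_rv (f : 'rV[R]_n -> R) : continuous f ->
  measurable_fun setT (f : 'rV[R]_n -> measurableTypeR R).
Proof.
move=> cf; apply: (measurability _ (RGenOInfty.measurableE R)).
move=> _ [_ [y ->] <-]; rewrite setTI; apply: open_measurable_rv.
apply: open_comp; first by move=> x _; exact: cf.
by rewrite (_ : `]y, +oo[%classic = [set z | y < z]);
  [exact: open_gt|apply/seteqP; split => x /=; rewrite in_itv/= andbT].
Qed.

Lemma setI_closed_oboxes : setI_closed oboxes.
Proof.
move=> _ _ [[a b] _ <-] [[a' b'] _ <-]; rewrite /= oboxI.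
by exists (\row_i Num.max (a 0 i) (a' 0 i), \row_i Num.min (b 0 i) (b' 0 i)).
Qed.

(** Open boxes form a pi-system generating the Borel sets, so vanishing
    integrals over boxes are inherited by every Borel set. *)
Lemma ae_eq0_obox (Q : set 'rV[R]_n) (w : 'rV[R]_n -> R) : measurable Q ->
  (leb R n).-integrable Q (EFin \o w) ->
  (forall a b, (\int[leb R n]_(x in Q `&` obox a b) (w x)%:E = 0)%E) ->
  (\int[leb R n]_(x in Q) (w x)%:E = 0)%E ->
  ae_eq (leb R n) Q (EFin \o w) (cst 0%E).
Proof.
move=> mQ iw wbox w0.
have H A : <<s oboxes >> A -> (\int[leb R n]_(x in Q `&` A) (w x)%:E = 0)%E.
  move: A; apply: (@dynkin_induction _ _ _
    (fun A => \int[leb R n]_(x in Q `&` A) (w x)%:E = 0)%E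
    measurable_oboxes setI_closed_oboxes).
  - by rewrite setIT.
  - by move=> _ [[a b] _ <-].
  - move=> S mS S0; have : (\int[leb R n]_(x in Q `&` S `|` Q `&` ~` S) (w x)%:E = 0)%E.
      by rewrite -setIUr setUv setIT.
    rewrite integral_setU //=.
    + by rewrite S0 add0e.
    + exact: measurableI.
    + by apply: measurableI => //; exact: measurableC.
    + by rewrite -setIUr setUv setIT; exact: measurable_int iw.
    + apply/disj_setPS => x [[_ ?] [_ ]]; exact.
  - move=> F mF tF F0; rewrite setI_bigcupr integral_bigcup//.
    + by apply: eseries0 => k _ _; exact: F0.
    + exact: trivIset_setIl.
    + by move=> k; exact: measurableI.
    + apply: integrableS iw => //.
        by apply: bigcupT_measurable => k; exact: measurableI.
      by move=> x [k _ []].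
apply: integral_ae_eq => // E EQ; rewrite measurable_oboxes => mE.
by have := H E mE; rewrite setIidr// => h; rewrite integral0 -[RHS]h.
Qed.

End boxes.

(** * Smooth bump functions on boxes *)

Section psi.
Context {R : realType}.
Implicit Types (p : {poly R}) (y t : R).

(** The classical flat functions p(1/y) exp(-1/y). Letting the polynomial p vary
    makes the class stable under differentiation, so that smoothness follows from
    a single derivative computation. *)
Definition psi p y : R := if 0 < y then p.[y^-1] * expR (- y^-1) else 0.

Lemma horner_expR_bound p : exists C : R, forall t, 0 <= t -> `|p.[t]| <= C * expR t.
Proof.
exists (\sum_(i < size p) `|p`_i| * (i`!)%:R) => t t0.
rewrite horner_coef mulr_suml; apply: le_trans (ler_norm_sum _ _ _) _.
apply: ler_sum => i _; rewrite normrM -mulrA ler_wpM2l// ger0_norm ?exprn_ge0//.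
case: (i : nat) => [|k].
  by rewrite expr0 fact0 mul1r -(addr0 1) -expR0 addr0 ler_expR.
have := expR_ge1Dxn k t0.
have f0 : 0 < (k.+1`!)%:R :> R by rewrite ltr0n fact_gt0.
move=> H; rewrite mulrC -ler_pdivrMr//; apply: le_trans H; lra.
Qed.

(** Since exp(1/y) dominates every polynomial in 1/y, and in particular the
    polynomial X^2 p, psi p is differentiable at 0 with derivative 0. *)
Lemma psi_quadratic p : exists2 C : R, 0 <= C & forall y, `|psi p y| <= C * y ^+ 2.
Proof.
have [C HC] := horner_expR_bound ('X^2 * p).
have C0 : 0 <= C.
  by have := HC 0 (lexx _); rewrite expR0 mulr1; apply: le_trans.
exists C => // y; rewrite /psi; case: ifPn => y0; last first.
  by rewrite normr0 mulr_ge0// sqr_ge0.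
have := HC y^-1; rewrite invr_ge0 (ltW y0) => /(_ isT).
rewrite hornerM hornerXn normrM (normrM p.[_]) (ger0_norm (expR_ge0 _)) expRN.
have -> : `|y^-1 ^+ 2| = (y ^+ 2)^-1.
  by rewrite ger0_norm ?exprVn// invr_ge0 sqr_ge0.
have y2 : 0 < y ^+ 2 by rewrite exprn_gt0.
by rewrite ler_pdivrMl// ler_pdivrMr ?expR_gt0// mulrCA mulrA.
Qed.

Lemma is_derive_psi p y : is_derive y 1 (psi p) (psi ('X^2 * (p - p^`())) y).
Proof.
have [y0|y0|<-] := ltgtP 0 y.
- apply: (@near_eq_is_derive _ _ _ (fun t : R => p.[t^-1] * expR (- t^-1))).
    by near=> t; rewrite /psi ifT//; near: t; exact: lt_nbhsr.
  have yn : y != 0 by rewrite gt_eqF.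
  have dV : is_derive y 1 (fun t : R => t^-1) (- y ^- 2).
    apply: is_derive_eq (is_deriveV yn (is_derive_id y 1)) _.
    by rewrite /GRing.scale/= mulr1.
  have dp : is_derive y 1 (fun t : R => p.[t^-1]) (p^`().[y^-1] * (- y ^- 2)).
    have dh : is_derive (y^-1) 1 (horner p) (p^`().[y^-1]).
      rewrite derivE derive1E; apply: derivableP; exact: derivable_horner.
    exact: (@is_derive1_comp _ (horner p) _ _ _ _ dh dV).
  have de : is_derive y 1 (fun t : R => expR (- t^-1)) (expR (- y^-1) * (y ^- 2)).
    have dN : is_derive y 1 (fun t : R => - t^-1) (y ^- 2).
      by apply: is_derive_eq; rewrite opprK.
    exact: (@is_derive1_comp _ expR _ _ _ _ (is_derive_expR _) dN).
  apply: is_derive_eq (is_deriveM dp de) _.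
  rewrite /psi y0 hornerM hornerXn hornerD hornerN exprVn /GRing.scale/=.
  ring.
- apply: (@near_eq_is_derive _ _ _ (cst 0)).
    near=> t; rewrite /psi ltNge ltW//.
    by near: t; exact: lt_nbhsl.
  by rewrite /psi ltNge ltW//; exact: is_derive_cst.
- have [C C0 HC] := psi_quadratic p.
  have psi00 q : psi q 0 = 0 by rewrite /psi ltxx.
  rewrite psi00.
  have H : (fun h : R => h^-1 *: ((psi p \o shift 0) (h *: (1:R)) - psi p 0))
      @ 0^' --> (0 : R).
    have C1 : 0 < C + 1 by lra.
    apply/cvgrPdist_le => e e0.
    near=> h; rewrite /= psi00 subr0 addr0 sub0r normrN /GRing.scale/= mulr1.
    have h0 : h != 0 by near: h; exact: nbhs_dnbhs_neq.
    rewrite normrM normfV ler_pdivrMl ?normr_gt0//.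
    apply: le_trans (HC h) _; rewrite -(real_normK (num_real h)) expr2 mulrCA.
    rewrite ler_wpM2l//.
    have he : `|h| <= e / (C + 1).
      by near: h; apply: dnbhs0_le; exact: divr_gt0.
    apply: (@le_trans _ _ ((C + 1) * `|h|)); first by rewrite ler_wpM2r//; lra.
    by rewrite -ler_pdivlMl// mulrC.
  apply: DeriveDef; first by apply/cvg_ex; exists 0.
  by apply: cvg_lim.
Unshelve. all: by end_near. Qed.

End psi.

Section box_bump.
Context {R : realType} {n : nat}.
Implicit Types (f g : 'rV[R]_n -> R) (a b x : 'rV[R]_n) (U : set 'rV[R]_n).

(** The algebra generated by the flat functions of affine functions of one
    coordinate: it contains the bumps below and is closed under partial derivatives. *)
Inductive psi_alg : ('rV[R]_n -> R) -> Prop :=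
| psi_alg_psi p i c d : psi_alg (fun x => psi p (c * x 0 i + d))
| psi_alg_cst c : psi_alg (fun=> c)
| psi_alg_add f g : psi_alg f -> psi_alg g -> psi_alg (fun x => f x + g x)
| psi_alg_mul f g : psi_alg f -> psi_alg g -> psi_alg (fun x => f x * g x).

Lemma is_diff_psi p i c d x : differentiable (fun x : 'rV[R]_n => psi p (c * x 0 i + d)) x /\
  forall v, 'D_v (fun x : 'rV[R]_n => psi p (c * x 0 i + d)) x =
    psi ('X^2 * (p - p^`())) (c * x 0 i + d) * (c * v 0 i).
Proof.
have dl : differentiable (fun x : 'rV[R]_n => c * x 0 i + d) x.
  apply: differentiableD => //; apply: differentiableM => //.
  exact: differentiable_coord.
have dpsi y : derivable (psi p) y 1 by have [] := is_derive_psi p y.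
have D : differentiable (fun x : 'rV[R]_n => psi p (c * x 0 i + d)) x.
  apply: (@differentiable_comp _ _ _ _ _ (psi p)) => //.
  exact/derivable1_diffP.
split => // v.
have -> : 'D_v (fun x : 'rV[R]_n => psi p (c * x 0 i + d)) x =
   'D_1 (fun t : R => psi p (c * (x 0 i + t * v 0 i) + d)) 0.
  rewrite /derive; apply: (f_equal (fun F : R -> R => lim (F @ (0 : R)^'))); apply/funext => h /=.
  by rewrite !mxE addr0 /GRing.scale/= mulr1 mul0r addr0 (addrC _ (x 0 i)).
have dt : is_derive (0:R) 1 (fun t : R => c * (x 0 i + t * v 0 i) + d) (c * v 0 i).
  have H (k m : R) : is_derive (0:R) 1 (fun t : R => k + t * m) m.
    apply: is_derive_eq; rewrite /GRing.scale/=; ring.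
  have := H (c * x 0 i + d) (c * v 0 i).
  by congr (is_derive _ _ _ _); apply/funext => t; ring.
have := @is_derive1_comp _ (psi p) _ _ _ _ (is_derive_psi p _) dt.
by move=> [_]; rewrite mul0r addr0.
Qed.

Lemma psi_alg_diff f : psi_alg f ->
  (forall x, differentiable f x) /\ forall i, psi_alg (partial i f).
Proof.
elim=> [p i c d|c|{}f g Hf [df pf] Hg [dg pg]|{}f g Hf [df pf] Hg [dg pg]].
- split=> [x|j]; first by have [] := is_diff_psi p i c d x.
  rewrite (_ : partial j _ = fun x => psi ('X^2 * (p - p^`())) (c * x 0 i + d) *
    (c * (delta_mx 0 j : 'rV[R]_n) 0 i)); last first.
    by apply/funext => x; have [_] := is_diff_psi p i c d x; exact.
  by apply: psi_alg_mul; constructor.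
- split=> [x|i]; first exact: differentiable_cst.
  rewrite (_ : partial i _ = fun=> 0); first exact: psi_alg_cst.
  by apply/funext => x; rewrite /partial derive_cst.
- split=> [x|i]; first exact: differentiableD.
  rewrite (_ : partial i _ = fun x => partial i f x + partial i g x).
    exact: psi_alg_add.
  by apply/funext => x; rewrite /partial deriveD//; exact: diff_derivable.
- split=> [x|i]; first exact: differentiableM.
  rewrite (_ : partial i _ = fun x => f x * partial i g x + g x * partial i f x).
    by apply: psi_alg_add; apply: psi_alg_mul.
  by apply/funext => x; rewrite /partial deriveM//; exact: diff_derivable.
Qed.

Lemma psi_alg_smooth f : psi_alg f -> smooth f.
Proof.
move=> H s x; suff : psi_alg (foldr partial f s) by move=> /psi_alg_diff[].
by elim: s => //= i s IH; apply: (psi_alg_diff IH).2.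
Qed.

(** As k grows, psi 1 (k y) increases to the indicator of y > 0, so these bumps
    converge to the indicator of the box. *)
Definition box_bump (k : R) a b x : R :=
  \prod_(i < n) (psi 1 (k * x 0 i + - k * a 0 i) * psi 1 (- k * x 0 i + k * b 0 i)).

Lemma psi_alg_box_bump k a b : psi_alg (box_bump k a b).
Proof.
rewrite /box_bump; elim: (index_enum _) => [|i s IH].
  rewrite (_ : (fun _ => _) = fun=> 1); first exact: psi_alg_cst.
  by apply/funext => x; rewrite big_nil.
rewrite (_ : (fun _ => _) = fun x =>
  (psi 1 (k * x 0 i + - k * a 0 i) * psi 1 (- k * x 0 i + k * b 0 i)) *
  \prod_(j <- s) (psi 1 (k * x 0 j + - k * a 0 j) * psi 1 (- k * x 0 j + k * b 0 j))).
  by apply: psi_alg_mul => //; apply: psi_alg_mul; exact: psi_alg_psi.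
by apply/funext => x; rewrite big_cons.
Qed.

Lemma psi1E (y : R) : psi 1 y = if 0 < y then expR (- y^-1) else 0.
Proof. by rewrite /psi hornerC mul1r. Qed.

Lemma psi1_ge0 (y : R) : 0 <= psi 1 y.
Proof. by rewrite psi1E; case: ifP => _ //; exact: expR_ge0. Qed.

Lemma psi1_le1 (y : R) : psi 1 y <= 1.
Proof.
by rewrite psi1E; case: ifPn => // y0; rewrite expR_le1 oppr_le0 invr_ge0 ltW.
Qed.

Lemma psi1_neq0 (y : R) : (psi 1 y != 0) = (0 < y).
Proof. by rewrite psi1E; case: ifPn => _; rewrite ?eqxx// gt_eqF// expR_gt0. Qed.

Lemma box_bump_neq0 k a b x : 0 < k -> box_bump k a b x != 0 -> obox a b x.
Proof.
move=> k0 /prodf_neq0 H i; have := H i isT.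
rewrite mulf_eq0 negb_or !psi1_neq0 !mulNr subr_gt0 addrC subr_gt0.
by rewrite !(ltr_pM2l k0) => /andP[-> ->].
Qed.

Lemma box_bump_ge0 k a b x : 0 <= box_bump k a b x.
Proof. by apply: prodr_ge0 => i _; rewrite mulr_ge0// psi1_ge0. Qed.

Lemma box_bump_le1 k a b x : box_bump k a b x <= 1.
Proof.
apply: prodr_ile1 => i _; rewrite mulr_ge0 ?psi1_ge0//=.
by rewrite mulr_ile1 ?psi1_ge0 ?psi1_le1.
Qed.

Lemma cvg_psi1 (c : R) : psi 1 ((k.+1)%:R * c)%R @[k --> \oo] --> ((0 < c)%R%:R : R).
Proof.
have [c0|c0] := ltP 0 c; last first.
  rewrite (_ : (fun _ => _) = cst 0); first exact: cvg_cst.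
  apply/funext => k; apply/eqP; rewrite -[_ == _]negbK psi1_neq0 -leNgt.
  by rewrite mulr_ge0_le0.
rewrite (_ : (fun _ => _) = (fun k => expR (- (k.+1%:R^-1 * c^-1)))); last first.
  by apply/funext => k; rewrite psi1E pmulr_rgt0// c0 invfM.
rewrite -[1%:R in X in _ --> X]expR0 -oppr0 -(mul0r c^-1).
apply: (@cvg_comp _ _ _ (fun k : nat => - (k.+1%:R^-1 * c^-1)) expR); last exact: continuous_expR.
apply: cvgN; apply: cvgMr_tmp; exact: cvg_harmonic.
Qed.

Lemma cvg_box_bump a b x : box_bump k.+1%:R a b x @[k --> \oo] --> (\1_(obox a b) x : R).
Proof.
have -> : \1_(obox a b) x = \prod_(i < n) ((0 < x 0 i - a 0 i)%R%:R * (0 < b 0 i - x 0 i)%R%:R) :> R.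
  rewrite indicE; have [|] := boolP (x \in obox a b).
    rewrite inE => H; rewrite big1// => i _.
    by have /andP[h1 h2] := H i; rewrite !subr_gt0 h1 h2 mulr1.
  move=> /negP H; apply/esym/eqP/negPn/negP => /prodf_neq0 K; apply: H.
  rewrite inE => i; have := K i isT; rewrite mulf_eq0 negb_or !pnatr_eq0 !eqb0 !negbK.
  by rewrite !subr_gt0.
rewrite /box_bump; elim: (index_enum _) => [|i s IH].
  by under eq_fun do rewrite big_nil; rewrite big_nil; exact: cvg_cst.
under eq_fun do rewrite big_cons; rewrite big_cons.
apply: cvgM => //; apply: cvgM.
  under eq_fun do rewrite mulNr -mulrBr; exact: cvg_psi1.
under eq_fun do rewrite mulNr addrC -mulrBr; exact: cvg_psi1.
Qed.

Lemma closed_cbox a b : closed (cbox a b).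
Proof.
rewrite (_ : cbox a b = \bigcap_(i in [set: 'I_n])
   ((fun x : 'rV[R]_n => x 0 i) @^-1` `[a 0 i, b 0 i]%classic)); last first.
  apply/seteqP; split => x /= H i; [move=> _|]; have := H i; rewrite /= in_itv //=.
  exact.
apply: closed_bigI => i _; apply: closed_comp.
  by move=> x _; exact: coord_continuous.
exact: itv_closed.
Qed.

Lemma compact_cbox a b : compact (cbox a b).
Proof.
rewrite (_ : cbox a b = [set x : 'rV[R]_n | forall i, `[a 0 i, b 0 i]%classic (x ord0 i)]).
  by apply: (@rV_compact _ _ (fun i => `[a 0 i, b 0 i]%classic)) => i; exact: segment_compact.
by apply/seteqP; split => x /= H i; have := H i; rewrite /= in_itv.
Qed.

Lemma test_box_bump (k : R) a b U : 0 < k -> cbox a b `<=` U -> test_function U (box_bump k a b).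
Proof.
move=> k0 sU.
have S : closure [set x | box_bump k a b x != 0] `<=` cbox a b.
  rewrite closureE => x; apply; split; first exact: closed_cbox.
  by move=> y /= /(box_bump_neq0 k0); exact: sub_obox_cbox.
split; first exact/psi_alg_smooth/psi_alg_box_bump.
- apply: subclosed_compact S; last exact: compact_cbox.
  exact: closed_closure.
- exact: subset_trans sU.
Qed.

End box_bump.

(** * Test functions and the fundamental lemma *)

Lemma integrable_mul_bounded d (T : measurableType d) (R : realType)
    (mu : {measure set T -> \bar R}) (D : set T) (w h : T -> R) (M : R) :
  measurable D -> mu.-integrable D (EFin \o w) -> measurable_fun D h ->
  (forall x, D x -> `|h x| <= M) ->
  mu.-integrable D (EFin \o (fun x => w x * h x)).
Proof.
move=> mD iw mh hM.
apply: (@le_integrable _ _ _ mu D mD _ (fun x => M%:E * (w x)%:E)%E).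
- apply/measurable_EFinP; apply: measurable_funM => //.
  by apply/measurable_EFinP; exact: measurable_int iw.
- move=> x Dx /=; rewrite lee_fin !normrM mulrC ler_wpM2r//.
  by apply: le_trans (hM x Dx) _; exact: ler_norm.
- exact: integrableZl.
Qed.

Lemma closure_min (T : topologicalType) (A B : set T) :
  closed B -> A `<=` B -> closure A `<=` B.
Proof. by move=> cB AB; rewrite closureE => x; apply. Qed.

Section test_functions.
Context {R : realType} {n : nat}.
Implicit Types (phi f : 'rV[R]_n -> R) (h x : 'rV[R]_n) (U : set 'rV[R]_n).

Lemma smooth_partial i phi : smooth phi -> smooth (partial i phi).
Proof. by move=> H s x; have := H (rcons s i) x; rewrite foldr_rcons. Qed.

Lemma smooth_differentiable phi x : smooth phi -> differentiable phi x.
Proof. by move=> H; exact: (H [::] x). Qed.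

Lemma smooth_continuous phi : smooth phi -> continuous phi.
Proof. by move=> H x; apply/differentiable_continuous/smooth_differentiable. Qed.

Lemma test_measurable U phi (D : set 'rV[R]_n) : test_function U phi ->
  measurable_fun D (phi : 'rV[R]_n -> measurableTypeR R).
Proof.
case=> sphi _ _; apply: measurable_funTS; apply: continuous_measurable_rv.
exact: smooth_continuous.
Qed.

Lemma test_out U phi x : test_function U phi -> ~ U x -> phi x = 0.
Proof.
case=> _ _ sU nUx; apply/eqP/negPn/negP => px; apply/nUx/sU.
exact: subset_closure.
Qed.

(** A function that vanishes near a point has zero derivative there, so the
    support does not grow. *)
Lemma test_partial U i phi : test_function U phi -> test_function U (partial i phi).
Proof.
case=> sphi cphi sU.
have S : closure [set x | partial i phi x != 0] `<=` closure [set x | phi x != 0].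
  apply: closure_min; first exact: closed_closure.
  move=> x /= px; apply: contrapT => nx.
  have : \forall y \near x, phi y = 0.
    have /(_ _ nx) : open (~` closure [set x | phi x != 0]).
      by apply: closed_openC; exact: closed_closure.
    move=> /= [e e0 H]; exists e => // y /H /= ny.
    by apply/eqP/negPn/negP => py; apply: ny; exact: subset_closure.
  move=> /(near_eq_derive (delta_mx 0 i) (g := cst 0)); rewrite derive_cst.
  by move=> H; rewrite /partial H eqxx in px.
split; first exact: smooth_partial.
- by apply: subclosed_compact S => //; exact: closed_closure.
- exact: subset_trans sU.
Qed.

Lemma test_bounded U phi : test_function U phi ->
  exists2 M : R, 0 <= M & forall x, `|phi x| <= M.
Proof.
case=> sphi cphi _.
have : compact (phi @` closure [set x | phi x != 0]).
  apply: continuous_compact => //; apply: continuous_subspaceT.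
  exact: smooth_continuous.
move=> /compact_bounded[M [_ HM]].
exists (`|M| + 1) => [|x]; first by rewrite addr_ge0.
have [->|px] := eqVneq (phi x) 0; first by rewrite normr0 addr_ge0.
apply: (HM (`|M| + 1)); first by rewrite (le_lt_trans (ler_norm M))// ltrDl.
by exists x => //; exact: subset_closure.
Qed.

Lemma partial_shift i f h : partial i (fun x => f (x - h)) =
  (fun x => partial i f (x - h)).
Proof.
apply/funext => x; rewrite /partial /derive.
apply: (f_equal (fun F : R -> R => lim (F @ (0 : R)^'))); apply/funext => t /=.
by rewrite addrA.
Qed.

Lemma smooth_shift phi h : smooth phi -> smooth (fun x => phi (x - h)).
Proof.
move=> H s x.
have -> : foldr partial (fun x => phi (x - h)) s =
    (fun x => foldr partial phi s (x - h)).
  by elim: s => //= i s ->; rewrite partial_shift.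
apply: (@differentiable_comp _ _ _ _ (fun x : 'rV[R]_n => x - h)); last exact: H.
exact: differentiableB.
Qed.

Lemma test_shift U U' phi h : (forall x, U x -> U' (x + h)) ->
  test_function U phi -> test_function U' (fun x => phi (x - h)).
Proof.
move=> UU' [sphi cphi sU].
pose C := (fun x => x + h) @` closure [set x | phi x != 0].
have cC : compact C.
  apply: continuous_compact => //; apply: continuous_subspaceT => x.
  apply: (@differentiable_continuous _ _ _ x (fun x : 'rV[R]_n => x + h)).
  exact: differentiableD.
have S : closure [set x | phi (x - h) != 0] `<=` C.
  apply: closure_min; first exact: compact_closed.
  move=> x /= px; exists (x - h); last by rewrite subrK.
  exact: subset_closure.
split; first exact: smooth_shift.
- by apply: subclosed_compact S => //; exact: closed_closure.
- by move=> x /S[y /sU Uy <-]; exact: UU'.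
Qed.

(** The fundamental lemma of the calculus of variations: by dominated convergence
    along bumps, w has zero integral over every box whose closure lies in U, hence
    over every Borel subset of such a box. *)
Lemma test_orthogonal_eq0 U (w : 'rV[R]_n -> R) : open U ->
  (leb R n).-integrable U (EFin \o w) ->
  (forall phi, test_function U phi -> \int[leb R n]_(x in U) (w x * phi x) = 0) ->
  ae_eq (leb R n) U (EFin \o w) (cst 0%E).
Proof.
move=> oU iw w0.
have mU : measurable U by exact: open_measurable_rv.
have mw : measurable_fun U w by apply/measurable_EFinP; exact: measurable_int iw.
have box0 a b : cbox a b `<=` U -> (\int[leb R n]_(x in obox a b) (w x)%:E = 0)%E.
  move=> abU; have boxU : obox a b `<=` U by apply: subset_trans abU; exact: sub_obox_cbox.
  have mbox := measurable_obox a b.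
  pose F k x := (w x * box_bump k.+1%:R a b x)%:E.
  have tb k : test_function U (box_bump k.+1%:R a b) by apply: test_box_bump.
  have F0 k : (\int[leb R n]_(x in U) F k x = 0)%E.
    have := w0 _ (tb k); rewrite /Rintegral => H0.
    rewrite -[RHS]/(0%:E) -H0 fineK//.
    apply: integrable_fin_num => //.
    apply: (@integrable_mul_bounded _ _ _ _ U w _ 1) => //.
      by apply: test_measurable; exact: tb.
    by move=> x _; rewrite ger0_norm ?box_bump_ge0 ?box_bump_le1.
  have := @dominated_convergence _ _ _ (leb R n) U mU F
    (fun x => (w x * \1_(obox a b) x)%:E) (fun x => `|(w x)%:E|%E).
  case.
  - move=> k; apply/measurable_EFinP; apply: measurable_funM => //.
    by apply: test_measurable; exact: tb.
  - by apply/measurable_EFinP; apply: measurable_funM => //; exact: measurable_indic.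
  - apply: aeW => x _; apply: cvg_EFin; first by apply: nearW.
    by apply: cvgMl_tmp; exact: cvg_box_bump.
  - exact: integrable_abse.
  - apply: aeW => x k _; rewrite /F /= lee_fin normrM ler_piMr// ger0_norm ?box_bump_ge0//.
    exact: box_bump_le1.
  move=> _ _; under eq_fun do rewrite F0; move=> /(cvg_unique _ (cvg_cst _)) H.
  have <- : U `&` obox a b = obox a b by rewrite setIidr.
  rewrite integral_mkcondr (eq_integral (fun x => (w x * \1_(obox a b) x)%:E)).
    by rewrite -H.
  move=> x _; rewrite patchE indicE; case: ifPn => _; rewrite ?mulr1 ?mulr0//.
have [F [UF FP]] := open_box_cover oU.
suff FQ k : ae_eq (leb R n) (F k) (EFin \o w) (cst 0%E).
  rewrite /ae_eq/= in FQ *.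
  have /ae_foralln := FQ; apply: filterS => x H; rewrite UF => -[k _ Fkx].
  exact: (H k).
case: (FP k) => [->|[a [b [-> abU]]]]; first by apply: aeW => x [].
have boxU : obox a b `<=` U by apply: subset_trans abU; exact: sub_obox_cbox.
apply: ae_eq0_obox; first exact: measurable_obox.
- by apply: integrableS iw => //; exact: measurable_obox.
- move=> a' b'; rewrite oboxI box0// => x H; apply: abU => i.
  have := H i; rewrite !mxE ge_max le_min => /andP[/andP[? ?] /andP[? ?]].
  exact/andP.
- exact: box0.
Qed.

End test_functions.

(** * Square integrable functions *)

Section square_integrable.
Context d (T : measurableType d) (R : realType).
Variables (mu : {measure set T -> \bar R}) (D : set T) (mD : measurable D).
Implicit Types f g : T -> R.

(** Square integrability for an arbitrary measure: the same facts serve for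
    Lebesgue measure on a domain and for the unit interval of times. *)
Definition sqint f : Prop :=
  measurable_fun D f /\ mu.-integrable D (fun x => (f x ^+ 2)%:E).

Lemma sqint_mul f g : sqint f -> sqint g ->
  mu.-integrable D (EFin \o (fun x => f x * g x)).
Proof.
move=> [mf f2] [mg g2].
apply: (@le_integrable _ _ _ mu D mD _ (fun x => (f x ^+ 2)%:E + (g x ^+ 2)%:E)%E).
- by apply/measurable_EFinP; exact: measurable_funM.
- move=> x _ /=; rewrite lee_fin [leRHS]ger0_norm ?addr_ge0 ?sqr_ge0//.
  rewrite ler_norml; apply/andP; split; nra.
- exact: integrableD.
Qed.

Lemma sqint_add f g : sqint f -> sqint g -> sqint (fun x => f x + g x).
Proof.
move=> Hf Hg; have [mf f2] := Hf; have [mg g2] := Hg.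
split; first exact: measurable_funD.
have -> : (fun x => ((f x + g x) ^+ 2)%:E) =
    (fun x => (f x ^+ 2)%:E + (2%:E * (f x * g x)%:E + (g x ^+ 2)%:E))%E.
  by apply/funext => x; rewrite -EFinM -!EFinD; congr EFin; ring.
apply: integrableD => //; apply: integrableD => //.
by apply: integrableZl => //; exact: sqint_mul.
Qed.

Lemma sqint_scale (c : R) f : sqint f -> sqint (fun x => c * f x).
Proof.
move=> [mf f2]; split; first exact: measurable_funM.
have -> : (fun x => ((c * f x) ^+ 2)%:E) = (fun x => (c ^+ 2)%:E * (f x ^+ 2)%:E)%E.
  by apply/funext => x; rewrite -EFinM exprMn.
exact: integrableZl.
Qed.

Lemma sqint_opp f : sqint f -> sqint (fun x => - f x).
Proof.
by move=> /(sqint_scale (-1)); congr sqint; apply/funext => x; rewrite mulN1r.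
Qed.

Lemma sqint_sub f g : sqint f -> sqint g -> sqint (fun x => f x - g x).
Proof. by move=> Hf Hg; apply: sqint_add => //; exact: sqint_opp. Qed.

Lemma sqint_sum (I : Type) (s : seq I) (F : I -> T -> R) :
  (forall i, sqint (F i)) -> sqint (fun x => \sum_(i <- s) F i x).
Proof.
move=> HF; elim: s => [|i s IH].
  split; first by under eq_fun do rewrite big_nil; exact: measurable_cst.
  by under eq_fun do rewrite big_nil expr0n; exact: integrable0.
under eq_fun do rewrite big_cons; exact: sqint_add.
Qed.

Lemma sqint_ae f g : sqint f -> measurable_fun D g ->
  ae_eq mu D f g -> sqint g.
Proof.
move=> [mf f2] mg fg; split => //.
have mg2 : measurable_fun D (fun x => (g x ^+ 2)%:E).
  by apply/measurable_EFinP; exact: measurable_funX.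
apply/integrableP; split => //.
have [mf2 /le_lt_trans] := integrableP _ _ _ f2; apply.
rewrite le_eqVlt; apply/orP; left; apply/eqP.
apply: ge0_ae_eq_integral => //; [exact: measurableT_comp..|].
by move: fg; apply: filterS => x /[apply] ->.
Qed.

Lemma Rintegral_ae (f g : T -> R) : measurable_fun D f -> measurable_fun D g ->
  ae_eq mu D f g -> \int[mu]_(x in D) f x = \int[mu]_(x in D) g x.
Proof.
move=> mf mg fg; congr fine; apply: ae_eq_integral => //; try exact/measurable_EFinP.
by move: fg; apply: filterS => x /[apply] ->.
Qed.

Lemma Rintegral_sqr_eq0 f : sqint f -> \int[mu]_(x in D) (f x ^+ 2) = 0 ->
  ae_eq mu D f (cst 0).
Proof.
move=> [mf f2] f0.
have /ae_eq_integral_abs : measurable_fun D (fun x => (f x ^+ 2)%:E).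
  exact: measurable_int f2.
move=> /(_ mu mD)[+ _] => H.
have : (\int[mu]_(x in D) `|(f x ^+ 2)%:E| = 0)%E.
  rewrite (eq_integral (fun x => (f x ^+ 2)%:E)); last first.
    by move=> x _; rewrite gee0_abs// lee_fin sqr_ge0.
  by rewrite -[RHS]/(0%:E) -f0 fineK//; exact: integrable_fin_num.
move=> /H; apply: filterS => x /[apply] -[] /eqP.
by rewrite sqrf_eq0 => /eqP.
Qed.

Hypothesis muD : (mu D < +oo)%E.

Lemma integrable_cst (c : R) : mu.-integrable D (fun=> c%:E).
Proof.
apply/integrableP; split; first exact: measurable_cst.
by rewrite integral_cst//= lte_mul_pinfty.
Qed.

Lemma sqint_cst (c : R) : sqint (fun=> c).
Proof.
split; first exact: measurable_cst.
exact: integrable_cst.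
Qed.

Lemma sqint_integrable f : sqint f -> mu.-integrable D (EFin \o f).
Proof.
move=> Hf; have := sqint_mul Hf (sqint_cst 1).
by congr integrable; apply/funext => x /=; rewrite mulr1.
Qed.

Lemma sqint_bounded f (M : R) : measurable_fun D f ->
  (forall x, D x -> `|f x| <= M) -> sqint f.
Proof.
move=> mf fM; split => //.
have mf2 : measurable_fun D (fun x => (f x ^+ 2)%:E).
  by apply/measurable_EFinP; exact: measurable_funX.
apply: (@le_integrable _ _ _ mu D mD _ (fun=> (M ^+ 2)%:E)) => //.
  move=> x Dx /=; rewrite lee_fin !ger0_norm ?sqr_ge0//.
  rewrite -(real_normK (num_real (f x))) ler_sqr ?nnegrE// ?fM//.
  by apply: le_trans (fM x Dx); exact: normr_ge0.
exact: integrable_cst.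
Qed.

End square_integrable.

Section riesz_fischer.
Context d (T : measurableType d) (R : realType).
Variables (mu : {measure set T -> \bar R}) (D : set T) (mD : measurable D).
Hypothesis muD : (mu D < +oo)%E.
Variable f : nat -> T -> R.
Hypothesis f2 : forall k, sqint mu D (f k).
Hypothesis fC : forall e, 0 < e -> exists N : nat, forall k l, (N <= k)%N -> (N <= l)%N ->
  \int[mu]_(x in D) ((f k x - f l x) ^+ 2) <= e.

Lemma sqint_subsequence : exists M : nat -> nat,
  (forall j, (M j <= M j.+1)%N) /\
  forall j k i, (M j <= k)%N -> (j <= i)%N ->
    (\int[mu]_(x in D) ((f k x - f (M i) x) ^+ 2)%:E <= (4^-1 ^+ j)%:E)%E.
Proof.
have e0 j : 0 < 4^-1 ^+ j :> R by rewrite exprn_gt0.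
have /choice[N HN] := fun j => fC (e0 j).
pose M j := (j + \sum_(i < j.+1) N i)%N.
have Mnd j : (M j <= M j.+1)%N 
  by rewrite /M [in leqRHS]big_ord_recr/=; apply: leq_add; [exact: leqnSn|exact: leq_addr].
have NM j i : (j <= i)%N -> (N j <= M i)%N.
  move=> ji; rewrite /M; apply: leq_trans (leq_addl _ _).
  have ji' : (j < i.+1)%N by rewrite ltnS.
  by rewrite (bigD1 (Ordinal ji'))//= leq_addr.
exists M; split=> [//|j k i jk ji].
have := HN j k (M i) (leq_trans (NM j j (leqnn _)) jk) (NM _ _ ji).
rewrite -lee_fin /Rintegral fineK//; apply: integrable_fin_num => //.
by have [] := sqint_sub mD (f2 k) (f2 (M i)).
Qed.

(** Riesz-Fischer. Along a subsequence whose successive distances decay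
    geometrically the increments are absolutely summable almost everywhere; the
    limsup of the subsequence is a measurable limit, and Fatou's lemma shows
    that it is the limit in mean square. *)
Lemma sqint_complete : exists2 F, sqint mu D F &
  forall e, 0 < e -> exists N : nat, forall k, (N <= k)%N ->
    \int[mu]_(x in D) ((f k x - F x) ^+ 2) <= e.
Proof.
have [M [Mnd HM]] := sqint_subsequence.
pose g j := f (M j).
have mg j : measurable_fun D (g j) by have [] := f2 (M j).
pose S x := (\sum_(j <oo) `|(g j.+1 x - g j x)|%:E)%E.
have mS j : measurable_fun D (fun x => `|(g j.+1 x - g j x)|%:E).
  by apply/measurable_EFinP/measurableT_comp => //; exact: measurable_funB.
(* by the arithmetic-geometric inequality |d| is at most half of 2^-j + 2^j d^2 *)
have intS j : (\int[mu]_(x in D) `|(g j.+1 x - g j x)|%:E <=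
    ((fine (mu D) + 1) / (2 ^ j.+1)%:R)%:E)%E.
  pose c : R := 2^-1 ^+ j.
  have c0 : 0 < c by rewrite exprn_gt0.
  pose h x := ((g j.+1 x - g j x) ^+ 2)%:E.
  have mh : measurable_fun D h.
    by apply/measurable_EFinP/measurable_funX; exact: measurable_funB.
  have h0 x : D x -> (0 <= h x)%E by move=> _; rewrite lee_fin sqr_ge0.
  have mch : measurable_fun D (fun x => (c^-1 / 2)%:E * h x)%E.
    by apply: emeasurable_funM.
  have ch0 x : D x -> (0 <= (c^-1 / 2)%:E * h x)%E.
    by move=> Dx; rewrite mule_ge0 ?h0// lee_fin divr_ge0// invr_ge0 ltW.
  have c20 : 0 <= c / 2 by rewrite divr_ge0// ltW.
  apply: (@le_trans _ _ (\int[mu]_(x in D) ((c / 2)%:E + (c^-1 / 2)%:E * h x))%E).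
    apply: ge0_le_integral => //; first exact: emeasurable_funD.
    move=> x _; rewrite /h -EFinM -EFinD lee_fin.
    rewrite -(real_normK (num_real (g j.+1 x - g j x))); set t := `|_|.
    have : 0 <= (c - t) ^+ 2 / c by rewrite divr_ge0 ?sqr_ge0// ltW.
    have -> : (c - t) ^+ 2 / c = 2 * (c / 2 + c^-1 / 2 * t ^+ 2 - t).
      by field; rewrite gt_eqF.
    lra.
  rewrite ge0_integralD// integral_cst// ge0_integralZl_EFin//; last first.
    by rewrite divr_ge0// invr_ge0 ltW.
  apply: (@le_trans _ _ ((c / 2)%:E * mu D + (c^-1 / 2)%:E * (4^-1 ^+ j)%:E)%E).
    rewrite leeD2l// lee_wpmul2l ?lee_fin ?divr_ge0 ?invr_ge0//; first exact: ltW.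
    exact: HM.
  rewrite -[X in (_ * X + _)%E]fineK ?ge0_fin_numE// -!EFinM -EFinD lee_fin.
  have -> : 4^-1 ^+ j = c * c.
    by rewrite /c -exprMn; congr (_ ^+ _); field.
  have -> : (2 ^ j.+1)%:R = 2 * c^-1 :> R.
    by rewrite natrX exprS /c exprVn invrK.
  by rewrite le_eqVlt; apply/orP; left; apply/eqP; field; rewrite gt_eqF.
have SD : (\int[mu]_(x in D) S x < +oo)%E.
  rewrite integral_nneseries//.
  apply: (@le_lt_trans _ _ (\sum_(j <oo) ((fine (mu D) + 1) / (2 ^ j.+1)%:R)%:E)%E).
    by apply: lee_nneseries => [j _ _|j _]; [exact: integral_ge0|exact: intS].
  apply: le_lt_trans (epsilon_trick0 _ _) _; last exact: ltry.
  by rewrite addr_ge0 ?fine_ge0.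
have mSD : measurable_fun D S by apply: ge0_emeasurable_sum.
have S0 x : (0 <= S x)%E by apply: nneseries_ge0.
have iS : mu.-integrable D S.
  apply/integrableP; split => //.
  by under eq_integral do rewrite gee0_abs//.
pose F x := fine (limn_esup (fun j => (g j x)%:E)).
have mF : measurable_fun D F.
  apply: measurableT_comp; first exact: fine_measurable.
  by apply: measurable_fun_limn_esup => j; exact/measurable_EFinP.
have gF : {ae mu, forall x, D x -> g j x @[j --> \oo] --> F x}.
  have := integrable_ae mD iS; apply: filterS => x Sx Dx.
  have {}Sx := Sx Dx.
  have cg : cvgn (fun j => g j x).
    have : cvgn (series (fun j => g j.+1 x - g j x)).
      apply: normed_cvg; apply: nondecreasing_is_cvgn.
        by apply: nondecreasing_series => k _ _; exact: normr_ge0.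
      exists (fine (S x)) => _ [k _ <-]; rewrite -lee_fin fineK//.
      rewrite /= /series/= -sumEFin; exact: nneseries_lim_ge.
    rewrite (telescopeK (fun j => g j x)) => cgg.
    rewrite (_ : (fun j => g j x) = (fun j => (g j x - g 0%N x) + g 0%N x)).
      by apply: is_cvgD; [exact: cgg|exact: is_cvg_cst].
    by apply/funext => j; rewrite subrK.
  have := cg => /cvg_ex[l gl].
  have gE : (g j x)%:E @[j --> \oo] --> l%:E by apply: cvg_EFin => //; apply: nearW.
  rewrite /F is_cvg_limn_esupE; last by apply/cvg_ex; exists l%:E.
  by rewrite (cvg_lim _ gE).
have key j k : (M j <= k)%N ->
    (\int[mu]_(x in D) ((f k x - F x) ^+ 2)%:E <= (4^-1 ^+ j)%:E)%E.
  move=> jk.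
  have mh i : measurable_fun D (fun x => ((f k x - g i x) ^+ 2)%:E).
    apply/measurable_EFinP/measurable_funX; apply: measurable_funB => //.
    by have [] := f2 k.
  have F0 i x : D x -> (0 <= ((f k x - g i x) ^+ 2)%:E)%E.
    by move=> _; rewrite lee_fin sqr_ge0.
  rewrite (@ge0_ae_eq_integral _ _ _ mu D _
    (fun x => limn_einf (fun i => ((f k x - g i x) ^+ 2)%:E))) //.
  - apply: le_trans (fatou mu mD mh F0) _.
    rewrite limn_einf_lim; apply: lime_le; first exact: is_cvg_einfs.
    apply: nearW => i; apply: (@le_trans _ _ (\int[mu]_(x in D) ((f k x - g (maxn i j) x) ^+ 2)%:E)%E).
      by apply: ereal_inf_lbound; exists (maxn i j) => //=; exact: leq_maxl.
    by apply: HM => //; exact: leq_maxr.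
  - apply/measurable_EFinP/measurable_funX; apply: measurable_funB => //.
    by have [] := f2 k.
  - rewrite (_ : (fun x => limn_einf _) = (fun x =>
        - limn_esup (fun i => - ((f k x - g i x) ^+ 2)%:E))%E).
      apply: measurableT_comp => //; apply: measurable_fun_limn_esup => i.
      exact: measurableT_comp.
    by apply/funext => x; apply: oppe_inj; rewrite -limn_esupN.
  - by move=> x _; rewrite lee_fin sqr_ge0.
  - move=> x Dx; rewrite limn_einf_lim; apply: lime_ge; first exact: is_cvg_einfs.
    apply: nearW => i; apply: le_ereal_inf_tmp => _ [l _ <-]; exact: F0.
  - move: gF; apply: filterS => x /[apply] gFx.
    have H : ((f k x - g i x) ^+ 2)%:E @[i --> \oo] --> ((f k x - F x) ^+ 2)%:E.
      apply: cvg_EFin; first exact: nearW.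
      by rewrite !expr2; apply: cvgM; apply: cvgB => //; exact: cvg_cst.
    rewrite is_cvg_limn_einfE; last by apply/cvg_ex; eexists; exact: H.
    by rewrite (cvg_lim _ H).
have kD k : measurable_fun D (fun x => f k x - F x).
  by apply: measurable_funB => //; have [] := f2 k.
have key2 j k : (M j <= k)%N -> sqint mu D (fun x => f k x - F x).
  move=> jk; split => //; apply/integrableP; split.
    by apply/measurable_EFinP/measurable_funX.
  under eq_integral do rewrite gee0_abs ?lee_fin ?sqr_ge0//.
  by apply: le_lt_trans (key _ _ jk) _; rewrite ltry.
exists F.
  have := sqint_sub mD (f2 (M 0%N)) (key2 0%N _ (leqnn _)).
  by congr sqint; apply/funext => x; rewrite subKr.
move=> e e0.
have /cvgrPdist_le/(_ _ e0)[j _ Hj] : (4^-1 ^+ j : R) @[j --> \oo] --> (0 : R).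
  by apply: cvg_expr; rewrite ger0_norm// invf_lt1// ltr1n.
exists (M j) => k jk.
have [_ ik] := key2 _ _ jk.
rewrite -lee_fin /Rintegral fineK; last exact: integrable_fin_num ik.
apply: le_trans (key _ _ jk) _; rewrite lee_fin.
have := Hj j (leqnn _); rewrite /= sub0r normrN ger0_norm//.
Qed.

End riesz_fischer.

(** * Weak gradients and the Sobolev space *)

(** A nonnegative quadratic polynomial has nonpositive discriminant: the source of
    the Cauchy-Schwarz inequalities and of the first-order conditions satisfied by
    minimizers. *)
Lemma quadratic_discr (R : realFieldType) (A B C : R) : 0 <= C ->
  (forall t, 0 <= A + 2 * t * B + t ^+ 2 * C) -> B ^+ 2 <= A * C.
Proof.
move=> C0 H; have [C00|Cn0] := eqVneq C 0.
  have [->|B0] := eqVneq B 0; first by rewrite expr0n C00 mulr0.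
  have := H (- (A + 1) / (2 * B)); rewrite C00 mulr0 addr0.
  have -> : A + 2 * (- (A + 1) / (2 * B)) * B = -1 by field.
  by rewrite ler0N1.
have Cp : 0 < C by rewrite lt_def Cn0.
have := H (- B / C).
have -> : A + 2 * (- B / C) * B + (- B / C) ^+ 2 * C = A - B ^+ 2 / C by field.
by rewrite subr_ge0 ler_pdivrMr.
Qed.

Section inner_product.
Context d (T : measurableType d) (R : realType).
Variables (mu : {measure set T -> \bar R}) (D : set T) (mD : measurable D).
Implicit Types f g h : T -> R.

Definition ip f g : R := \int[mu]_(x in D) (f x * g x).

Lemma ipC f g : ip f g = ip g f.
Proof. by rewrite /ip; under eq_Rintegral do rewrite mulrC. Qed.

Lemma ipDl f g h : sqint mu D f -> sqint mu D g -> sqint mu D h ->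
  ip (fun x => f x + g x) h = ip f h + ip g h.
Proof.
move=> Hf Hg Hh; rewrite /ip; under eq_Rintegral do rewrite mulrDl.
by rewrite RintegralD//; exact: sqint_mul.
Qed.

Lemma ipZl c f h : sqint mu D f -> sqint mu D h ->
  ip (fun x => c * f x) h = c * ip f h.
Proof.
move=> Hf Hh; rewrite /ip; under eq_Rintegral do rewrite -mulrA.
by rewrite RintegralZl//; exact: sqint_mul.
Qed.

Lemma ipBl f g h : sqint mu D f -> sqint mu D g -> sqint mu D h ->
  ip (fun x => f x - g x) h = ip f h - ip g h.
Proof.
move=> Hf Hg Hh; rewrite /ip; under eq_Rintegral do rewrite mulrBl.
by rewrite RintegralB//; exact: sqint_mul.
Qed.

Lemma ip_ge0 f : 0 <= ip f f.
Proof. by apply: Rintegral_ge0 => x _; rewrite -expr2 sqr_ge0. Qed.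

Lemma ip_eq0 f : sqint mu D f -> ip f f = 0 -> ae_eq mu D f (cst 0).
Proof. by move=> Hf H; apply: Rintegral_sqr_eq0. Qed.

Lemma ip_ae f f' g : sqint mu D f -> sqint mu D f' -> sqint mu D g ->
  ae_eq mu D f f' -> ip f g = ip f' g.
Proof.
move=> [mf _] [mf' _] [mg _] ff'; apply: Rintegral_ae => //.
- exact: measurable_funM.
- exact: measurable_funM.
- by move: ff'; apply: filterS => x /[apply] ->.
Qed.

Lemma ip_cauchy_schwarz f g : sqint mu D f -> sqint mu D g ->
  ip f g ^+ 2 <= ip f f * ip g g.
Proof.
move=> Hf Hg; apply: quadratic_discr; first exact: ip_ge0.
move=> t; have Htg := sqint_scale mD t Hg; have Hs := sqint_add mD Hf Htg.
have := ip_ge0 (fun x => f x + t * g x); rewrite ipDl//.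
rewrite [ip f _]ipC [ip (fun x => t * g x) _]ipC !ipDl// !(ipC _ (fun x => t * _)).
rewrite !ipZl// [ip g f]ipC (ipC g (fun x => t * g x)) ipZl//.
congr (_ <= _); ring.
Qed.

End inner_product.

Section W12.
Context {R : realType} {n : nat}.
Variable B : set 'rV[R]_n.
Hypotheses (oB : open B) (muB : (leb R n B < +oo)%E).
Implicit Types (u v : 'rV[R]_n -> R) (G H : 'rV[R]_n -> 'rV[R]_n).

Let mB : measurable B. Proof. exact: open_measurable_rv. Qed.

Local Notation sq := (sqint (leb R n) B).
Local Notation ipB := (ip (leb R n) B).

Lemma test_sqint phi : test_function B phi -> sq phi.
Proof.
move=> tphi; have [M _ HM] := test_bounded tphi.
by apply: (@sqint_bounded _ _ _ _ _ mB muB _ M) => //; exact: test_measurable tphi.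
Qed.

Lemma weak_gradient_lin (c : R) u v G H : sq u -> sq v ->
  weak_gradient B u G -> weak_gradient B v H ->
  weak_gradient B (fun x => c * u x + v x) (fun x => c *: G x + H x).
Proof.
move=> Hu Hv wG wH i; have [G2 wGi] := wG i; have [H2 wHi] := wH i.
have E : (fun x => (c *: G x + H x) 0 i) = (fun x => c * G x 0 i + H x 0 i).
  by apply/funext => x; rewrite !mxE.
have cG2 : sq (fun x => c * G x 0 i) by exact: sqint_scale.
split; first by rewrite E; exact: sqint_add.
move=> phi tphi; have s1 := test_sqint tphi.
have s2 := test_sqint (test_partial i tphi).
have cu : sq (fun x => c * u x) by exact: sqint_scale.
have := wGi _ tphi; have := wHi _ tphi.
move=> e1 e2.
rewrite -[LHS]/(ipB (fun x => c * u x + v x) (partial i phi)).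
apply: (@eq_trans _ _ (- ipB (fun x => c * G x 0 i + H x 0 i) phi)); last first.
  by rewrite -E.
rewrite !ipDl// !ipZl//.
have {}e2 : ipB u (partial i phi) = - ipB (fun x => G x 0 i) phi by [].
have {}e1 : ipB v (partial i phi) = - ipB (fun x => H x 0 i) phi by [].
by rewrite e1 e2 mulrN opprD.
Qed.

(** The difference of two weak gradients is orthogonal to every test function. *)
Lemma weak_gradient_unique u G H i :
  weak_gradient B u G -> weak_gradient B u H ->
  ae_eq (leb R n) B (fun x => G x 0 i) (fun x => H x 0 i).
Proof.
move=> wG wH; have [G2 wGi] := wG i; have [H2 wHi] := wH i.
have D2 : sq (fun x => G x 0 i - H x 0 i) by exact: sqint_sub.
have := @test_orthogonal_eq0 R n B (fun x => G x 0 i - H x 0 i) oB.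
move=> /(_ (sqint_integrable mB muB D2)) K.
have {}K := K _; suff /K : forall phi, test_function B phi ->
    \int[leb R n]_(x in B) ((G x 0 i - H x 0 i) * phi x) = 0.
  apply: filterS => x /[apply] /= -[] /eqP; rewrite subr_eq0 => /eqP //.
move=> phi tphi; have s1 := test_sqint tphi.
rewrite -[LHS]/(ipB (fun x => G x 0 i - H x 0 i) phi) ipBl//.
have := wGi _ tphi; rewrite (wHi _ tphi) => /oppr_inj H0.
by rewrite /ip H0 subrr.
Qed.

Lemma wgradP u : W12 B u -> weak_gradient B u (wgrad B u).
Proof. by case=> _ [G wG]; exact: (@xgetPex _ _ [set G | weak_gradient B u G] (ex_intro _ G wG)). Qed.

Lemma wgrad_sq u i : W12 B u -> sq (fun x => wgrad B u x 0 i).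
Proof. by move=> /wgradP/(_ i)[]. Qed.

Lemma W12_sq u : W12 B u -> sq u.
Proof. by case. Qed.

Lemma W12_lin c u v : W12 B u -> W12 B v -> W12 B (fun x => c * u x + v x).
Proof.
move=> Hu Hv; split.
  by apply: sqint_add => //; [apply: sqint_scale => //|]; exact: W12_sq.
exists (fun x => c *: wgrad B u x + wgrad B v x).
apply: weak_gradient_lin; [exact: W12_sq|exact: W12_sq|exact: wgradP|exact: wgradP].
Qed.

Lemma wgrad_lin c u v i : W12 B u -> W12 B v ->
  ae_eq (leb R n) B (fun x => wgrad B (fun x => c * u x + v x) x 0 i)
    (fun x => c * wgrad B u x 0 i + wgrad B v x 0 i).
Proof.
move=> Hu Hv.
have := @weak_gradient_unique (fun x => c * u x + v x) _ _ i (wgradP (W12_lin c Hu Hv))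
  (weak_gradient_lin c (W12_sq Hu) (W12_sq Hv) (wgradP Hu) (wgradP Hv)).
by apply: filterS => x /[apply] ->; rewrite !mxE.
Qed.

Lemma weak_gradient_ae u v G : measurable_fun B v -> sq u -> ae_eq (leb R n) B u v ->
  weak_gradient B u G -> weak_gradient B v G.
Proof.
move=> mv Hu uv wG i; have [G2 wGi] := wG i; split => // phi tphi.
rewrite -wGi//; apply/esym/(@ip_ae _ _ _ (leb R n) B mB u v) => //.
  exact: sqint_ae uv.
exact/test_sqint/test_partial.
Qed.

Lemma Rintegral_sum (I : Type) (s : seq I) (F : I -> 'rV[R]_n -> R) :
  (forall i, (leb R n).-integrable B (EFin \o F i)) ->
  \int[leb R n]_(x in B) (\sum_(i <- s) F i x) =
  \sum_(i <- s) \int[leb R n]_(x in B) F i x.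
Proof.
move=> HF; elim: s => [|i s IH].
  rewrite big_nil; under eq_Rintegral do rewrite big_nil.
  by rewrite Rintegral_cst// mul0r.
rewrite big_cons -IH; under eq_Rintegral do rewrite big_cons.
rewrite RintegralD//.
rewrite (_ : EFin \o _ = fun x => (\sum_(j <- s) (F j x)%:E)%E); last first.
  by apply/funext => x /=; rewrite sumEFin.
by apply: integrable_sum => // j _; exact: HF.
Qed.

Definition grad_ip u v : R :=
  \int[leb R n]_(x in B) dotv (wgrad B u x) (wgrad B v x).

Lemma grad_ipE u v : W12 B u -> W12 B v -> grad_ip u v =
  \sum_(i < n) ipB (fun x => wgrad B u x 0 i) (fun x => wgrad B v x 0 i).
Proof.
move=> Hu Hv; rewrite /grad_ip /dotv Rintegral_sum// => i.
by apply: sqint_mul => //; exact: wgrad_sq.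
Qed.

Lemma grad_ipC u v : grad_ip u v = grad_ip v u.
Proof.
rewrite /grad_ip; apply: eq_Rintegral => x _; apply: eq_bigr => i _.
by rewrite mulrC.
Qed.

Lemma dirichletE u : dirichlet B u = grad_ip u u.
Proof.
rewrite /dirichlet /grad_ip; apply: eq_Rintegral => x _.
rewrite /enorm sqr_sqrtr//; apply: sumr_ge0 => i _.
by rewrite -expr2 sqr_ge0.
Qed.

Lemma grad_ip_ge0 u : 0 <= grad_ip u u.
Proof.
apply: Rintegral_ge0 => x _; apply: sumr_ge0 => i _.
by rewrite -expr2 sqr_ge0.
Qed.

Lemma grad_ip_lin c u v w : W12 B u -> W12 B v -> W12 B w ->
  grad_ip (fun x => c * u x + v x) w = c * grad_ip u w + grad_ip v w.
Proof.
move=> Hu Hv Hw; have Huv := W12_lin c Hu Hv.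
rewrite !grad_ipE// mulr_sumr -big_split/=; apply: eq_bigr => i _.
have su := wgrad_sq i Hu; have sv := wgrad_sq i Hv; have sw := wgrad_sq i Hw.
have scu := sqint_scale mB c su.
rewrite -ipZl// -ipDl//; apply: ip_ae => //; first exact: wgrad_sq.
- exact: sqint_add.
- exact: wgrad_lin.
Qed.

(** The graph of the weak gradient is closed: passing to the limit in the
    defining identity only needs the Cauchy-Schwarz inequality. *)
Lemma weak_gradient_closed u G (uk : nat -> 'rV[R]_n -> R) (Gk : nat -> 'rV[R]_n -> 'rV[R]_n) :
  sq u -> (forall i, sq (fun x => G x 0 i)) ->
  (forall k, sq (uk k)) -> (forall k, weak_gradient B (uk k) (Gk k)) ->
  (forall e, 0 < e -> exists N : nat, forall k, (N <= k)%N ->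
     ipB (fun x => uk k x - u x) (fun x => uk k x - u x) <= e) ->
  (forall i e, 0 < e -> exists N : nat, forall k, (N <= k)%N ->
     ipB (fun x => Gk k x 0 i - G x 0 i) (fun x => Gk k x 0 i - G x 0 i) <= e) ->
  weak_gradient B u G.
Proof.
move=> Hu HG Huk HGk cu cG i; split; [exact: HG|move=> phi tphi].
have s1 := test_sqint tphi; have s2 := test_sqint (test_partial i tphi).
pose a := ipB u (partial i phi); pose b := ipB (fun x => G x 0 i) phi.
suff : a = - b by []; apply/eqP; rewrite -subr_eq0 opprK.
rewrite -sqrf_eq0 eq_le sqr_ge0 andbT; apply/ler_addgt0Pr => e e0; rewrite add0r.
pose A := ipB (partial i phi) (partial i phi); pose C := ipB phi phi.
have A0 : 0 <= A by exact: ip_ge0.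
have C0 : 0 <= C by exact: ip_ge0.
have d0 : 0 < e / (2 * (A + C + 1)) by rewrite divr_gt0//; lra.
have [N1 H1] := cu _ d0; have [N2 H2] := cG i _ d0.
pose k := maxn N1 N2; have {}H1 := H1 k (leq_maxl _ _); have {}H2 := H2 k (leq_maxr _ _).
have [Gk2 /(_ _ tphi) Ek] := HGk k i.
have Du := sqint_sub mB (Huk k) Hu; have DG := sqint_sub mB Gk2 (HG i).
have CS1 := ip_cauchy_schwarz mB Du s2.
have CS2 := ip_cauchy_schwarz mB DG s1.
have E1 : ipB (fun x => uk k x - u x) (partial i phi) = ipB (uk k) (partial i phi) - a.
  by rewrite ipBl.
have E2 : ipB (fun x => Gk k x 0 i - G x 0 i) phi = ipB (fun x => Gk k x 0 i) phi - b.
  by rewrite ipBl.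
rewrite -/(ipB _ _) -[X in - X]/(ipB (fun x => Gk k x 0 i) phi) in Ek.
have Ek' : ipB (uk k) (partial i phi) = - ipB (fun x => Gk k x 0 i) phi by exact: Ek.
rewrite {}E1 Ek' -/A in CS1; rewrite {}E2 -/C in CS2.
move: (ipB _ phi) H1 H2 CS1 CS2 => y.
set p := ipB _ _; set q := ipB _ _ => H1 H2 CS1 CS2.
have K1 : (- y - a) ^+ 2 <= e / (2 * (A + C + 1)) * A by apply: le_trans CS1 _; rewrite ler_wpM2r.
have K2 : (y - b) ^+ 2 <= e / (2 * (A + C + 1)) * C by apply: le_trans CS2 _; rewrite ler_wpM2r.
have -> : a + b = - ((- y - a) + (y - b)) by ring.
rewrite sqrrN.
apply: (@le_trans _ _ (2 * (- y - a) ^+ 2 + 2 * (y - b) ^+ 2)).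
  rewrite -subr_ge0 (_ : _ - _ = ((- y - a) - (y - b)) ^+ 2) ?sqr_ge0//; ring.
apply: (@le_trans _ _ (e / (2 * (A + C + 1)) * (2 * (A + C)))); first by lra.
have -> : e / (2 * (A + C + 1)) * (2 * (A + C)) = e * ((A + C) / (A + C + 1)).
  by field; rewrite gt_eqF//; lra.
by rewrite ler_piMr ?(ltW e0)// ler_pdivrMr; lra.
Qed.

Lemma grad_ip_component u i : W12 B u ->
  ipB (fun x => wgrad B u x 0 i) (fun x => wgrad B u x 0 i) <= grad_ip u u.
Proof.
move=> Hu; rewrite grad_ipE// (bigD1 i)//= lerDl; apply: sumr_ge0 => j _.
exact: ip_ge0.
Qed.

Lemma W12_sub u v : W12 B u -> W12 B v -> W12 B (fun x => u x - v x).
Proof.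
move=> Hu Hv; have := W12_lin (-1) Hv Hu.
by congr (W12 B _); apply/funext => x; rewrite mulN1r addrC.
Qed.

Lemma wgrad_sub u v i : W12 B u -> W12 B v ->
  ae_eq (leb R n) B (fun x => wgrad B (fun x => u x - v x) x 0 i)
    (fun x => wgrad B u x 0 i - wgrad B v x 0 i).
Proof.
move=> Hu Hv; have := wgrad_lin (-1) i Hv Hu.
rewrite (_ : (fun x => -1 * v x + u x) = (fun x => u x - v x)); last first.
  by apply/funext => x; rewrite mulN1r addrC.
by apply: filterS => x /[apply] ->; rewrite mulN1r addrC.
Qed.

(** Mean square limits exist for the functions and for each component of their
    gradients, and closedness identifies the latter as the gradient of the former. *)
Lemma W12_complete (uk : nat -> 'rV[R]_n -> R) : (forall k, W12 B (uk k)) ->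
  (forall e, 0 < e -> exists N : nat, forall k l, (N <= k)%N -> (N <= l)%N ->
     ipB (fun x => uk k x - uk l x) (fun x => uk k x - uk l x) +
     grad_ip (fun x => uk k x - uk l x) (fun x => uk k x - uk l x) <= e) ->
  exists2 u, W12 B u & forall e, 0 < e -> exists N : nat, forall k, (N <= k)%N ->
     ipB (fun x => uk k x - u x) (fun x => uk k x - u x) +
     grad_ip (fun x => uk k x - u x) (fun x => uk k x - u x) <= e.
Proof.
move=> Wuk CC.
have gip (f g : 'rV[R]_n -> R) (i : 'I_n) : W12 B f -> W12 B g ->
    ipB (fun x => wgrad B f x 0 i - wgrad B g x 0 i) (fun x => wgrad B f x 0 i - wgrad B g x 0 i)
    = ipB (fun x => wgrad B (fun x => f x - g x) x 0 i) (fun x => wgrad B (fun x => f x - g x) x 0 i).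
  move=> Hf Hg; have S := wgrad_sq i (W12_sub Hf Hg).
  have S' : sq (fun x => wgrad B f x 0 i - wgrad B g x 0 i).
    by apply: sqint_sub => //; exact: wgrad_sq.
  have E := ae_eq_sym (wgrad_sub i Hf Hg).
  by rewrite (ip_ae _ _ _ _ E)// ipC (ip_ae _ _ _ _ E).
have [u Hu cu] : exists2 u, sq u & forall e, 0 < e -> exists N : nat, forall k, (N <= k)%N ->
    ipB (fun x => uk k x - u x) (fun x => uk k x - u x) <= e.
  apply: sqint_complete => // [k|e e0]; first exact: W12_sq.
  have [N HN] := CC _ e0; exists N => k l Nk Nl; apply: le_trans (HN k l Nk Nl).
  by rewrite lerDl grad_ip_ge0.
have /choice[G HG] : forall i, exists g : 'rV[R]_n -> R, sq g /\
    forall e, 0 < e -> exists N : nat, forall k, (N <= k)%N ->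
    ipB (fun x => wgrad B (uk k) x 0 i - g x) (fun x => wgrad B (uk k) x 0 i - g x) <= e.
  move=> i; suff [g ? ?] : exists2 g, sq g & forall e, 0 < e -> exists N : nat, forall k, (N <= k)%N ->
    ipB (fun x => wgrad B (uk k) x 0 i - g x) (fun x => wgrad B (uk k) x 0 i - g x) <= e by exists g.
  apply: sqint_complete => // [k|e e0]; first exact: wgrad_sq.
  have [N HN] := CC _ e0; exists N => k l Nk Nl; apply: le_trans (HN k l Nk Nl).
  apply: (@le_trans _ _ (grad_ip (fun x => uk k x - uk l x) (fun x => uk k x - uk l x))).
    have := grad_ip_component i (W12_sub (Wuk k) (Wuk l)); rewrite -gip//.
  by rewrite lerDr ip_ge0.
pose GG x : 'rV[R]_n := \row_i G i x.
have GGE i : (fun x => GG x 0 i) = G i by apply/funext => x; rewrite mxE.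
have wG : weak_gradient B u GG.
  apply: (@weak_gradient_closed u GG uk (fun k => wgrad B (uk k))) => //.
  - by move=> i; rewrite GGE; have [] := HG i.
  - by move=> k; exact: W12_sq.
  - by move=> k; exact: wgradP.
  - move=> i e e0; have [_ /(_ _ e0)[N HN]] := HG i; exists N => k /HN.
    suff -> : (fun x => wgrad B (uk k) x 0 i - GG x 0 i) =
        (fun x => wgrad B (uk k) x 0 i - G i x) by [].
    by apply/funext => x; rewrite mxE.
have Wu : W12 B u by split => //; exists GG.
exists u => // e e0.
have d0 : 0 < e / (n%:R + 1) by rewrite divr_gt0// ltr_wpDl.
have [N0 HN0] := cu _ d0.
have /choice[N HN] : forall i, exists N : nat, forall k, (N <= k)%N ->
    ipB (fun x => wgrad B (uk k) x 0 i - wgrad B u x 0 i)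
        (fun x => wgrad B (uk k) x 0 i - wgrad B u x 0 i) <= e / (n%:R + 1).
  move=> i; have [sG /(_ _ d0)[N HN]] := HG i; exists N => k /HN.
  have E : ae_eq (leb R n) B (fun x => wgrad B (uk k) x 0 i - G i x)
      (fun x => wgrad B (uk k) x 0 i - wgrad B u x 0 i).
    have := weak_gradient_unique i wG (wgradP Wu).
    by apply: filterS => x /[apply] <-; rewrite mxE.
  have S1 : sq (fun x => wgrad B (uk k) x 0 i - G i x).
    by apply: sqint_sub => //; exact: wgrad_sq.
  have S2 : sq (fun x => wgrad B (uk k) x 0 i - wgrad B u x 0 i).
    by apply: sqint_sub => //; exact: wgrad_sq.
  by rewrite (ip_ae _ _ _ _ E)// ipC (ip_ae _ _ _ _ E).
exists (maxn N0 (\max_i N i)) => k; rewrite geq_max => /andP[k0 km].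
rewrite grad_ipE; [|exact: W12_sub|exact: W12_sub].
apply: (@le_trans _ _ (e / (n%:R + 1) + \sum_(i < n) (e / (n%:R + 1)))).
  apply: lerD; first exact: HN0.
  apply: ler_sum => i _; rewrite -gip//; apply: HN; apply: leq_trans km.
  exact: leq_bigmax.
rewrite sumr_const card_ord -[in leLHS]mulr_natr le_eqVlt; apply/orP; left.
by apply/eqP; field; rewrite gt_eqF// ltr_wpDl.
Qed.

End W12.

(** * Fubini, translations and segments *)

Section real_fubini.
Context d1 d2 (T1 : measurableType d1) (T2 : measurableType d2) (R : realType).
Variables (m1 : {sigma_finite_measure set T1 -> \bar R})
  (m2 : {sigma_finite_measure set T2 -> \bar R}).
Implicit Types k : T1 * T2 -> R.

Lemma integrable_Rfubini1 k : (m1 \x m2)%E.-integrable setT (EFin \o k) ->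
  m1.-integrable setT (fun x => (\int[m2]_y k (x, y))%:E).
Proof.
move=> ik; have iF := integrable_fubini_F ik.
apply: (@le_integrable _ _ _ m1 setT measurableT _ (fubini_F m2 (EFin \o k))) => //.
- apply/measurable_EFinP; apply: (@measurableT_comp _ _ _ _ _ _ fine).
    exact: fine_measurable.
  exact: measurable_int iF.
- move=> x _; rewrite /Rintegral /fubini_F /=.
  by case: (integral _ _ _) => [r| |] //=; rewrite ?normr0 ?leey.
Qed.

(** The inner real-valued integrals are the finite parts of the extended ones,
    and almost all of the latter are finite. *)
Lemma Rfubini k : (m1 \x m2)%E.-integrable setT (EFin \o k) ->
  \int[m1]_x \int[m2]_y k (x, y) = \int[m2]_y \int[m1]_x k (x, y).
Proof.
move=> ik; have iF := integrable_fubini_F ik.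
congr fine; transitivity (\int[m1]_x fubini_F m2 (EFin \o k) x)%E.
  apply: ae_eq_integral => //.
  - exact: measurable_int (integrable_Rfubini1 ik).
  - exact: measurable_int iF.
  - have := integrable_ae measurableT iF; apply: filterS => x Fx _.
    by rewrite /Rintegral fineK//; exact: (Fx Logic.I).
have mG := measurable_fubini_G ik.
rewrite (Fubini ik); apply: ae_eq_integral => //.
- apply/measurable_EFinP; apply: (@measurableT_comp _ _ _ _ _ _ fine).
    exact: fine_measurable.
  exact: mG.
- have := ae_integrable2 ik; apply: filterS => y iy _.
  by rewrite /Rintegral fineK//; exact: integrable_fin_num.
Qed.

End real_fubini.

Section translation.
Context {R : realType} {n : nat}.
Implicit Types (f phi : 'rV[R]_n -> R) (h x : 'rV[R]_n).

Lemma measurable_translate h : measurable_fun setT (fun x : 'rV[R]_n => x + h).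
Proof.
have := @measurable_affine R n 1 h.
by congr measurable_fun; apply/funext => x; rewrite scale1r.
Qed.

Lemma ge0_integral_translate h (f : 'rV[R]_n -> \bar R) :
  measurable_fun setT f -> (forall x, 0 <= f x)%E ->
  (\int[leb R n]_x f (x + h)%R = \int[leb R n]_x f x)%E.
Proof.
move=> mf f0; rewrite [RHS](@integral_leb_affine R n 1 h)//.
rewrite normr1 expr1n mul1e; apply: eq_integral => x _.
by rewrite scale1r.
Qed.

Lemma integral_translate h (f : 'rV[R]_n -> \bar R) : measurable_fun setT f ->
  (\int[leb R n]_x f (x + h)%R = \int[leb R n]_x f x)%E.
Proof.
move=> mf; rewrite integralE [RHS]integralE.
rewrite -(ge0_integral_translate h (measurable_funepos mf))//.
rewrite -(ge0_integral_translate h (measurable_funeneg mf))//.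
congr (_ - _)%E; apply: eq_integral => x _; first by rewrite !funeposE.
by rewrite !funenegE.
Qed.

Lemma Rintegral_translate h f : measurable_fun setT f ->
  \int[leb R n]_x f (x + h) = \int[leb R n]_x f x.
Proof.
move=> mf; congr fine.
by rewrite (@integral_translate h (EFin \o f))//; exact/measurable_EFinP.
Qed.

Lemma derive_coord phi h x : differentiable phi x ->
  'D_h phi x = \sum_(i < n) h 0 i * partial i phi x.
Proof.
move=> dphi; rewrite deriveE// [in LHS](row_sum_delta h) linear_sum.
by apply: eq_bigr => i _; rewrite linearZ /= /partial deriveE.
Qed.

(** The sign makes this function a primitive of the directional derivative
    along the segment that runs backwards from x. *)
Lemma is_derive_line phi h x (t : R) : differentiable phi (x - t *: h) ->
  is_derive t 1 (fun s : R => - phi (x - s *: h)) ('D_h phi (x - t *: h)).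
Proof.
move=> dphi.
have E : (fun s : R => s^-1 *: (((fun s : R => phi (x - s *: h)) \o shift t) (s *: 1) -
     phi (x - t *: h))) = (fun s : R => s^-1 *: ((phi \o shift (x - t *: h)) (s *: (- h)) -
     phi (x - t *: h))).
  apply/funext => s /=; congr (_ *: (phi _ - _)).
  by rewrite [_ *: 1]mulr1 scalerDl scalerN opprD addrCA.
have D : is_derive t 1 (fun s : R => phi (x - s *: h)) (- 'D_h phi (x - t *: h)).
  apply: DeriveDef.
    by rewrite /derivable E; exact: diff_derivable.
  have -> : 'D_1 (fun s : R => phi (x - s *: h)) t = 'D_(- h) phi (x - t *: h).
    by rewrite /derive E.
  by rewrite !deriveE// linearN.
by rewrite -[X in is_derive _ _ _ X]opprK; exact: is_deriveN.
Qed.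

Lemma integral_line phi h x : smooth phi ->
  \int[lebesgue_measure]_(t in `[0, 1]) 'D_h phi (x - t *: h) = phi x - phi (x - h).
Proof.
move=> sphi.
have dl (t : R) : is_derive t 1 (fun s : R => - phi (x - s *: h)) ('D_h phi (x - t *: h)).
  by apply: is_derive_line; exact: smooth_differentiable.
have cl (f : 'rV[R]_n -> R) : smooth f -> continuous (fun t : R => f (x - t *: h)).
  move=> sf t; apply: (@continuous_comp _ _ _ (fun t : R => x - t *: h) f).
    apply: (@differentiable_continuous _ _ _ t (fun t : R => x - t *: h)).
    by apply: differentiableB => //; exact: differentiableZl.
  exact: smooth_continuous.
have cD : continuous (fun t : R => 'D_h phi (x - t *: h)).
  rewrite (_ : (fun t : R => 'D_h phi (x - t *: h)) =
      fun t => \sum_(i < n) h 0 i * partial i phi (x - t *: h)); last first.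
    by apply/funext => t; rewrite derive_coord//; exact: smooth_differentiable.
  elim: (index_enum _) => [|i s IH] t.
    rewrite (_ : (fun _ => _) = cst 0); first exact: cvg_cst.
    by apply/funext => r; rewrite big_nil.
  rewrite (_ : (fun t : R => \sum_(j <- i :: s) _) = (fun t : R =>
      h 0 i * partial i phi (x - t *: h) +
      \sum_(j <- s) h 0 j * partial j phi (x - t *: h))); last first.
    by apply/funext => r; rewrite big_cons.
  apply: cvgD; last exact: IH.
  by apply: cvgMl_tmp; apply: cl; exact: smooth_partial.
rewrite /Rintegral (@continuous_FTC2 _ _ (fun s : R => - phi (x - s *: h))) //.
- by rewrite /= scale1r scale0r subr0 opprK addrC.
- exact: continuous_subspaceT.
- have cF : continuous (fun s : R => - phi (x - s *: h)).
    by move=> t; apply: cvgN; exact: cl.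
  split.
  + by move=> t _; have [] := dl t.
  + exact: cvg_at_right_filter (cF 0).
  + exact: cvg_at_left_filter (cF 1).
- by move=> t _; rewrite derive1E; have [_ ->] := dl t.
Qed.

End translation.

(** * Integration along segments of a convex set *)

Section measurable_rv.
Context {R : realType} {n : nat} d (T : measurableType d).

Lemma measurable_fun_rvD (f g : T -> 'rV[R]_n) : measurable_fun setT f ->
  measurable_fun setT g -> measurable_fun setT (fun x => f x + g x).
Proof.
move=> mf mg; apply: measurable_fun_rvP => i.
rewrite (_ : _ \o _ = (rv_coord i \o f) \+ (rv_coord i \o g)); last first.
  by apply/funext => x; rewrite /rv_coord /= mxE.
by apply: measurable_funD; apply: measurableT_comp => //; exact: measurable_rv_coord.
Qed.

Lemma measurable_fun_rvZ (k : T -> R) (f : T -> 'rV[R]_n) : measurable_fun setT k ->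
  measurable_fun setT f -> measurable_fun setT (fun x => k x *: f x).
Proof.
move=> mk mf; apply: measurable_fun_rvP => i.
rewrite (_ : _ \o _ = k \* (rv_coord i \o f)); last first.
  by apply/funext => x; rewrite /rv_coord /= mxE.
by apply: measurable_funM => //; apply: measurableT_comp => //; exact: measurable_rv_coord.
Qed.

End measurable_rv.

Section difference.
Context {R : realType} {n : nat}.
Implicit Types (f phi : 'rV[R]_n -> R) (h x : 'rV[R]_n) (t : R).
Local Notation L := (@lebesgue_measure R).
Local Notation I01 := (\1_(`[0, 1]%classic) : R -> R).

Lemma measurable_I01 : measurable_fun [set: measurableTypeR R] I01.
Proof. by apply: measurable_indic; exact: measurable_itv. Qed.

Lemma integrable_I01 : L.-integrable setT (EFin \o I01).
Proof. exact: integrable_indic_itv. Qed.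

Lemma I01_ge0 t : 0 <= I01 t. Proof. by rewrite indicE. Qed.

Lemma measurable_line h : measurable_fun setT
  (fun p : 'rV[R]_n * measurableTypeR R => p.1 + p.2 *: h).
Proof.
apply: measurable_fun_rvD; first exact: measurable_fst.
by apply: measurable_fun_rvZ; [exact: measurable_snd|exact: measurable_cst].
Qed.

Lemma integrable_line f h : (leb R n).-integrable setT (EFin \o f) ->
  (leb R n \x L)%E.-integrable setT
    (EFin \o (fun p : 'rV[R]_n * measurableTypeR R => I01 p.2 * f (p.1 + p.2 *: h))).
Proof.
move=> iff; have mf : measurable_fun setT f by apply/measurable_EFinP; exact: measurable_int iff.
have nf : (0 <= \int[leb R n]_x `|(f x)%:E|)%E.
  by apply: integral_ge0 => x _; rewrite lee_fin.
apply/integrable21ltyP.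
  apply/measurable_EFinP; apply: measurable_funM.
    by apply: measurableT_comp; [exact: measurable_I01|exact: measurable_snd].
  by apply: measurableT_comp => //; exact: measurable_line.
rewrite (_ : (fun t => _) = (fun t => (\int[leb R n]_x `|(f x)%:E|) * (I01 t)%:E)%E).
  rewrite ge0_integralZl//.
  - apply: lte_mul_pinfty => //.
    + by rewrite ge0_fin_numE//; have /integrableP[] := iff.
    + have /integrableP[_] := integrable_I01.
      apply: le_lt_trans; rewrite le_eqVlt; apply/orP; left; apply/eqP.
      by apply: eq_integral => t _; rewrite /= ger0_norm ?I01_ge0.
  - by apply/measurable_EFinP; exact: measurable_I01.
apply/funext => t /=.
under eq_integral do rewrite normrM ger0_norm ?I01_ge0// EFinM.
have mt : measurable_fun setT (fun x : 'rV[R]_n => `|f (x + t *: h)|%:E).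
  apply/measurable_EFinP; apply: measurableT_comp => //.
  apply: (@measurableT_comp _ _ _ _ _ _ f) => //; exact: measurable_translate.
rewrite ge0_integralZl_EFin ?I01_ge0// muleC; congr (_ * _)%E.
apply: (@ge0_integral_translate _ _ (t *: h) (fun x => `|f x|%:E)).
  by apply/measurable_EFinP; exact: measurableT_comp.
by move=> x; rewrite lee_fin.
Qed.

(** Convexity, with the second endpoint given by its displacement h, because
    differences of u are integrated along the segments x + t h. *)
Definition segment_convex (S : set 'rV[R]_n) : Prop :=
  forall x h t, S x -> S (x + h) -> 0 <= t <= 1 -> S (x + t *: h).

Variable B : set 'rV[R]_n.
Hypotheses (oB : open B) (muB : (leb R n B < +oo)%E).
Let mB : measurable B. Proof. exact: open_measurable_rv. Qed.
Local Notation sq := (sqint (leb R n) B).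
Local Notation ipB := (ip (leb R n) B).

Lemma Rintegral_patch f : \int[leb R n]_(x in B) f x = \int[leb R n]_x (f \_ B) x.
Proof. exact: Rintegral_mkcond. Qed.

Lemma integrable_patch f : sq f -> (leb R n).-integrable setT (EFin \o (f \_ B)).
Proof.
move=> sf; have := sqint_integrable mB muB sf.
by rewrite integrable_mkcond//; congr integrable; apply/funext => x; rewrite restrict_EFin.
Qed.

Definition directional h (G : 'rV[R]_n -> 'rV[R]_n) : 'rV[R]_n -> R :=
  fun x => dotv h (G x).

Lemma directional_sq h (G : 'rV[R]_n -> 'rV[R]_n) : (forall i, sq (fun x => G x 0 i)) -> sq (directional h G).
Proof. by move=> sG; apply: sqint_sum => // i; exact: sqint_scale. Qed.

Lemma weak_gradient_directional u G h phi : sq u -> weak_gradient B u G ->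
  test_function B phi ->
  \int[leb R n]_(x in B) (u x * 'D_h phi x) =
  - \int[leb R n]_(x in B) (directional h G x * phi x).
Proof.
move=> su wG tphi; have [sphi _ _] := tphi.
have tsq := test_sqint oB muB tphi.
have psq i := test_sqint oB muB (test_partial i tphi).
have E1 : \int[leb R n]_(x in B) (u x * 'D_h phi x) =
    \sum_(i < n) h 0 i * ipB u (partial i phi).
  rewrite (@eq_Rintegral _ _ _ _ B (fun x => \sum_(i < n) h 0 i * (u x * partial i phi x))).
    rewrite Rintegral_sum// => [|i]; last first.
      exact: (integrableZl mB (h 0 i) (sqint_mul mB su (psq i))).
    by apply: eq_bigr => i _; rewrite RintegralZl//; exact: sqint_mul.
  move=> x _; rewrite derive_coord; last exact: smooth_differentiable.
  by rewrite mulr_sumr; apply: eq_bigr => i _; rewrite mulrCA.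
have E2 : \int[leb R n]_(x in B) (directional h G x * phi x) =
    \sum_(i < n) h 0 i * ipB (fun x => G x 0 i) phi.
  rewrite (@eq_Rintegral _ _ _ _ B (fun x => \sum_(i < n) h 0 i * (G x 0 i * phi x))).
    rewrite Rintegral_sum// => [|i]; last first.
      exact: (integrableZl mB (h 0 i) (sqint_mul mB (proj1 (wG i)) tsq)).
    apply: eq_bigr => i _; rewrite RintegralZl//; apply: sqint_mul => //.
    by have [] := wG i.
  by move=> x _; rewrite /directional /dotv mulr_suml; apply: eq_bigr => i _; rewrite mulrA.
rewrite E1 E2 -sumrN; apply: eq_bigr => i _.
by have [_ /(_ _ tphi) H] := wG i; rewrite -mulrN; congr (_ * _); exact: H.
Qed.

End difference.

(** * The fundamental theorem of calculus for weak gradients *)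

Section difference_ae.
Context {R : realType} {n : nat}.
Implicit Types (f phi u : 'rV[R]_n -> R) (h x : 'rV[R]_n) (t : R).
Local Notation L := (@lebesgue_measure R).
Local Notation I01 := (\1_(`[0, 1]%classic) : R -> R).
Variable B : set 'rV[R]_n.
Hypotheses (oB : open B) (muB : (leb R n B < +oo)%E) (cB : segment_convex B).
Let mB : measurable B. Proof. exact: open_measurable_rv. Qed.
Local Notation sq := (sqint (leb R n) B).

Lemma patch_mul f k : (fun x : 'rV[R]_n => f x * k x) \_ B = (fun x => (f \_ B) x * k x).
Proof. by apply/funext => x; rewrite !patchE; case: ifPn => // _; rewrite mul0r. Qed.

Lemma I01E t : I01 t = if 0 <= t <= 1 then 1 else 0.
Proof.
rewrite indicE mem_setE in_itv/=; by case: (_ && _).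
Qed.

Lemma Rintegral_I01 (k : R -> R) : \int[L]_t (I01 t * k t) = \int[L]_(t in `[0, 1]) k t.
Proof.
rewrite [RHS]Rintegral_mkcond; apply: eq_Rintegral => t _.
by rewrite patchE indicE; case: ifPn => _; rewrite ?mul1r ?mul0r.
Qed.

Lemma integrable_translate h f : (leb R n).-integrable setT (EFin \o f) ->
  (leb R n).-integrable setT (EFin \o (fun x => f (x + h))).
Proof.
move=> /integrableP[mf fi]; have mf' : measurable_fun setT f by apply/measurable_EFinP.
apply/integrableP; split.
  apply/measurable_EFinP; apply: (@measurableT_comp _ _ _ _ _ _ f) => //.
  exact: measurable_translate.
have := @ge0_integral_translate R n h (fun x => `|(f x)%:E|%E).
move=> ->//; last first.
  by apply: measurableT_comp.
Qed.

(** The fundamental theorem of calculus for u along segments, tested against phi.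
    Write phi(x) - phi(x - h) as the integral of D_h phi(x - t h) over t in [0, 1].
    By convexity of B each phi(x - t h) is a test function on B, so the weak
    gradient moves the derivative onto u; a translation by t h for each t then
    produces h.G(x + t h). *)
Lemma line_identity u (G : 'rV[R]_n -> 'rV[R]_n) h phi : sq u -> weak_gradient B u G ->
  test_function (B `&` [set x | B (x + h)]) phi ->
  \int[leb R n]_x (((u \_ B) (x + h) - (u \_ B) x) * phi x) =
  \int[leb R n]_x ((\int[L]_t (I01 t * (directional h G \_ B) (x + t *: h))) * phi x).
Proof.
move=> su wG tphi; set U := (X in test_function X) in tphi.
set uB := u \_ B; set g := directional h G \_ B.
have sg : sq (directional h G) by apply: directional_sq => // i; have [] := wG i.
have iu : (leb R n).-integrable setT (EFin \o uB) by exact: integrable_patch.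
have ig : (leb R n).-integrable setT (EFin \o g) by exact: integrable_patch.
have mu' : measurable_fun setT uB by apply/measurable_EFinP; exact: measurable_int iu.
have mg' : measurable_fun setT g by apply/measurable_EFinP; exact: measurable_int ig.
have sphi : smooth phi by case: tphi.
have [M M0 HM] := test_bounded tphi.
pose psi x := 'D_h phi x.
have psiE x : psi x = \sum_(i < n) h 0 i * partial i phi x.
  by rewrite /psi derive_coord//; exact: smooth_differentiable.
have mphi : measurable_fun setT phi by exact: test_measurable tphi.
have mpsi : measurable_fun setT psi.
  rewrite (_ : psi = fun x => \sum_(i < n) h 0 i * partial i phi x); last exact/funext.
  apply: measurable_sum => i; apply: measurable_funM => //.
  exact: test_measurable (test_partial i tphi).
have [M' HM'] : exists M' : R, forall x, `|psi x| <= M'.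
  have /choice[Mi HMi] : forall i, exists Mi : R, forall x, `|partial i phi x| <= Mi.
    by move=> i; have [Mi _ ?] := test_bounded (test_partial i tphi); exists Mi.
  exists (\sum_(i < n) `|h 0 i| * Mi i) => x; rewrite psiE.
  apply: le_trans (ler_norm_sum _ _ _) _; apply: ler_sum => i _.
  by rewrite normrM ler_wpM2l.
have testt t : 0 <= t <= 1 -> test_function B (fun x => phi (x - t *: h)).
  by move=> t01; apply: test_shift tphi => x [Bx Bxh]; exact: cB.
have step t : 0 <= t <= 1 ->
    \int[leb R n]_x (uB x * psi (x - t *: h)) = - \int[leb R n]_x (g x * phi (x - t *: h)).
  move=> t01; have := weak_gradient_directional oB muB h su wG (testt t t01).
  rewrite (@eq_Rintegral _ _ _ _ B (fun x => u x * psi (x - t *: h))).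
    by rewrite !(Rintegral_patch B) !patch_mul.
  move=> x _; congr (_ * _); rewrite /psi /derive.
  apply: (f_equal (fun F : R -> R => lim (F @ (0 : R)^'))); apply/funext => s /=.
  by rewrite addrA.
pose K0 (f : 'rV[R]_n -> R) (k : 'rV[R]_n) (p : 'rV[R]_n * measurableTypeR R) := I01 p.2 * f (p.1 + p.2 *: k).
pose K1 (p : 'rV[R]_n * measurableTypeR R) := K0 uB 0 p * psi (p.1 - p.2 *: h).
pose K2 (p : 'rV[R]_n * measurableTypeR R) := K0 g 0 p * phi (p.1 - p.2 *: h).
pose K3 (p : 'rV[R]_n * measurableTypeR R) := K0 g h p * phi p.1.
have iK1 : (leb R n \x L)%E.-integrable setT (EFin \o K1).
  apply: (@integrable_mul_bounded _ _ _ _ _ _ _ M') => //.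
    exact: integrable_line.
  apply: (@measurableT_comp _ _ _ _ _ _ psi) => //.
  have := @measurable_line R n (- h).
  by congr measurable_fun; apply/funext => p; rewrite scalerN.
pose K3' (p : 'rV[R]_n * measurableTypeR R) := K0 g h p * - phi p.1.
have iK3' : (leb R n \x L)%E.-integrable setT (EFin \o K3').
  apply: (@integrable_mul_bounded _ _ _ _ _ _ _ M) => //.
  - exact: integrable_line.
  - apply: (@measurable_funN _ _ _ _ (fun p : 'rV[R]_n * measurableTypeR R => phi p.1)).
    by apply: (@measurableT_comp _ _ _ _ _ _ phi).
  - by move=> p _; rewrite normrN.
have K12 t : \int[leb R n]_x K1 (x, t) = - \int[leb R n]_x K2 (x, t).
  rewrite /K1 /K2 /K0 /= I01E; case: ifPn => [t01|_]; last first.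
    under eq_Rintegral do rewrite !mul0r.
    under [in RHS]eq_Rintegral do rewrite !mul0r.
    by rewrite Rintegral_cst// mul0r oppr0.
  under eq_Rintegral do rewrite mul1r scaler0 addr0.
  by rewrite step//; congr (- _); apply: eq_Rintegral => x _; rewrite mul1r scaler0 addr0.
have K23 t : \int[leb R n]_x K2 (x, t) = \int[leb R n]_x K3 (x, t).
  have m2 : measurable_fun setT (fun x => K2 (x, t)).
    have m21 : measurable_fun setT (fun x : 'rV[R]_n => phi (x - t *: h)).
      apply: (@measurableT_comp _ _ _ _ _ _ phi) => //.
      exact: (measurable_translate (- (t *: h))).
    have m22 : measurable_fun setT (fun x : 'rV[R]_n => I01 t * g (x + t *: 0)).
      apply: measurable_funM => //; apply: (@measurableT_comp _ _ _ _ _ _ g) => //.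
      exact: (measurable_translate (t *: 0)).
    exact: (measurable_funM m22 m21).
  rewrite -(Rintegral_translate (t *: h) m2); apply: eq_Rintegral => x _.
  by rewrite /K2 /K3 /K0 /= scaler0 addr0 addrK.
have key : \int[leb R n]_x (uB x * (phi x - phi (x - h))) =
    - \int[leb R n]_x ((\int[L]_t (I01 t * g (x + t *: h))) * phi x).
  transitivity (\int[leb R n]_x \int[L]_t K1 (x, t)).
    apply: eq_Rintegral => x _; rewrite -integral_line// -Rintegral_I01 -RintegralZl//.
      by apply: eq_Rintegral => t _; rewrite /K1 /K0 /= scaler0 addr0 mulrCA mulrA.
    apply: (@integrable_mul_bounded _ _ _ _ _ _ _ M') => //.
      exact: integrable_I01.
      apply: (@measurableT_comp _ _ _ _ _ _ psi) => //.
      have := @measurable_fun_pair2 _ _ _ _ _ _ _ x (@measurable_line R n (- h)).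
      by congr measurable_fun; apply/funext => p /=; rewrite scalerN.
    by move=> t _; exact: HM'.
  rewrite (Rfubini iK1).
  transitivity (\int[L]_t \int[leb R n]_x K3' (x, t)).
    apply: eq_Rintegral => t _; rewrite K12 K23 -mulN1r -RintegralZl//.
      by apply: eq_Rintegral => x _; rewrite mulN1r /K3' mulrN.
    apply: (@integrable_mul_bounded _ _ _ _ _ (fun x => K0 g h (x, t)) _ M) => //.
    exact: (integrableZl measurableT (I01 t) (integrable_translate (t *: h) ig)).
  rewrite -(Rfubini iK3') -mulN1r -RintegralZl//; last first.
    apply: (@integrable_mul_bounded _ _ _ _ _ _ _ M) => //.
    exact: integrable_Rfubini1 (integrable_line h ig).
  have mW := measurable_int _ (integrable_Rfubini1 (integrable_line h ig)).
  apply: Rintegral_ae => //.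
  - by apply/measurable_EFinP; exact: measurable_int (integrable_Rfubini1 iK3').
  - apply: measurable_funM => //; apply: measurable_funM => //.
    exact/measurable_EFinP.
  - have := ae_integrable1 (integrable_line h ig); apply: filterS => x ix _.
    by rewrite /K3' /K0 /= mulN1r -mulrN RintegralZr.
have iup : (leb R n).-integrable setT (EFin \o (fun x => uB (x + h) * phi x)).
  apply: (@integrable_mul_bounded _ _ _ _ _ (fun x => uB (x + h)) _ M) => //.
  exact: integrable_translate.
have iup' : (leb R n).-integrable setT (EFin \o (fun x => uB x * phi x)).
  exact: (@integrable_mul_bounded _ _ _ _ _ _ _ M).
have mph : measurable_fun setT (fun x => phi (x - h)).
  by apply: (@measurableT_comp _ _ _ _ _ _ phi) => //; exact: measurable_translate.
have iup'' : (leb R n).-integrable setT (EFin \o (fun x => uB x * phi (x - h))).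
  exact: (@integrable_mul_bounded _ _ _ _ _ _ _ M).
under eq_Rintegral do rewrite mulrBl.
rewrite RintegralB//.
have -> : \int[leb R n]_x (uB (x + h) * phi x) = \int[leb R n]_x (uB x * phi (x - h)).
  rewrite -[RHS](Rintegral_translate h); last exact: measurable_funM.
  by apply: eq_Rintegral => x _; rewrite addrK.
apply: oppr_inj; rewrite -key opprB -RintegralB//.
by apply: eq_Rintegral => x _; rewrite mulrBr.
Qed.

End difference_ae.

Lemma dotv_ge0 (R : realType) n (x : 'rV[R]_n) : 0 <= dotv x x.
Proof. by apply: sumr_ge0 => i _; rewrite -expr2 sqr_ge0. Qed.

Lemma dotv_cauchy_schwarz (R : realType) n (x y : 'rV[R]_n) :
  dotv x y ^+ 2 <= dotv x x * dotv y y.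
Proof.
apply: quadratic_discr; first exact: dotv_ge0.
move=> t; have := dotv_ge0 (x + t *: y); congr (_ <= _).
rewrite /dotv !mulr_sumr -!big_split/=; apply: eq_bigr => i _.
by rewrite !mxE; ring.
Qed.

Section difference_bound.
Context {R : realType} {n : nat}.
Implicit Types (f u : 'rV[R]_n -> R) (h x : 'rV[R]_n) (t : R).
Local Notation L := (@lebesgue_measure R).
Local Notation I01 := (\1_(`[0, 1]%classic) : R -> R).
Variable B : set 'rV[R]_n.
Hypotheses (oB : open B) (muB : (leb R n B < +oo)%E) (cB : segment_convex B).
Let mB : measurable B. Proof. exact: open_measurable_rv. Qed.
Local Notation sq := (sqint (leb R n) B).
Variables (u : 'rV[R]_n -> R) (G : 'rV[R]_n -> 'rV[R]_n).
Hypotheses (su : sq u) (wG : weak_gradient B u G).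

Let sG i : sq (fun x => G x 0 i). Proof. by have [] := wG i. Qed.

(** Functions with equal integrals against all test functions agree almost
    everywhere. *)
Lemma difference_ae h : {ae leb R n, forall x, B x -> B (x + h) ->
  (u \_ B) (x + h) - (u \_ B) x = \int[L]_t (I01 t * (directional h G \_ B) (x + t *: h))}.
Proof.
set uB := u \_ B; set g := directional h G \_ B.
pose U := B `&` [set x | B (x + h)].
pose W x := \int[L]_t (I01 t * g (x + t *: h)).
have iu : (leb R n).-integrable setT (EFin \o uB) by exact: integrable_patch.
have ig : (leb R n).-integrable setT (EFin \o g) by apply: integrable_patch => //; exact: directional_sq.
have iuh := integrable_translate h iu.
have iW : (leb R n).-integrable setT (EFin \o W).
  exact: integrable_Rfubini1 (integrable_line h ig).
have oU : open U.
  apply: openI => //; apply: (@open_comp _ _ (fun x : 'rV[R]_n => x + h) B) => //.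
  move=> x _; apply: (@differentiable_continuous _ _ _ x (fun x : 'rV[R]_n => x + h)).
  exact: differentiableD.
have mU : measurable U by exact: open_measurable_rv.
pose w x := uB (x + h) - uB x - W x.
have iw : (leb R n).-integrable setT (EFin \o w).
  exact: integrableB (integrableB _ iuh iu) iW.
have mw : measurable_fun setT w by apply/measurable_EFinP; exact: measurable_int iw.
have iwU : (leb R n).-integrable U (EFin \o w) by apply: integrableS iw.
have := test_orthogonal_eq0 oU iwU.
move=> H; suff /H : forall phi, test_function U phi ->
    \int[leb R n]_(x in U) (w x * phi x) = 0.
  apply: filterS => x Hx Bx Bxh; have /= [] := Hx (conj Bx Bxh).
  by move=> /eqP; rewrite /w subr_eq0 => /eqP.
move=> phi tphi; have [M M0 HM] := test_bounded tphi.
have mphi : measurable_fun setT phi by exact: test_measurable tphi.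
have -> : \int[leb R n]_(x in U) (w x * phi x) = \int[leb R n]_x (w x * phi x).
  rewrite Rintegral_mkcond; apply: eq_Rintegral => x _; rewrite patchE.
  case: ifPn => // /negP xU; rewrite (test_out tphi) ?mulr0//.
  by move=> Ux; apply: xU; rewrite inE.
have mb f : (leb R n).-integrable setT (EFin \o f) ->
    (leb R n).-integrable setT (EFin \o (fun x => f x * phi x)).
  by move=> iff; apply: (@integrable_mul_bounded _ _ _ _ _ _ _ M).
rewrite /w; under eq_Rintegral do rewrite mulrBl.
rewrite RintegralB//; [|exact: (mb _ (integrableB measurableT iuh iu))|exact: mb].
by rewrite (line_identity oB muB cB su wG tphi) subrr.
Qed.

Lemma sqr_integral_I01 (k : R -> R) : measurable_fun [set: measurableTypeR R] k ->
  (((\int[L]_t (I01 t * k t)) ^+ 2)%:E <= \int[L]_t (I01 t * k t ^+ 2)%:E)%E.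
Proof.
move=> mk; have E : (\int[L]_t (I01 t * k t ^+ 2)%:E = \int[L]_(t in `[0%R, 1%R]) (k t ^+ 2)%:E)%E.
  rewrite [RHS]integral_mkcond; apply: eq_integral => t _.
  by rewrite patchE indicE; case: ifPn => _; rewrite ?mul1r ?mul0r.
rewrite {}E Rintegral_I01.
have mI : measurable (`[0%R, 1%R]%classic : set (measurableTypeR R)) by exact: measurable_itv.
have LI : (L `[0%R, 1%R]%classic = 1)%E.
  by rewrite lebesgue_measure_itv/= lte_fin ltr01 oppr0 adde0.
have LIoo : (L `[0%R, 1%R]%classic < +oo)%E by rewrite LI ltry.
have I0 : (0 <= \int[L]_(t in `[0%R, 1%R]) (k t ^+ 2)%:E)%E.
  by apply: integral_ge0 => t _; rewrite lee_fin sqr_ge0.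
have [->|koo] := eqVneq (\int[L]_(t in `[0%R, 1%R]) (k t ^+ 2)%:E)%E +oo%E; first by rewrite leey.
have mk2 : measurable_fun (`[0%R, 1%R]%classic : set (measurableTypeR R)) (fun t => (k t ^+ 2)%:E).
  by apply/measurable_EFinP/measurable_funX; exact: measurable_funTS.
have sk : sqint L (`[0%R, 1%R]%classic : set (measurableTypeR R)) k.
  split; first exact: measurable_funTS.
  apply/integrableP; split => //; under eq_integral do rewrite gee0_abs ?lee_fin ?sqr_ge0//.
  by rewrite ltey.
have s1 : sqint L (`[0%R, 1%R]%classic : set (measurableTypeR R)) (fun=> 1 : R).
  exact: (sqint_cst mI LIoo).
have := ip_cauchy_schwarz mI sk s1.
rewrite /ip; under eq_Rintegral do rewrite mulr1.
under [X in _ * X]eq_Rintegral do rewrite mulr1.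
rewrite (Rintegral_cst _ mI) [fine _](_ : _ = 1) ?mulr1; last exact: (congr1 fine LI).
move=> H; rewrite -[leRHS]fineK ?ge0_fin_numE ?ltey//.
Qed.

(** The energy density is extended by 0, so that it can be evaluated along
    segments without mentioning B. *)
Definition energy : 'rV[R]_n -> R := (fun x => dotv (G x) (G x)) \_ B.

Lemma energy_ge0 x : 0 <= energy x.
Proof. by rewrite /energy patchE; case: ifPn => // _; exact: dotv_ge0. Qed.

Lemma measurable_energy : measurable_fun setT energy.
Proof.
rewrite /energy; apply: (measurable_restrictT _ mB).1; rewrite /dotv.
elim: (index_enum _) => [|i s IH].
  by under eq_fun do rewrite big_nil; exact: measurable_cst.
under eq_fun do rewrite big_cons; apply: measurable_funD => //.
by apply: measurable_funM; have [] := sG i.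
Qed.

Lemma difference_bound h : {ae leb R n, forall x, B x -> B (x + h) ->
  ((((u \_ B) (x + h) - (u \_ B) x) ^+ 2)%:E <=
   (dotv h h)%:E * \int[L]_t (I01 t * energy (x + t *: h))%:E)%E}.
Proof.
have := difference_ae h; apply: filterS => x /[apply] /[apply] ->.
have ml (f : 'rV[R]_n -> R) : measurable_fun setT f ->
    measurable_fun [set: measurableTypeR R] (fun t : R => f (x + t *: h)).
  move=> mf; apply: (@measurableT_comp _ _ _ _ _ _ f) => //.
  apply: measurable_fun_rvD; first exact: measurable_cst.
  by apply: measurable_fun_rvZ; [exact: measurable_id|exact: measurable_cst].
have mg : measurable_fun setT (directional h G \_ B).
  by apply: (measurable_restrictT _ mB).1; have [] := directional_sq oB h sG.
apply: (le_trans (sqr_integral_I01 (ml _ mg))).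
rewrite -ge0_integralZl_EFin ?dotv_ge0//; last 2 first.
- by move=> t _; rewrite lee_fin mulr_ge0 ?energy_ge0.
- apply/measurable_EFinP; apply: measurable_funM; first exact: measurable_I01.
  by apply: ml; exact: measurable_energy.
apply: ge0_le_integral => //.
- by move=> t _; rewrite lee_fin mulr_ge0 ?sqr_ge0.
- apply/measurable_EFinP; apply: measurable_funM; first exact: measurable_I01.
  by apply: measurable_funX; exact: ml.
- apply/measurable_EFinP; apply: measurable_funM => //; apply: measurable_funM; first exact: measurable_I01.
  by apply: ml; exact: measurable_energy.
move=> t _; rewrite -EFinM lee_fin [leRHS]mulrCA ler_wpM2l//.
rewrite /energy !patchE; case: ifPn => _; last by rewrite expr0n mulr0.
exact: dotv_cauchy_schwarz.
Qed.

End difference_bound.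

(** * The Poincare inequality on convex sets *)

Section poincare.
Context {R : realType} {n : nat}.
Implicit Types (f : 'rV[R]_n -> R) (h x : 'rV[R]_n) (t : R).
Local Notation L := (@lebesgue_measure R).
Local Notation I01 := (\1_(`[0, 1]%classic) : R -> R).
Local Notation V := 'rV[R]_n.
Variable B : set 'rV[R]_n.
Hypotheses (oB : open B) (muB : (leb R n B < +oo)%E) (cB : segment_convex B).
Let mB : measurable B. Proof. exact: open_measurable_rv. Qed.
Local Notation sq := (sqint (leb R n) B).
Variables (u : 'rV[R]_n -> R) (G : 'rV[R]_n -> 'rV[R]_n).
Hypotheses (su : sq u) (wG : weak_gradient B u G).
Variables (O : set 'rV[R]_n) (d : R).
Hypotheses (mO : measurable O) (OB : O `<=` B) (cO : segment_convex O).
Hypothesis Od : forall x y i, O x -> O y -> `|x 0 i - y 0 i| <= d.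

Local Notation E := (energy B G).
Let uB := u \_ B.
Let C : R := n%:R * d ^+ 2.

Let E0 x : 0 <= E x. Proof. exact: energy_ge0. Qed.
Let mE : measurable_fun setT E. Proof. exact: (measurable_energy oB wG). Qed.
Let m1O : measurable_fun setT (\1_O : V -> R). Proof. exact: measurable_indic. Qed.
Let O0 x : 0 <= \1_O x :> R. Proof. by rewrite indicE. Qed.

Let dotv_le h x : O x -> O (x + h) -> dotv h h <= C.
Proof.
move=> Ox Oxh; rewrite /dotv /C -[n in n%:R]card_ord -sumr_const mulr_suml.
apply: ler_sum => i _; rewrite mul1r -expr2.
have := Od i Oxh Ox; rewrite !mxE addrAC subrr add0r => hd.
by rewrite -(real_normK (num_real (h 0 i))) ler_sqr ?nnegrE// (le_trans _ hd).
Qed.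

(* the integrand of the energy estimate, in the variables (h, t, x) *)
Let q (p : (V * measurableTypeR R) * V) : R :=
  \1_O p.2 * \1_O (p.2 + p.1.1) * I01 p.1.2 * E (p.2 + p.1.2 *: p.1.1).

Let q0 p : 0 <= q p.
Proof. by rewrite /q !mulr_ge0. Qed.

Let mq : measurable_fun setT q.
Proof.
have m11 : measurable_fun setT (fun p : (V * measurableTypeR R) * V => p.1.1).
  by apply: measurableT_comp; [exact: measurable_fst|exact: measurable_fst].
have m12 : measurable_fun setT (fun p : (V * measurableTypeR R) * V => p.1.2).
  by apply: measurableT_comp; [exact: measurable_snd|exact: measurable_fst].
have m2 : measurable_fun setT (fun p : (V * measurableTypeR R) * V => p.2).
  exact: measurable_snd.
rewrite /q; apply: measurable_funM; last first.
  apply: (@measurableT_comp _ _ _ _ _ _ E) => //.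
  by apply: measurable_fun_rvD => //; exact: measurable_fun_rvZ.
apply: measurable_funM; last by apply: measurableT_comp => //; exact: measurable_I01.
apply: measurable_funM.
  exact: (@measurableT_comp _ _ _ _ _ _ (\1_O : V -> R)).
apply: (@measurableT_comp _ _ _ _ _ _ (\1_O : V -> R)) => //.
exact: measurable_fun_rvD.
Qed.

Let EO := (\int[leb R n]_z (\1_O z * E z)%:E)%E.

(* contracting by a factor of at least 1/2 costs at most 2^n in measure *)
Let scale_bound (c : R) z : 2^-1 <= `|c| ->
  (\int[leb R n]_h (\1_O (c *: h + z))%:E <= (2 ^+ n)%:E * leb R n O)%E.
Proof.
move=> c2; have c0 : c != 0 by rewrite -normr_gt0; apply: lt_le_trans c2.
have := @integral_leb_affine R n c z (fun x => (\1_O x)%:E) c0.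
have mz : measurable_fun setT (fun x : V => (\1_O x : R)%:E) by exact/measurable_EFinP.
move=> /(_ mz (fun x => O0 x)); rewrite integral_indic// setIT => ->.
rewrite muleA -EFinM; apply: lee_pemull; last first.
  rewrite lee_fin -exprMn exprn_ege1// -[leLHS](@divff _ 2)//; lra.
by apply: integral_ge0 => h _; rewrite lee_fin.
Qed.

(* Substitute z = x + t h. The endpoints of the segment are then z - t h and
   z + (1 - t) h; keeping only the constraint on the endpoint c h + z whose factor
   satisfies |c| >= 1/2 leaves h in a set of measure at most 2^n |O|. *)
Let q_bound t : (\int[leb R n]_h \int[leb R n]_x (q ((h, t), x))%:E <=
  (I01 t)%:E * ((2 ^+ n)%:E * leb R n O * EO))%E.
Proof.
rewrite I01E; case: ifPn => t01; last first.
  rewrite mul0e le_eqVlt; apply/orP; left; apply/eqP.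
  under eq_integral => h _.
    rewrite (@eq_integral _ _ _ _ _ (cst 0%E)); last first.
      by move=> x _; rewrite /q /= I01E (negbTE t01) mulr0 mul0r.
    rewrite integral0; over.
  by rewrite integral0.
rewrite mul1e.
pose c : R := if 2^-1 <= t then - t else 1 - t.
have c2 : 2^-1 <= `|c|.
  rewrite /c; case: ifPn => [t2|]; first by rewrite normrN ger0_norm//; lra.
  by rewrite -ltNge => t2; rewrite ger0_norm; lra.
pose s (p : V * V) : R := \1_O p.2 * E p.2 * \1_O (c *: p.1 + p.2).
have s0 p : 0 <= s p by rewrite /s !mulr_ge0.
have ms : measurable_fun setT s.
  apply: measurable_funM.
    apply: (@measurableT_comp _ _ _ _ _ _ (fun x => \1_O x * E x)); last exact: measurable_snd.
    exact: measurable_funM.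
  apply: (@measurableT_comp _ _ _ _ _ _ (\1_O : V -> R)) => //.
  apply: measurable_fun_rvD; last exact: measurable_snd.
  by apply: measurable_fun_rvZ; [exact: measurable_cst|exact: measurable_fst].
apply: (@le_trans _ _ (\int[leb R n]_h \int[leb R n]_z (s (h, z))%:E)%E).
  apply: ge0_le_integral => //.
  - by move=> h _; apply: integral_ge0 => x _; rewrite lee_fin.
  - apply: (@measurable_fun_fubini_tonelli_F _ _ _ _ _ (leb R n)
      (fun p : V * V => (q ((p.1, t), p.2))%:E)) => [|p]; last by rewrite lee_fin.
    apply/measurable_EFinP; apply: (@measurableT_comp _ _ _ _ _ _ q) => //.
    apply: measurable_fun_pair; last exact: measurable_snd.
    by apply: measurable_fun_pair; [exact: measurable_fst|exact: measurable_cst].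
  - apply: (@measurable_fun_fubini_tonelli_F _ _ _ _ _ (leb R n) (EFin \o s)) => [|p].
      exact/measurable_EFinP.
    by rewrite /= lee_fin.
  move=> h _.
  pose F z : R := \1_O (z - t *: h) * \1_O (z - t *: h + h) * E z.
  have mF : measurable_fun setT F.
    have mt : measurable_fun setT (fun z : V => z - t *: h) by exact: measurable_translate.
    apply: measurable_funM => //; apply: measurable_funM.
      exact: (@measurableT_comp _ _ _ _ _ _ (\1_O : V -> R)).
    apply: (@measurableT_comp _ _ _ _ _ _ (\1_O : V -> R)) => //.
    by apply: measurable_fun_rvD => //; exact: measurable_cst.
  have F0 z : 0 <= F z by rewrite /F !mulr_ge0.
  rewrite (@eq_integral _ _ _ _ _ (fun x => (F (x + t *: h))%:E)); last first.
    by move=> x _; rewrite /q /F /= addrK I01E t01 mulr1.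
  rewrite (@ge0_integral_translate _ _ (t *: h) (EFin \o F)); last 2 first.
    exact/measurable_EFinP.
    by move=> x; rewrite /= lee_fin.
  apply: ge0_le_integral => //.
  - by move=> z _; rewrite /= lee_fin.
  - exact/measurable_EFinP.
  - apply/measurable_EFinP; apply: (@measurableT_comp _ _ _ _ _ _ s) => //.
  move=> z _; rewrite /= lee_fin /F /s /=.
  rewrite [leRHS]mulrAC mulrC (mulrC _ (E z)) ler_wpM2l//.
  rewrite !indicE; have [zt|] := boolP (z - t *: h \in O); last by rewrite mul0r mulr_ge0.
  have [zth|] := boolP (z - t *: h + h \in O); last by rewrite mulr0 mulr_ge0.
  rewrite !inE in zt zth.
  have Oz : O z by have := cO zt zth t01; rewrite subrK.
  rewrite mulr1 mem_set// mul1r mem_set//.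
  rewrite /c; case: ifPn => _; first by rewrite scaleNr addrC.
  by rewrite scalerBl scale1r addrC addrA addrAC.
rewrite (@fubini_tonelli _ _ _ _ _ (leb R n) (leb R n) (EFin \o s)); last 2 first.
- exact/measurable_EFinP.
- by move=> p; rewrite /= lee_fin.
apply: (@le_trans _ _ (\int[leb R n]_z ((\1_O z * E z)%:E * ((2 ^+ n)%:E * leb R n O)))%E).
  apply: ge0_le_integral => //.
  - by move=> z _; apply: integral_ge0 => h _; rewrite lee_fin.
  - apply: (@measurable_fun_fubini_tonelli_G _ _ _ _ _ (leb R n) (EFin \o s)) => [|p].
      exact/measurable_EFinP.
    by rewrite /= lee_fin.
  - apply: emeasurable_funM => //; apply/measurable_EFinP; exact: measurable_funM.
  move=> z _; rewrite /s /=.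
  under eq_integral do rewrite EFinM.
  rewrite ge0_integralZl_EFin ?mulr_ge0//; last first.
    apply/measurable_EFinP; apply: (@measurableT_comp _ _ _ _ _ _ (\1_O : V -> R)) => //.
    exact: measurable_affine.
  by apply: lee_wpmul2l; [rewrite lee_fin mulr_ge0|exact: scale_bound].
rewrite ge0_integralZr//.
- by rewrite muleC.
- by apply/measurable_EFinP; exact: measurable_funM.
- by move=> z _; rewrite lee_fin mulr_ge0.
- by rewrite mule_ge0// lee_fin exprn_ge0.
Qed.

Let p (xy : V * V) : R := \1_O xy.1 * \1_O xy.2 * (uB xy.2 - uB xy.1) ^+ 2.

Let p0 xy : 0 <= p xy.
Proof. by apply: mulr_ge0; [rewrite mulr_ge0|exact: sqr_ge0]. Qed.

Let muBB : measurable_fun setT uB.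
Proof. by apply: (measurable_restrictT _ mB).1; case: su. Qed.

Let mp : measurable_fun setT p.
Proof.
have mfst : measurable_fun setT (fun xy : V * V => xy.1) by exact: measurable_fst.
have msnd : measurable_fun setT (fun xy : V * V => xy.2) by exact: measurable_snd.
apply: measurable_funM.
  apply: measurable_funM.
    exact: (@measurableT_comp _ _ _ _ _ _ (\1_O : V -> R)).
  exact: (@measurableT_comp _ _ _ _ _ _ (\1_O : V -> R)).
apply: measurable_funX; apply: measurable_funB.
  exact: (@measurableT_comp _ _ _ _ _ _ uB).
exact: (@measurableT_comp _ _ _ _ _ _ uB).
Qed.

Let mshear : measurable_fun setT (fun hx : V * V => (hx.2, hx.2 + hx.1)).
Proof.
apply: measurable_fun_pair; first exact: measurable_snd.
by apply: measurable_fun_rvD; [exact: measurable_snd|exact: measurable_fst].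
Qed.

Let C0 : 0 <= C. Proof. by rewrite /C mulr_ge0 ?sqr_ge0. Qed.

(* square the identity for u(x + h) - u(x), then integrate over x and h *)
Let energy_estimate :
  (\int[leb R n]_h \int[leb R n]_x (p (x, (x + h)%R))%:E <=
   C%:E * ((2 ^+ n)%:E * leb R n O * EO))%E.
Proof.
pose Q h x := (\int[L]_t (q ((h, t), x))%:E)%E.
have Q0 h x : (0 <= Q h x)%E by apply: integral_ge0 => t _; rewrite lee_fin.
have mQ : measurable_fun setT (fun hx : V * V => Q hx.1 hx.2).
  apply: (@measurable_fun_fubini_tonelli_F _ _ _ _ _ L
    (fun z : (V * V) * measurableTypeR R => (q ((z.1.1, z.2), z.1.2))%:E)) => [|z].
    apply/measurable_EFinP; apply: (@measurableT_comp _ _ _ _ _ _ q) => //.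
    apply: measurable_fun_pair; last first.
      by apply: measurableT_comp; [exact: measurable_snd|exact: measurable_fst].
    apply: measurable_fun_pair; last exact: measurable_snd.
    by apply: measurableT_comp; [exact: measurable_fst|exact: measurable_fst].
  by rewrite lee_fin.
have mQh h : measurable_fun setT (Q h).
  exact: (measurable_fun_pair2 h mQ).
have EQ0 h : (0 <= \int[leb R n]_x Q h x)%E by apply: integral_ge0.
have mEQ : measurable_fun setT (fun h => \int[leb R n]_x Q h x)%E.
  by apply: (@measurable_fun_fubini_tonelli_F _ _ _ _ _ (leb R n)
    (fun hx : V * V => Q hx.1 hx.2)).
apply: (@le_trans _ _ (\int[leb R n]_h (C%:E * \int[leb R n]_x Q h x))%E).
  apply: ge0_le_integral => //.
  - by move=> h _; apply: integral_ge0 => x _; rewrite lee_fin.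
  - apply: (@measurable_fun_fubini_tonelli_F _ _ _ _ _ (leb R n)
      (fun hx : V * V => (p (hx.2, hx.2 + hx.1))%:E)) => [|z]; last by rewrite lee_fin.
    by apply/measurable_EFinP; apply: (@measurableT_comp _ _ _ _ _ _ p).
  - by apply: emeasurable_funM.
  move=> h _; rewrite -ge0_integralZl_EFin//.
  apply: ae_ge0_le_integral => //.
  - by move=> x _; rewrite lee_fin.
  - apply/measurable_EFinP; apply: (@measurableT_comp _ _ _ _ _ _ p) => //.
    exact: (measurable_fun_pair2 h mshear).
  - by move=> x _; rewrite mule_ge0 ?lee_fin.
  - by apply: emeasurable_funM.
  have := difference_bound oB muB cB su wG h; apply: filterS => x Hx _.
  rewrite /p /=; have [Ox|nOx] := pselect (O x); last first.
    by rewrite !indicE memNset// !mul0r mule_ge0 ?lee_fin.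
  have [Oxh|nOxh] := pselect (O (x + h)); last first.
    by rewrite !indicE [x + h \in O]memNset// mulr0 mul0r mule_ge0 ?lee_fin.
  have -> : Q h x = (\int[L]_t (I01 t * E (x + t *: h)%R)%:E)%E.
    by apply: eq_integral => t _; rewrite /q /= [\1_O x]indicE [\1_O (x + h)]indicE
      !(mem_set Ox, mem_set Oxh) !mul1r.
  rewrite [\1_O x]indicE [\1_O (x + h)]indicE !(mem_set Ox, mem_set Oxh) !mul1r.
  apply: le_trans (Hx (OB Ox) (OB Oxh)) _.
  apply: lee_wpmul2r; last by rewrite lee_fin; exact: dotv_le Ox Oxh.
  by apply: integral_ge0 => t _; rewrite lee_fin mulr_ge0// E0.
rewrite ge0_integralZl_EFin//; apply: lee_wpmul2l; first by rewrite lee_fin.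
have mqh h : measurable_fun setT (fun xt : V * measurableTypeR R => (q ((h, xt.2), xt.1))%:E).
  apply/measurable_EFinP; apply: (@measurableT_comp _ _ _ _ _ _ q) => //.
  apply: measurable_fun_pair; last exact: measurable_fst.
  by apply: measurable_fun_pair; [exact: measurable_cst|exact: measurable_snd].
under eq_integral => h _.
  rewrite (fubini_tonelli (m1 := leb R n) (m2 := L)
    (fun xt : V * measurableTypeR R => (q ((h, xt.2), xt.1))%:E) (mqh h)); last first.
    by move=> z; rewrite lee_fin.
  over.
pose S (ht : V * measurableTypeR R) := (\int[leb R n]_x (q (ht, x))%:E)%E.
have S0 ht : (0 <= S ht)%E by apply: integral_ge0 => x _; rewrite lee_fin.
have mS : measurable_fun setT S.
  apply: (@measurable_fun_fubini_tonelli_F _ _ _ _ _ (leb R n) (EFin \o q)) => [|z].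
    exact/measurable_EFinP.
  by rewrite /= lee_fin.
rewrite [leLHS](fubini_tonelli (m1 := leb R n) (m2 := L) S)//.
apply: (@le_trans _ _ (\int[L]_t ((I01 t)%:E * ((2 ^+ n)%:E * leb R n O * EO)))%E).
  have EO0 : (0 <= EO)%E by apply: integral_ge0 => z _; rewrite lee_fin mulr_ge0.
  apply: ge0_le_integral => //.
  - by move=> t _; apply: integral_ge0.
  - by apply: (@measurable_fun_fubini_tonelli_G _ _ _ _ _ (leb R n) S).
  - by apply: emeasurable_funM => //; apply/measurable_EFinP; exact: measurable_I01.
  - by move=> t _; exact: q_bound.
rewrite ge0_integralZr//; last 2 first.
- by apply/measurable_EFinP; exact: measurable_I01.
- rewrite mule_ge0 ?mule_ge0 ?lee_fin ?exprn_ge0//.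
  by apply: integral_ge0 => z _; rewrite lee_fin mulr_ge0.
have -> : (\int[L]_t (I01 t)%:E = 1)%E.
  have LI : (L `[0%R, 1%R]%classic = 1)%E.
    by rewrite lebesgue_measure_itv/= lte_fin ltr01 oppr0 adde0.
  by rewrite integral_indic// setIT; exact: LI.
by rewrite mul1e.
Qed.

Let muO : (leb R n O < +oo)%E.
Proof. by apply: le_lt_trans muB; apply: le_measure => //; rewrite inE. Qed.

Let sqS f : sq f -> sqint (leb R n) O f.
Proof.
move=> [mf fi]; split; first exact: measurable_funS mf.
exact: integrableS fi.
Qed.

Let indic_integral f : (leb R n).-integrable O (EFin \o f) ->
  (\int[leb R n]_x (\1_O x * f x)%:E = (\int[leb R n]_(x in O) f x)%:E)%E.
Proof.
move=> fi; rewrite /Rintegral fineK; last exact: integrable_fin_num.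
rewrite [RHS]integral_mkcond; apply: eq_integral => x _.
by rewrite patchE indicE; case: ifPn => _; rewrite ?mul1r ?mul0r.
Qed.

Let A := \int[leb R n]_(x in O) (u x ^+ 2).
Let S := \int[leb R n]_(x in O) (u x).
Let W := fine (leb R n O).

Let quad_integrable (a b c : R) :
  (leb R n).-integrable O (EFin \o (fun x => a * u x ^+ 2 + b * u x + c)).
Proof.
have s := sqS su; have [_ i2] := s; have i1 := sqint_integrable mO muO s.
have ic := integrable_cst mO muO c.
exact: (integrableD mO (integrableD mO (integrableZl mO a i2) (integrableZl mO b i1)) ic).
Qed.

Let quad_integral (a b c : R) :
  \int[leb R n]_(x in O) (a * u x ^+ 2 + b * u x + c) = a * A + b * S + c * W.
Proof.
have s := sqS su; have [_ i2] := s; have i1 := sqint_integrable mO muO s.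
have ic := integrable_cst mO muO c.
have ia := integrableZl mO a i2; have ib := integrableZl mO b i1.
rewrite RintegralD//; last exact: (integrableD mO ia ib).
by rewrite RintegralD// RintegralZl// RintegralZl// Rintegral_cst.
Qed.

(* expanding (u(y) - u(x))^2 over O x O gives twice |O| times the variance of u *)
Let pair_integral :
  (\int[leb R n]_h \int[leb R n]_x (p (x, (x + h)%R))%:E = (2 * (W * A - S ^+ 2))%:E)%E.
Proof.
rewrite (fubini_tonelli (m1 := leb R n) (m2 := leb R n)
  (fun hx : V * V => (p (hx.2, hx.2 + hx.1))%:E)); last 2 first.
- by apply/measurable_EFinP; apply: (@measurableT_comp _ _ _ _ _ _ p).
- by move=> z; rewrite lee_fin.
transitivity (\int[leb R n]_x (\1_O x * (W * u x ^+ 2 + (- 2 * S) * u x + A))%:E)%E.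
  apply: eq_integral => x _ /=.
  under eq_integral do rewrite [x + _]addrC.
  rewrite (@ge0_integral_translate _ _ x (fun y => (p (x, y))%:E)); last 2 first.
  - by apply/measurable_EFinP; exact: (measurable_fun_pair2 x mp).
  - by move=> y; rewrite lee_fin.
  rewrite /p /=; have [Ox|nOx] := pselect (O x); last first.
    rewrite [\1_O x]indicE memNset// mul0r.
    by under eq_integral do rewrite !mul0r; exact: integral0.
  rewrite [\1_O x]indicE mem_set// mul1r /uB.
  under eq_integral do rewrite mul1r.
  transitivity (\int[leb R n]_y (\1_O y * (1 * u y ^+ 2 + (- 2 * u x) * u y + u x ^+ 2))%:E)%E.
    apply: eq_integral => y _; rewrite indicE; case: (boolP (y \in O)) => yO; last by rewrite !mul0r.
    rewrite !mul1r !patchE !mem_set//; [|exact: OB|by apply: OB; rewrite inE in yO].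
    by congr EFin; ring.
  rewrite indic_integral//; congr EFin; rewrite quad_integral; ring.
rewrite indic_integral// quad_integral; congr EFin; ring.
Qed.

(** The Poincare inequality with a constant that sees only the sup norm
    diameter d of O, not its shape: u(x + h) - u(x) is the integral of h.G over a segment that stays
    in O, and averaging over the pairs of endpoints costs at most the factor 2^n
    of the contraction bound. The denominator |O| is multiplied out so that the
    inequality also makes sense for null sets. *)
Lemma poincare_convex :
  fine (leb R n O) * \int[leb R n]_(x in O) (u x ^+ 2) <=
  (\int[leb R n]_(x in O) u x) ^+ 2 +
  n%:R * d ^+ 2 * 2 ^+ n * fine (leb R n O) *
    \int[leb R n]_(x in O) dotv (G x) (G x).
Proof.
rewrite -/A -/S -/W.
have sG i : sqint (leb R n) O (fun x => G x 0 i) by apply: sqS; have [] := wG i.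
have iE : (leb R n).-integrable O (EFin \o (fun x => dotv (G x) (G x))).
  rewrite (_ : EFin \o _ = fun x => (\sum_(i < n) (G x 0 i * G x 0 i)%:E)%E); last first.
    by apply/funext => x /=; rewrite sumEFin.
  by apply: integrable_sum => // i _; exact: sqint_mul.
have EOE : EO = (\int[leb R n]_(x in O) dotv (G x) (G x))%:E.
  rewrite -indic_integral//; apply: eq_integral => x _.
  rewrite !indicE; case: (boolP (x \in O)) => xO; last by rewrite !mul0r.
  by rewrite !mul1r /energy patchE mem_set//; apply: OB; rewrite inE in xO.
have := energy_estimate; rewrite pair_integral EOE.
rewrite -[leb R n O]fineK ?ge0_fin_numE// -!EFinM lee_fin -/W -/C => H.
have I0 : 0 <= C * (2 ^+ n * W * \int[leb R n]_(x in O) dotv (G x) (G x)).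
  apply: mulr_ge0 => //; apply: mulr_ge0.
    by rewrite mulr_ge0 ?exprn_ge0 ?fine_ge0.
  by apply: Rintegral_ge0 => x _; exact: dotv_ge0.
rewrite -!mulrA in H I0 *; lra.
Qed.

End poincare.

(** * Compactness from a partition into small cells *)

Lemma Rintegral_finite_partition d (T : measurableType d) (R : realType)
    (mu : {measure set T -> \bar R}) (I : finType) (F : I -> set T) (D : set T) (g : T -> R) :
  (forall i, measurable (F i)) -> trivIset setT F -> D = \bigcup_i F i ->
  mu.-integrable D (EFin \o g) -> (forall x, D x -> 0 <= g x) ->
  \int[mu]_(x in D) g x = \sum_i \int[mu]_(x in F i) g x.
Proof.
move=> mF tF DE gi g0.
have FD i : F i `<=` D by rewrite DE => x Fx; exists i.
have DE' : D = \big[setU/set0]_(i <- index_enum I) F i.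
  rewrite -bigcup_seq DE (_ : [set` _] = setT)//.
  by apply/seteqP; split => // i _; rewrite /= mem_index_enum.
have mD : measurable D by rewrite DE'; exact: bigsetU_measurable.
rewrite /Rintegral sum_fine; last first.
  move=> i _; apply: integrable_fin_num => //.
  exact: (integrableS mD (mF i) (FD i) gi).
congr fine; rewrite [in LHS]DE' ge0_integral_bigsetU ?index_enum_uniq//.
- by apply: sub_trivIset tF.
- by rewrite -DE'; case/integrableP: gi.
- by rewrite -DE' => x Dx; rewrite lee_fin g0.
Qed.

Section compactness.
Context {R : realType} {n : nat}.
Variables (B : set 'rV[R]_n) (M : R).
Hypotheses (oB : open B) (muB : (leb R n B < +oo)%E) (cB : segment_convex B).
Hypothesis BM : B `<=` cube M.
Implicit Types u v : 'rV[R]_n -> R.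

Let mB : measurable B. Proof. exact: open_measurable_rv. Qed.
Variables (d : R) (k : nat).
Hypotheses (d0 : 0 < d) (kM : 2 * M / d < k.+1%:R).

(** The grid boxes are half-open, so that they partition B; there are k + 1 per
    direction, enough to cover [-M, M]. *)
Definition cell (f : {ffun 'I_n -> 'I_k.+1}) : set 'rV[R]_n :=
  B `&` [set x | forall i, d * (f i)%:R <= x 0 i + M < d * (f i).+1%:R].

Lemma measurable_cell f : measurable (cell f).
Proof.
apply: measurableI => //.
apply: (@measurable_coords_set R n (fun i => [set y : R | d * (f i)%:R <= y + M < d * (f i).+1%:R])) => i.
rewrite (_ : mkset _ = `[d * (f i)%:R - M, d * (f i).+1%:R - M[%classic); last first.
  by apply/seteqP; split => y /=; rewrite in_itv/= lerBlDr ltrBrDr.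
exact: measurable_itv.
Qed.

Lemma sub_cell f : cell f `<=` B.
Proof. by move=> x []. Qed.

Lemma leb_cell_lty f : (leb R n (cell f) < +oo)%E.
Proof.
apply: le_lt_trans muB; apply: le_measure; rewrite ?inE//.
- exact: measurable_cell.
- exact: sub_cell.
Qed.

Lemma convex_cell f : segment_convex (cell f).
Proof.
move=> x h t [Bx cx] [Bxh cxh] t01; split; first exact: cB.
move=> i; have := cx i; have := cxh i; rewrite !mxE; move: t01.
move: (d * _) (d * _) => p q /andP[t0 t1] /andP[h1 h2] /andP[h3 h4].
have s0 : 0 <= 1 - t by lra.
have [->|tn0] := eqVneq t 0; first by rewrite mul0r addr0 h3 h4.
have tp : 0 < t by rewrite lt_def tn0.
rewrite -subr_ge0 in h1; rewrite -subr_gt0 in h2; rewrite -subr_ge0 in h3; rewrite -subr_gt0 in h4.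
have := mulr_ge0 s0 h3; have := mulr_ge0 t0 h1.
have := mulr_ge0 s0 (ltW h4); have := mulr_gt0 tp h2.
by move=> *; apply/andP; split; lra.
Qed.

Lemma diam_cell f (x y : 'rV[R]_n) i : cell f x -> cell f y -> `|x 0 i - y 0 i| <= d.
Proof.
move=> [_ /(_ i) cx] [_ /(_ i) cy]; move: cx cy.
by rewrite -natr1 mulrDr mulr1 => /andP[? ?] /andP[? ?]; rewrite ler_norml; apply/andP; split; lra.
Qed.

Let idx (y : R) := Num.truncn (y / d).

Let idxP (y : R) (j : nat) : 0 <= y -> (idx y == j) = (d * j%:R <= y < d * j.+1%:R).
Proof.
move=> y0; rewrite /idx truncn_eq; last by rewrite divr_ge0// ltW.
by rewrite ler_pdivlMr// ltr_pdivrMr// ![_ * d]mulrC.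
Qed.

Let coord_bound (x : 'rV[R]_n) i : B x -> 0 <= x 0 i + M <= 2 * M.
Proof.
by move=> /BM/(_ i); rewrite ler_norml => /andP[? ?]; apply/andP; split; lra.
Qed.

Lemma bigcup_cell : B = \bigcup_f cell f.
Proof.
apply/seteqP; split => [x Bx|x [f _ []]//].
have lt i : (idx (x 0%R i + M) < k.+1)%N.
  have /andP[x0 xM] := coord_bound i Bx.
  rewrite -(ltr_nat R); apply: le_lt_trans kM.
  have /andP[+ _] : d * (idx (x 0 i + M))%:R <= x 0 i + M < d * (idx (x 0 i + M)).+1%:R.
    by rewrite -idxP.
  rewrite mulrC ler_pdivlMr// => /le_trans; exact.
exists [ffun i => Ordinal (lt i)] => //; split => // i; rewrite ffunE -idxP//.
by have /andP[] := coord_bound i Bx.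
Qed.

Lemma trivIset_cell : trivIset setT cell.
Proof.
move=> f g _ _ [x [[Bx cf] [_ cg]]]; apply/ffunP => i.
have /andP[x0 _] := coord_bound i Bx.
have := cf i; have := cg i; rewrite -!idxP// => /eqP gE /eqP fE.
by apply: val_inj => /=; rewrite -fE -gE.
Qed.

(** Normalized so that its square is exactly the contribution of the mean of u to
    the mean square over the cell. On a null cell it is 0, by the convention for
    division by 0. *)
Definition cell_mean f u : R :=
  (\int[leb R n]_(x in cell f) u x) / Num.sqrt (fine (leb R n (cell f))).

Let sqc f u : sqint (leb R n) B u -> sqint (leb R n) (cell f) u.
Proof.
move=> [mu iu]; split; first exact: measurable_funS (mB) (@sub_cell f) mu.
exact: (integrableS mB (measurable_cell f) (@sub_cell f) iu).
Qed.

Lemma cell_meanB f u v : sqint (leb R n) B u -> sqint (leb R n) B v ->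
  cell_mean f (fun x => u x - v x) = cell_mean f u - cell_mean f v.
Proof.
move=> /(@sqc f) su /(@sqc f) sv; rewrite /cell_mean RintegralB ?mulrBl//.
- exact: measurable_cell.
- by apply: sqint_integrable; [exact: measurable_cell|exact: leb_cell_lty|].
- by apply: sqint_integrable; [exact: measurable_cell|exact: leb_cell_lty|].
Qed.

Let w f : R := fine (leb R n (cell f)).
Let w0 f : 0 <= w f. Proof. exact: fine_ge0. Qed.

Let cell_mean_sq f u : cell_mean f u ^+ 2 = (\int[leb R n]_(x in cell f) u x) ^+ 2 / w f.
Proof. by rewrite /cell_mean exprMn exprVn sqr_sqrtr//; exact: w0. Qed.

Let cell_null f u : sqint (leb R n) B u -> w f = 0 ->
  \int[leb R n]_(x in cell f) (u x ^+ 2) = 0.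
Proof.
move=> su; have [_ iu] := @sqc f _ su; rewrite /w => /eqP.
rewrite fine_eq0 ?ge0_fin_numE ?leb_cell_lty// => /eqP wf.
rewrite /Rintegral null_set_integral//; first exact: measurable_cell.
by case/integrableP: iu.
Qed.

Let sqr_partition u : sqint (leb R n) B u -> ip (leb R n) B u u =
  \sum_f \int[leb R n]_(x in cell f) (u x ^+ 2).
Proof.
move=> [mu iu]; rewrite /ip; under eq_Rintegral do rewrite -expr2.
apply: Rintegral_finite_partition => //.
- exact: measurable_cell.
- exact: trivIset_cell.
- exact: bigcup_cell.
- by move=> x _; exact: sqr_ge0.
Qed.

Lemma cell_mean_le f u : sqint (leb R n) B u -> cell_mean f u ^+ 2 <= ip (leb R n) B u u.
Proof.
move=> su; have sc := @sqc f _ su; rewrite cell_mean_sq sqr_partition// (bigD1 f)//=.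
apply: ler_wpDr; first by apply: sumr_ge0 => g _; apply: Rintegral_ge0 => x _; exact: sqr_ge0.
have [wf|wf] := eqVneq (w f) 0; first by rewrite cell_null// wf invr0 mulr0.
have wp : 0 < w f by rewrite lt_def wf w0.
have mc := measurable_cell f.
have := ip_cauchy_schwarz mc sc (sqint_cst mc (leb_cell_lty f) 1).
rewrite /ip ler_pdivrMr//; under eq_Rintegral do rewrite mulr1.
under [X in _ <= X * _]eq_Rintegral do rewrite -expr2.
by rewrite Rintegral_cst// mulr1 mul1r.
Qed.

(** Summing the Poincare inequality over the cells: up to finitely many
    functionals the mean square is controlled by the energy, with a factor that
    tends to 0 with the mesh. *)
Lemma cell_poincare u : W12 B u -> ip (leb R n) B u u <=
  n%:R * d ^+ 2 * 2 ^+ n * grad_ip B u u + \sum_f cell_mean f u ^+ 2.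
Proof.
move=> Wu; have su := W12_sq Wu; rewrite sqr_partition//.
have -> : grad_ip B u u = \sum_f \int[leb R n]_(x in cell f) dotv (wgrad B u x) (wgrad B u x).
  apply: Rintegral_finite_partition => //.
  - exact: measurable_cell.
  - exact: trivIset_cell.
  - exact: bigcup_cell.
  - rewrite (_ : _ \o _ = fun x => \sum_(i < n) (wgrad B u x 0 i ^+ 2)%:E)%E.
      by apply: integrable_sum => // i; have [] := wgrad_sq i Wu.
    by apply/funext => x; rewrite /= /dotv sumEFin; congr EFin; apply: eq_bigr => i _; rewrite expr2.
  - by move=> x _; exact: dotv_ge0.
rewrite mulr_sumr -big_split/=; apply: ler_sum => f _.
have cd x y i : cell f x -> cell f y -> `|x 0 i - y 0 i| <= d by exact: diam_cell.
have := poincare_convex oB muB cB su (wgradP Wu) (measurable_cell f) (@sub_cell f) (@convex_cell f) cd.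
have g0 : 0 <= \int[leb R n]_(x in cell f) dotv (wgrad B u x) (wgrad B u x).
  by apply: Rintegral_ge0 => x _; exact: dotv_ge0.
rewrite cell_mean_sq -/(w f); have [wf _|wf] := eqVneq (w f) 0.
  by rewrite cell_null// wf invr0 mulr0 addr0 !mulr_ge0 ?sqr_ge0 ?exprn_ge0//; exact: ltW.
have wp : 0 < w f by rewrite lt_def wf; exact: w0.
rewrite -[leLHS]mulrC -ler_pdivlMr// mulrDl addrC => /le_trans; apply.
by rewrite lerD2l [leLHS]mulrAC mulfK.
Qed.

End compactness.

(** * Spectral theory of a pair of forms *)

Section psd_form.
Context {R : realType} {V : lmodType R}.
Implicit Types (f : V -> V -> R) (u v w : V).

(** Neither form is definite in the application: the energy vanishes on constants,
    and the mass on functions that are 0 almost everywhere, which stay distinct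
    from 0. *)
Definition psd_form f : Prop :=
  [/\ forall c u v w, f (c *: u + v) w = c * f u w + f v w,
      forall u v, f u v = f v u & forall u, 0 <= f u u].

Variable f : V -> V -> R.
Hypothesis psdf : psd_form f.

Lemma psdC u v : f u v = f v u. Proof. by case: psdf. Qed.
Lemma psd_ge0 u : 0 <= f u u. Proof. by case: psdf. Qed.

Lemma psdDl u v w : f (u + v) w = f u w + f v w.
Proof. by case: psdf => H _ _; have := H 1 u v w; rewrite scale1r mul1r. Qed.

Lemma psd0l w : f 0 w = 0.
Proof. by have := psdDl 0 0 w; rewrite addr0 => /eqP; rewrite -subr_eq subrr eq_sym => /eqP. Qed.

Lemma psdZl c u w : f (c *: u) w = c * f u w.
Proof. by case: psdf => H _ _; have := H c u 0 w; rewrite addr0 psd0l addr0. Qed.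

Lemma psdNl u w : f (- u) w = - f u w.
Proof. by rewrite -scaleN1r psdZl mulN1r. Qed.

Lemma psdBl u v w : f (u - v) w = f u w - f v w.
Proof. by rewrite psdDl psdNl. Qed.

Lemma psdDr u v w : f w (u + v) = f w u + f w v.
Proof. by rewrite !(psdC w) psdDl. Qed.
Lemma psdZr c u w : f w (c *: u) = c * f w u.
Proof. by rewrite !(psdC w) psdZl. Qed.
Lemma psdBr u v w : f w (u - v) = f w u - f w v.
Proof. by rewrite !(psdC w) psdBl. Qed.
Lemma psd0r w : f w 0 = 0. Proof. by rewrite psdC psd0l. Qed.

Lemma psdNr u w : f w (- u) = - f w u.
Proof. by rewrite !(psdC w) psdNl. Qed.

Definition psd_lin := (psdDl, psdNl, psdZl, psdDr, psdNr, psdZr, psd0l, psd0r).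

Lemma psd_suml (I : Type) (s : seq I) (F : I -> V) w :
  f (\sum_(i <- s) F i) w = \sum_(i <- s) f (F i) w.
Proof.
elim: s => [|i s IH]; first by rewrite !big_nil psd0l.
by rewrite !big_cons psdDl IH.
Qed.

Lemma psd_cauchy_schwarz u v : f u v ^+ 2 <= f u u * f v v.
Proof.
apply: quadratic_discr; first exact: psd_ge0.
move=> t; have := psd_ge0 (u + t *: v); rewrite !psd_lin (psdC v u).
by congr (_ <= _); ring.
Qed.

Lemma psd_null u v : f u u = 0 -> f u v = 0.
Proof.
move=> u0; have := psd_cauchy_schwarz u v; rewrite u0 mul0r => H.
by apply/eqP; rewrite -sqrf_eq0 eq_le H sqr_ge0.
Qed.

(** Convergence for the seminorm of f; limits are unique only up to null vectors. *)
Definition fcvg (w : nat -> V) u : Prop := forall e, 0 < e ->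
  exists N : nat, forall k, (N <= k)%N -> f (w k - u) (w k - u) <= e.

Lemma fcvg_form (w : nat -> V) u v : fcvg w u -> forall e, 0 < e ->
  exists N : nat, forall k, (N <= k)%N -> `|f (w k) v - f u v| <= e.
Proof.
move=> wu e e0; have v0 := psd_ge0 v.
have d0 : 0 < e ^+ 2 / (f v v + 1) by rewrite divr_gt0 ?exprn_gt0//; lra.
have [N HN] := wu _ d0; exists N => k /HN {}HN.
rewrite -ler_sqr ?nnegrE ?(ltW e0)// real_normK ?num_real// -psdBl.
apply: le_trans (psd_cauchy_schwarz _ _) _.
apply: (@le_trans _ _ (e ^+ 2 / (f v v + 1) * f v v)); first by rewrite ler_wpM2r.
rewrite mulrAC -mulrA ler_piMr ?sqr_ge0// ler_pdivrMr; lra.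
Qed.

Lemma fcvg_sqr (w : nat -> V) u : fcvg w u -> forall e, 0 < e ->
  exists N : nat, forall k, (N <= k)%N -> `|f (w k) (w k) - f u u| <= e.
Proof.
move=> wu e e0.
have e2 : 0 < e / 2 by lra. have e4 : 0 < e / 4 by lra.
have [N1 H1] := wu _ e2; have [N2 H2] := fcvg_form u wu e4.
exists (maxn N1 N2) => k; rewrite geq_max => /andP[/H1 {}H1 /H2 {}H2].
have -> : f (w k) (w k) - f u u = f (w k - u) (w k - u) + 2 * (f (w k) u - f u u).
  by rewrite !psd_lin (psdC u (w k)); ring.
apply: le_trans (ler_normD _ _) _.
rewrite (ger0_norm (psd_ge0 _)) normrM (@ger0_norm _ 2)//; lra.
Qed.

End psd_form.

Lemma eq_of_close (R : realFieldType) (x y : R) :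
  (forall e, 0 < e -> `|x - y| <= e) -> x = y.
Proof.
move=> H; apply/eqP; rewrite -subr_eq0 -normr_eq0 eq_le normr_ge0 andbT.
by apply/ler_addgt0Pr => e /H; rewrite add0r.
Qed.

Lemma invS_small (R : realType) (e : R) : 0 < e ->
  exists N : nat, forall k, (N <= k)%N -> k.+1%:R^-1 <= e.
Proof.
move=> e0; have [N _ HN] := near_infty_natSinv_lt (PosNum e0).
by exists N => k /HN /ltW.
Qed.

Lemma ultra_bounded_cvg (R : realType) (U : set_system nat) (g : nat -> R) (c : R) :
  UltraFilter U -> (forall k, `|g k| <= c) ->
  exists p, forall e, 0 < e -> U [set k | `|g k - p| < e].
Proof.
move=> UU gc.
have cpt : compact (`[- c, c]%classic : set R) by exact: segment_compact.
have : (g @ U) `[- c, c]%classic.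
  apply: (@filterS _ U _ setT); last exact: filterT.
  by move=> k _ /=; rewrite in_itv/= -ler_norml.
move=> /cpt[p [_ clp]]; exists p => e e0.
have [//|nU] := in_ultra_setVsetC [set k | `|g k - p| < e] UU.
have [x [/= nx xp]] := clp (~` [set y | `|y - p| < e]) (ball p e) nU (nbhsx_ballx p e e0).
by exfalso; apply: nx; move: xp; rewrite /ball/= distrC.
Qed.

Section spectral.
Context {R : realType} {V : lmodType R}.
Implicit Types (u v w phi psi : V).
Variables (a b : V -> V -> R) (mu : nat -> R).
Hypotheses (psda : psd_form a) (psdb : psd_form b).

Let s u v := b u v + a u v.

Hypothesis complete : forall w : nat -> V,
  (forall e, 0 < e -> exists N : nat, forall k l, (N <= k)%N -> (N <= l)%N ->
     s (w k - w l) (w k - w l) <= e) -> exists u, fcvg s w u.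
(* This replaces the compact embedding of the form domain: up to finitely many
   bounded functionals, b is an arbitrarily small multiple of a. *)
Hypothesis compactness : forall e, 0 < e -> exists (I : finType) (l : I -> V -> R) (K : R),
  [/\ forall i u v, l i (u - v) = l i u - l i v,
      forall i u, l i u ^+ 2 <= K * b u u &
      forall u, b u u <= e * a u u + \sum_i l i u ^+ 2].
Hypothesis null_form : forall u, b u u = 0 -> a u u = 0.

Definition eigen lambda phi : Prop := forall v, a phi v = lambda * b phi v.

Hypotheses (mu0 : mu 0%N = 0) (mu_lt : forall k, mu k < mu k.+1).
Hypothesis mu_spec : forall lambda,
  (exists2 phi, eigen lambda phi & b phi phi <> 0) <-> exists k, mu k = lambda.

Let psds : psd_form s.
Proof.
split=> [c u v w|u v|u]; rewrite /s.
- by rewrite !(psd_lin psda) !(psd_lin psdb); ring.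
- by rewrite (psdC psda) (psdC psdb).
- by rewrite addr_ge0 ?(psd_ge0 psda) ?(psd_ge0 psdb).
Qed.

Let a0 u : 0 <= a u u. Proof. exact: psd_ge0. Qed.
Let b0 u : 0 <= b u u. Proof. exact: psd_ge0. Qed.

Lemma fcvg_a (w : nat -> V) u : fcvg s w u -> fcvg a w u.
Proof.
move=> wu e /wu[N HN]; exists N => k /HN; apply: le_trans.
by rewrite /s lerDr.
Qed.

Lemma fcvg_b (w : nat -> V) u : fcvg s w u -> fcvg b w u.
Proof.
move=> wu e /wu[N HN]; exists N => k /HN; apply: le_trans.
by rewrite /s lerDl.
Qed.

(** Along an ultrafilter finer than infinity every bounded scalar sequence
    converges, in particular each of the functionals that control b up to a small
    multiple of a. So for each j there is a large set of indices on which the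
    sequence varies by at most 1/j, and a diagonal choice gives the subsequence. *)
Lemma precompact (v : nat -> V) (M : R) : (forall k, s (v k) (v k) <= M) ->
  exists kk : nat -> nat, (forall j, (j <= kk j)%N) /\
    forall e, 0 < e -> exists N : nat, forall i j, (N <= i)%N -> (N <= j)%N ->
      b (v (kk i) - v (kk j)) (v (kk i) - v (kk j)) <= e.
Proof.
move=> vM.
have M0 : 0 <= M by apply: le_trans (vM 0%N); exact: psd_ge0.
have [U [UU subU]] := @ultraFilterLemma _ (nbhs \oo : set_system nat) _.
have HU e : 0 < e -> exists2 A, U A & forall k l, A k -> A l ->
    b (v k - v l) (v k - v l) <= e.
  move=> e0; have d0 : 0 < e / (8 * (M + 1)) by rewrite divr_gt0//; lra.
  have [I [l [K [lB lK lC]]]] := compactness d0.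
  have lbd i k : `|l i (v k)| <= `|K| * M + 1.
    have KM0 : 0 <= `|K| * M by rewrite mulr_ge0.
    have H : l i (v k) ^+ 2 <= `|K| * M.
      apply: le_trans (lK _ _) _; apply: (@le_trans _ _ (`|K| * b (v k) (v k))).
        by rewrite ler_wpM2r// ler_norm.
      by rewrite ler_wpM2l//; apply: le_trans (vM k); rewrite /s lerDl.
    rewrite -ler_sqr ?nnegrE ?addr_ge0// real_normK ?num_real//.
    by apply: le_trans H _; nra.
  have /choice[p Hp] := fun i => ultra_bounded_cvg UU (lbd i).
  pose m : R := #|I|%:R.
  have m0 : 0 <= m by rewrite ler0n.
  pose d := Num.sqrt (e / (8 * (m + 1))).
  have e8 : 0 < e / (8 * (m + 1)) by rewrite divr_gt0//; lra.
  have dp : 0 < d by rewrite sqrtr_gt0.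
  have d2 : d ^+ 2 = e / (8 * (m + 1)) by rewrite sqr_sqrtr// ltW.
  exists [set k | forall i, `|l i (v k) - p i| < d].
    by apply: filter_forall => i; exact: Hp.
  move=> k k' Ak Ak'; apply: le_trans (lC _) _.
  have H1 : e / (8 * (M + 1)) * a (v k - v k') (v k - v k') <= e / 2.
    apply: (@le_trans _ _ (e / (8 * (M + 1)) * (4 * M))).
      rewrite ler_wpM2l ?(ltW d0)//.
      have := psd_ge0 psda (v k + v k'); rewrite !(psd_lin psda) => pp.
      have ak : a (v k) (v k) <= M by apply: le_trans (vM k); rewrite /s lerDr.
      have ak' : a (v k') (v k') <= M by apply: le_trans (vM k'); rewrite /s lerDr.
      lra.
    have -> : e / (8 * (M + 1)) * (4 * M) = e / 2 * (M / (M + 1)) by field; rewrite gt_eqF//; lra.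
    by rewrite ler_piMr ?ler_pdivrMr; lra.
  have H2 : \sum_i l i (v k - v k') ^+ 2 <= e / 2.
    apply: (@le_trans _ _ (\sum_(i : I) 4 * d ^+ 2)).
      apply: ler_sum => i _; rewrite lB; have h1 := Ak i; have h2 := Ak' i.
      have H : `|l i (v k) - l i (v k')| <= 2 * d.
        have -> : l i (v k) - l i (v k') = (l i (v k) - p i) - (l i (v k') - p i) by ring.
        by apply: le_trans (ler_normB _ _) _; lra.
      rewrite -(real_normK (num_real (l i (v k) - l i (v k')))).
      have -> : 4 * d ^+ 2 = (2 * d) ^+ 2 by ring.
      by rewrite ler_sqr ?nnegrE// mulr_ge0// ltW.
    have -> : \sum_(i : I) 4 * d ^+ 2 = m * (4 * d ^+ 2).
      by rewrite sumr_const [RHS]mulr_natl.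
    rewrite d2.
    have -> : m * (4 * (e / (8 * (m + 1)))) = e / 2 * (m / (m + 1)) by field; rewrite gt_eqF//; lra.
    by rewrite ler_piMr ?ler_pdivrMr; lra.
  lra.
have /choice[A HA] : forall j : nat, exists A : set nat, U A /\ forall k l, A k -> A l ->
    b (v k - v l) (v k - v l) <= j.+1%:R^-1.
  by move=> j; have [|A UA HA] := HU j.+1%:R^-1; [rewrite invr_gt0|exists A].
have /choice[kk Hkk] : forall j : nat, exists k : nat, (j <= k)%N /\ forall i, (i <= j)%N -> A i k.
  move=> j.
  have : U ([set k | (j <= k)%N] `&` [set k | forall i : 'I_j.+1, A i k]).
    apply: filterI; first by apply: subU; exists j.
    by apply: filter_forall => i; exact: (HA i).1.
  move=> /(@filter_ex _ _ _)[k [jk Hk]]; exists k; split => // i ij.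
  exact: (Hk (Ordinal (ij : (i < j.+1)%N))).
exists kk; split=> [j|e e0]; first exact: (Hkk j).1.
have [N /(_ N (leqnn N)) HN] := invS_small e0.
exists N => i j Ni Nj; apply: le_trans HN; apply: (HA N).2; exact: (Hkk _).2.
Qed.

Definition closed_subspace (P : V -> Prop) : Prop :=
  (forall c u v, P u -> P v -> P (c *: u + v)) /\
  (forall (w : nat -> V) u, (exists N : nat, forall k, (N <= k)%N -> P (w k)) ->
     fcvg s w u -> P u).

Section subspace.
Variable P : V -> Prop.
Hypothesis Psub : closed_subspace P.

Lemma subspaceD u v : P u -> P v -> P (u + v).
Proof. by move=> Pu Pv; have := Psub.1 1 _ _ Pu Pv; rewrite scale1r. Qed.

Lemma subspace0 u : P u -> P 0.
Proof. by move=> Pu; have := Psub.1 (-1) _ _ Pu Pu; rewrite scaleN1r addNr. Qed.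

Lemma subspaceZ c u : P u -> P (c *: u).
Proof.
by move=> Pu; have := Psub.1 c _ _ Pu (subspace0 Pu); rewrite addr0.
Qed.

(** Along a minimizing sequence of the Rayleigh quotient, the parallelogram
    identity turns Cauchy sequences for b into Cauchy sequences for a. *)
Lemma rayleigh_minimizer v : P v -> b v v <> 0 ->
  exists u, [/\ P u, b u u = 1 & forall w, P w -> a u u * b w w <= a w w].
Proof.
move=> Pv bv.
pose S := [set a u u | u in [set u | P u /\ b u u = 1]].
have normalize w : P w -> b w w <> 0 -> exists2 c, c ^+ 2 * b w w = 1 & P (c *: w) /\ b (c *: w) (c *: w) = 1.
  move=> Pw bw; have bp : 0 < b w w by rewrite lt_def b0 andbT; apply/eqP.
  have H : (Num.sqrt (b w w))^-1 ^+ 2 * b w w = 1.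
    by rewrite exprVn sqr_sqrtr ?b0// mulVf// gt_eqF.
  exists (Num.sqrt (b w w))^-1 => //; split; first exact: subspaceZ.
  by rewrite !(psd_lin psdb) mulrA -expr2.
have S0 : S !=set0.
  have [c _ [Pcv bcv]] := normalize _ Pv bv.
  by exists (a (c *: v) (c *: v)); exists (c *: v).
have Slb : has_lbound S by exists 0 => _ [u _ <-].
pose la := inf S.
have la0 : 0 <= la by apply: lb_le_inf => // _ [u _ <-].
have ray w : P w -> la * b w w <= a w w.
  move=> Pw; have [->|/eqP bw] := eqVneq (b w w) 0; first by rewrite mulr0.
  have [c c1 [Pcw bcw]] := normalize _ Pw bw.
  have : la <= a (c *: w) (c *: w) by apply: ge_inf => //; exists (c *: w).
  rewrite !(psd_lin psda) mulrA -expr2 => H.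
  by have := ler_wpM2r (b0 w) H; rewrite mulrAC c1 mul1r.
have /choice[w Hw] : forall k : nat, exists w, [/\ P w, b w w = 1 & a w w <= la + k.+1%:R^-1].
  move=> k; have k0 : 0 < k.+1%:R^-1 :> R by rewrite invr_gt0.
  have [_ [w [Pw bw] <-] aw] := inf_adherent k0 (conj S0 Slb).
  by exists w; split => //; exact: ltW.
have Pw k : P (w k) by case: (Hw k).
have bw k : b (w k) (w k) = 1 by case: (Hw k).
have aw k : a (w k) (w k) <= la + k.+1%:R^-1 by case: (Hw k).
have k1 (k : nat) : k.+1%:R^-1 <= 1 :> R by rewrite invf_le1// ler1n.
have [kk [kkj kkC]] : exists kk : nat -> nat, (forall j, (j <= kk j)%N) /\
    forall e, 0 < e -> exists N : nat, forall i j, (N <= i)%N -> (N <= j)%N ->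
      b (w (kk i) - w (kk j)) (w (kk i) - w (kk j)) <= e.
  apply: (@precompact w (la + 2)) => k; rewrite /s bw.
  move: (aw k) (k1 k); move: (k.+1%:R^-1 : R) (a (w k) (w k)) => x y; lra.
have [|u ucv] := @complete (w \o kk).
  move=> e e0.
  have d0 : 0 < e / (la + 5) by rewrite divr_gt0//; lra.
  have [N1 H1] := kkC _ d0; have [N2 H2] := invS_small d0.
  exists (maxn N1 N2) => k l; rewrite !geq_max => /andP[k1' k2] /andP[l1 l2].
  have := H1 k l k1' l1; set x := w (kk k); set y := w (kk l) => bxy.
  have ax : a x x <= la + e / (la + 5).
    by apply: le_trans (aw _) _; rewrite lerD2l; apply: H2; exact: leq_trans (kkj _).
  have ay : a y y <= la + e / (la + 5).
    by apply: le_trans (aw _) _; rewrite lerD2l; apply: H2; exact: leq_trans (kkj _).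
  have axy := ray _ (subspaceD (Pw (kk k)) (Pw (kk l))); rewrite -/x -/y in axy.
  have bx : b x x = 1 by exact: bw. have by_ : b y y = 1 by exact: bw.
  move: bxy axy; rewrite /= -/x -/y /s !(psd_lin psda) !(psd_lin psdb) bx by_.
  rewrite (psdC psda y x) (psdC psdb y x).
  set A := a x y in ax ay *; set Bq := b x y => bxy axy.
  have lb : la * (1 - Bq + (- Bq + 1)) <= la * (e / (la + 5)).
    by rewrite ler_wpM2l//; lra.
  have ee : e = (la + 5) * (e / (la + 5)) by field; rewrite gt_eqF//; lra.
  by set d := e / (la + 5) in ax ay bxy lb ee d0 *; rewrite ee; nra.
have Pu : P u by apply: (Psub.2 (w \o kk)) => //; exists 0%N => k _; exact: Pw.
have bu : b u u = 1.
  apply: eq_of_close => e e0; have [N HN] := fcvg_sqr psdb (fcvg_b ucv) e0.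
  by have := HN N (leqnn _); rewrite /= bw distrC.
have au : a u u = la.
  apply/eqP; rewrite eq_le; apply/andP; split; last by have := ray _ Pu; rewrite bu mulr1.
  apply/ler_addgt0Pr => e e0; have e2 : 0 < e / 2 by lra.
  have [N1 H1] := fcvg_sqr psda (fcvg_a ucv) e2.
  have [N2 H2] := invS_small e2.
  pose k := maxn N1 N2; have := H1 k (leq_maxl _ _); rewrite ler_distl => /andP[h _].
  have h2 : a (w (kk k)) (w (kk k)) <= la + e / 2.
    by apply: le_trans (aw _) _; rewrite lerD2l; exact: H2 _ (leq_trans (leq_maxr _ _) (kkj _)).
  by move: h; rewrite /=; lra.
by exists u; split => // z Pz; rewrite au; exact: ray.
Qed.

(** The first-order condition: the quadratic polynomial in t obtained from the
    minimality at u + t w is nonnegative and has zero constant term. *)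
Lemma minimizer_eigen u : P u -> b u u = 1 ->
  (forall w, P w -> a u u * b w w <= a w w) ->
  forall w, P w -> a u w = a u u * b u w.
Proof.
move=> Pu bu umin w Pw; apply/eqP; rewrite -subr_eq0 -sqrf_eq0 eq_le sqr_ge0 andbT.
rewrite -(mul0r (a w w - a u u * b w w)); apply: quadratic_discr.
  by rewrite subr_ge0; exact: umin.
move=> t; have := umin _ (subspaceD Pu (subspaceZ t Pw)).
rewrite !(psd_lin psda) !(psd_lin psdb) (psdC psda w u) (psdC psdb w u) bu.
by rewrite -subr_ge0; congr (_ <= _); ring.
Qed.

(** On a subspace where a is dominated by b, a Cauchy sequence for b is also one
    for a + b, so the usual argument with a minimizing sequence applies even though
    V is only complete for a + b. *)
Lemma projection_exists (m : R) u : P 0 -> (forall w, P w -> a w w <= m * b w w) ->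
  exists2 p, P p & forall w, P w -> b (u - p) w = 0.
Proof.
move=> P0 am.
pose S := [set b (u - p) (u - p) | p in [set p | P p]].
have Slb : has_lbound S by exists 0 => _ [p _ <-].
have S0 : S !=set0 by exists (b (u - 0) (u - 0)), 0.
pose d := inf S.
have dmin p : P p -> d <= b (u - p) (u - p) by move=> Pp; apply: ge_inf => //; exists p.
have /choice[p Hp] : forall k : nat, exists p, P p /\ b (u - p) (u - p) <= d + k.+1%:R^-1.
  move=> k; have k0 : 0 < k.+1%:R^-1 :> R by rewrite invr_gt0.
  have [_ [p Pp <-] bp] := inf_adherent k0 (conj S0 Slb).
  by exists p; split => //; exact: ltW.
have bpC e : 0 < e -> exists N : nat, forall k l, (N <= k)%N -> (N <= l)%N ->
    b (p k - p l) (p k - p l) <= e.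
  move=> e0; have e4 : 0 < e / 4 by lra.
  have [N HN] := invS_small e4; exists N => k l /HN hk /HN hl.
  have [Pk bk] := Hp k; have [Pl bl] := Hp l.
  have bk' : b (u - p k) (u - p k) <= d + e / 4 by apply: le_trans bk _; rewrite lerD2l.
  have bl' : b (u - p l) (u - p l) <= d + e / 4 by apply: le_trans bl _; rewrite lerD2l.
  have := dmin _ (subspaceZ 2^-1 (subspaceD Pk Pl)).
  move: bk' bl'; rewrite !(psd_lin psdb).
  rewrite (psdC psdb (p k) u) (psdC psdb (p l) u) (psdC psdb (p l) (p k)); lra.
have [|q qcv] := @complete p.
  move=> e e0; have d0 : 0 < e / (1 + `|m|) by rewrite divr_gt0// ltr_pwDl.
  have [N HN] := bpC _ d0; exists N => k l Nk Nl.
  have := HN k l Nk Nl; set x := p k - p l => bx.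
  have Px : P x.
    have := Psub.1 (-1) _ _ (Hp l).1 (Hp k).1; rewrite scaleN1r addrC; exact.
  have ax : a x x <= `|m| * b x x.
    by apply: le_trans (am _ Px) _; rewrite ler_wpM2r// ler_norm.
  apply: (@le_trans _ _ ((1 + `|m|) * b x x)); first by rewrite /s mulrDl mul1r lerD2l.
  by rewrite mulrC -ler_pdivlMr// ltr_pwDl.
have Pq : P q by apply: (Psub.2 p) => //; exists 0%N => k _; case: (Hp k).
have bq : b (u - q) (u - q) <= d.
  apply/ler_addgt0Pr => e e0; have e2 : 0 < e / 2 by lra.
  have cv : fcvg b (fun k => u - p k) (u - q).
    move=> e' e'0; have [N HN] := fcvg_b qcv e'0; exists N => k /HN.
    have -> : u - p k - (u - q) = - (p k - q) by rewrite [- (u - q)]opprB [RHS]opprB addrC addrA subrK.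
    by rewrite !(psd_lin psdb); lra.
  have [N1 H1] := fcvg_sqr psdb cv e2; have [N2 H2] := invS_small e2.
  have := H1 (maxn N1 N2) (leq_maxl _ _); rewrite ler_distl => /andP[h _].
  have h2 : b (u - p (maxn N1 N2)) (u - p (maxn N1 N2)) <= d + e / 2.
    by apply: le_trans (Hp _).2 _; rewrite lerD2l; exact: H2 _ (leq_maxr _ _).
  lra.
exists q => // w Pw.
apply/eqP; rewrite -sqrf_eq0 eq_le sqr_ge0 andbT.
rewrite -(mul0r (b w w)); apply: quadratic_discr => // t.
have := le_trans bq (dmin _ (subspaceD Pq (subspaceZ (- t) Pw))).
rewrite !(psd_lin psdb) (psdC psdb q u) (psdC psdb w u) (psdC psdb w q); lra.
Qed.

End subspace.

Lemma eigen_closed la : closed_subspace (eigen la).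
Proof.
split=> [c u v eu ev w|w u [N HN] wu v].
  by rewrite (psdDl psda) (psdZl psda) eu ev (psdDl psdb) (psdZl psdb); ring.
apply: eq_of_close => e e0.
have d0 : 0 < e / (1 + `|la|) by rewrite divr_gt0// ltr_pwDl.
have [N1 H1] := fcvg_form psda v (fcvg_a wu) d0.
have [N2 H2] := fcvg_form psdb v (fcvg_b wu) d0.
pose k := maxn N (maxn N1 N2).
have kN : (N <= k)%N by exact: leq_maxl.
have k1 : (N1 <= k)%N by rewrite (leq_trans (leq_maxl _ _) (leq_maxr _ _)).
have k2 : (N2 <= k)%N by rewrite (leq_trans (leq_maxr _ _) (leq_maxr _ _)).
have := H1 k k1; have := H2 k k2; have := HN k kN v => ek hb ha.
have -> : a u v - la * b u v = (a u v - a (w k) v) + la * (b (w k) v - b u v).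
  by rewrite ek; ring.
apply: le_trans (ler_normD _ _) _; rewrite normrM distrC.
apply: (@le_trans _ _ (e / (1 + `|la|) + `|la| * (e / (1 + `|la|)))).
  by apply: lerD => //; rewrite ler_wpM2l.
by rewrite le_eqVlt; apply/orP; left; apply/eqP; field; rewrite gt_eqF// ltr_pwDl.
Qed.

Lemma eigen0 la : eigen la 0.
Proof. by move=> v; rewrite (psd0l psda) (psd0l psdb) mulr0. Qed.

Lemma eigen_projection k u : exists2 p, eigen (mu k) p &
  forall w, eigen (mu k) w -> b (u - p) w = 0.
Proof.
apply: (@projection_exists _ (eigen_closed (mu k)) (mu k)); first exact: eigen0.
by move=> w ew; rewrite ew.
Qed.

Definition eigenproj k u : V := sval (cid2 (eigen_projection k u)).

Lemma eigenproj_eigen k u : eigen (mu k) (eigenproj k u).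
Proof. by rewrite /eigenproj; case: cid2. Qed.

Lemma eigenproj_orth k u w : eigen (mu k) w -> b (u - eigenproj k u) w = 0.
Proof. by rewrite /eigenproj; case: cid2 => p /= _ H /H. Qed.

Lemma mu_homo : {mono mu : k l / (k <= l)%N >-> k <= l}.
Proof. by apply: le_mono; apply: homo_ltn => //; exact: lt_trans. Qed.

Lemma mu_neq k l : k <> l -> mu k <> mu l.
Proof.
move=> kl e; apply: kl; apply/eqP; rewrite eqn_leq -!mu_homo e lexx//.
Qed.

Lemma eigen_orth k l phi psi : k <> l -> eigen (mu k) phi -> eigen (mu l) psi ->
  b phi psi = 0.
Proof.
move=> /mu_neq/eqP kl ek el; have := ek psi; rewrite (psdC psda) el (psdC psdb psi).
move=> /eqP; rewrite -subr_eq0 -mulrBl mulf_eq0 => /orP[|/eqP //].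
by rewrite subr_eq0 eq_sym (negbTE kl).
Qed.

(** The part of u orthogonal to the first m + 1 eigenspaces. *)
Definition tail m u : V := u - \sum_(0 <= k < m.+1) eigenproj k u.

Lemma tailS m u : tail m u = tail m.+1 u + eigenproj m.+1 u.
Proof. by rewrite /tail [in RHS]big_nat_recr//= opprD addrA subrK. Qed.

Definition perp m : V -> Prop :=
  fun v => forall k phi, (k <= m)%N -> eigen (mu k) phi -> b v phi = 0.

Lemma perp_tail m u : perp m (tail m u).
Proof.
move=> k phi km ek; rewrite /tail (psdBl psdb) (psd_suml psdb).
rewrite (bigD1_seq k) ?mem_index_iota ?iota_uniq//= big1 ?addr0.
  by rewrite -(psdBl psdb) eigenproj_orth.
move=> j /eqP jk; apply: eigen_orth ek; [exact: jk|exact: eigenproj_eigen].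
Qed.

Lemma perp_a m v k phi : perp m v -> (k <= m)%N -> eigen (mu k) phi -> a v phi = 0.
Proof. by move=> pv km ek; rewrite (psdC psda) ek (psdC psdb) (pv k)// mulr0. Qed.

Lemma perp_closed m : closed_subspace (perp m).
Proof.
split=> [c u v pu pv k phi km ek|w u [N HN] wu k phi km ek].
  by rewrite !(psd_lin psdb) (pu k)// (pv k)// mulr0 addr0.
apply: eq_of_close => e e0; have [N1 H1] := fcvg_form psdb phi (fcvg_b wu) e0.
have := H1 (maxn N N1) (leq_maxr _ _).
by rewrite (HN _ (leq_maxl _ _) k phi km ek) distrC.
Qed.

(** A minimizer of the Rayleigh quotient on the complement of the first m + 1
    eigenspaces is an eigenvector of the whole space, since a and b both vanish
    between the complement and those eigenspaces. Its eigenvalue is on the list, and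
    not among the first m + 1 values. *)
Lemma perp_rayleigh m v : perp m v -> mu m.+1 * b v v <= a v v.
Proof.
move=> pv; have [->|/eqP bv] := eqVneq (b v v) 0; first by rewrite mulr0.
have [u [pu bu umin]] := rayleigh_minimizer (perp_closed m) pv bv.
have eu : eigen (a u u) u.
  move=> w; have -> : w = tail m w + \sum_(0 <= k < m.+1) eigenproj k w by rewrite subrK.
  rewrite (psdDr psda) (psdDr psdb) mulrDr.
  rewrite (minimizer_eigen (perp_closed m) pu bu umin (@perp_tail m w)); congr (_ + _).
  rewrite (psdC psda) (psdC psdb) (psd_suml psda) (psd_suml psdb).
  rewrite !big_nat [X in _ = _ * X]big1 ?mulr0; last first.
    by move=> k /andP[_ km]; rewrite (psdC psdb) (pu k)//; exact: eigenproj_eigen.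
  rewrite big1// => k /andP[_ km]; rewrite (psdC psda).
  by rewrite (perp_a pu _ (eigenproj_eigen k w)).
have [k muk] : exists k, mu k = a u u by apply/mu_spec; exists u => //; rewrite bu; exact/eqP/oner_neq0.
have km : (m < k)%N.
  rewrite ltnNge; apply/negP => km; have := pu k u km; rewrite muk bu => /(_ eu)/eqP.
  by rewrite oner_eq0.
by apply: le_trans (umin v pv); rewrite -muk ler_wpM2r// mu_homo.
Qed.

(** Otherwise orthonormal eigenvectors would have bounded energy, hence a Cauchy
    subsequence, although their mutual square distances equal 2. *)
Lemma mu_unbounded M : exists k, M < mu k.
Proof.
apply: contrapT => nM; have muM k : mu k <= M.
  by rewrite leNgt; apply/negP => Mk; apply: nM; exists k.
have /choice[phi Hphi] : forall k, exists phi, eigen (mu k) phi /\ b phi phi = 1.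
  move=> k; have [phi ephi bphi] : exists2 phi, eigen (mu k) phi & b phi phi <> 0.
    by apply/mu_spec; exists k.
  have bp : 0 < b phi phi by rewrite lt_def b0 andbT; apply/eqP.
  exists ((Num.sqrt (b phi phi))^-1 *: phi); split.
    exact: subspaceZ (eigen_closed _) _ _ ephi.
  by rewrite !(psd_lin psdb) mulrA -expr2 exprVn sqr_sqrtr// mulVf// gt_eqF.
have [k|kk [kkj kkC]] := @precompact phi (1 + M).
  by have [e1 b1] := Hphi k; rewrite /s e1 b1 mulr1 lerD2l.
have [N HN] := kkC 1 ltr01.
have := HN N (kk N).+1 (leqnn _) (leqW (kkj N)).
have ne : kk N <> kk (kk N).+1.
  by move=> e; have := kkj (kk N).+1; rewrite -e ltnn.
have [eN bN] := Hphi (kk N); have [eK bK] := Hphi (kk (kk N).+1).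
rewrite !(psd_lin psdb) bN bK (eigen_orth ne eN eK).
by rewrite (psdC psdb) (eigen_orth ne eN eK); lra.
Qed.

Lemma b_tailS m u : b (tail m u) (tail m u) =
  b (tail m.+1 u) (tail m.+1 u) + b (eigenproj m.+1 u) (eigenproj m.+1 u).
Proof.
have h := @perp_tail m.+1 u _ _ (leqnn m.+1) (eigenproj_eigen m.+1 u).
rewrite tailS; move: (tail m.+1 u) (eigenproj m.+1 u) h => x y h.
rewrite !(psd_lin psdb) (psdC psdb y x) h; ring.
Qed.

(** Together with the previous identity this is the mechanism of the theorem:
    passing from one tail to the next removes the same component from both
    forms, weighted by the eigenvalue. *)
Lemma a_tailS m u : a (tail m u) (tail m u) =
  a (tail m.+1 u) (tail m.+1 u) + mu m.+1 * b (eigenproj m.+1 u) (eigenproj m.+1 u).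
Proof.
have h := perp_a (@perp_tail m.+1 u) (leqnn m.+1) (eigenproj_eigen m.+1 u).
rewrite -(eigenproj_eigen m.+1 u (eigenproj m.+1 u)) tailS.
move: (tail m.+1 u) (eigenproj m.+1 u) h => x y h.
rewrite !(psd_lin psda) (psdC psda y x) h; ring.
Qed.

Definition eigen_sum m : V -> Prop := fun Phi => exists2 e : nat -> V,
  (forall k, (k <= m)%N -> eigen (mu k) (e k)) & Phi = \sum_(0 <= k < m.+1) e k.

Lemma perp_eigen_sum m v Phi : perp m v -> eigen_sum m Phi -> b v Phi = 0.
Proof.
move=> pv [e ee ->]; rewrite (psdC psdb) (psd_suml psdb) big_nat big1// => k /andP[_ km].
by rewrite (psdC psdb); exact: pv (km) (ee k km).
Qed.

Lemma perp_eigen_sum_a m v Phi : perp m v -> eigen_sum m Phi -> a v Phi = 0.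
Proof.
move=> pv [e ee ->]; rewrite (psdC psda) (psd_suml psda) big_nat big1// => k /andP[_ km].
by rewrite (psdC psda); exact: perp_a pv km (ee k km).
Qed.

Lemma eigen_sumB m Phi Psi : eigen_sum m Phi -> eigen_sum m Psi -> eigen_sum m (Phi - Psi).
Proof.
move=> [e ee ->] [e' ee' ->]; exists (fun k => e k - e' k); last by rewrite sumrB.
move=> k km; have := (eigen_closed (mu k)).1 (-1) _ _ (ee' k km) (ee k km).
by rewrite scaleN1r addrC.
Qed.

Lemma eigen_sum_eigenproj m u : eigen_sum m (\sum_(0 <= k < m.+1) eigenproj k u).
Proof. by exists (eigenproj ^~ u) => // k _; exact: eigenproj_eigen. Qed.

Lemma split_eigen_sum m u Phi : exists2 Psi, eigen_sum m Psi & u - Phi = tail m u + Psi - Phi.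
Proof. by exists (\sum_(0 <= k < m.+1) eigenproj k u); [exact: eigen_sum_eigenproj|rewrite subrK]. Qed.

Lemma tail_min_b m u Phi : eigen_sum m Phi -> b (tail m u) (tail m u) <= b (u - Phi) (u - Phi).
Proof.
move=> MPhi; have [Psi MPsi ->] := split_eigen_sum m u Phi.
have := perp_eigen_sum (@perp_tail m u) (eigen_sumB MPsi MPhi).
rewrite -addrA; move: (tail m u) (Psi - Phi) => x y h.
by rewrite !(psd_lin psdb) (psdC psdb y x) h; have := b0 y; lra.
Qed.

Lemma tail_min_a m u Phi : eigen_sum m Phi -> a (tail m u) (tail m u) <= a (u - Phi) (u - Phi).
Proof.
move=> MPhi; have [Psi MPsi ->] := split_eigen_sum m u Phi.
have := perp_eigen_sum_a (@perp_tail m u) (eigen_sumB MPsi MPhi).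
rewrite -addrA; move: (tail m u) (Psi - Phi) => x y h.
by rewrite !(psd_lin psda) (psdC psda y x) h; have := a0 y; lra.
Qed.

Lemma tail_eigen_sum m Phi : eigen_sum m Phi -> b (tail m Phi) (tail m Phi) = 0.
Proof.
move=> MPhi; rewrite [in X in b _ X]/tail (psdBr psdb).
by rewrite !(perp_eigen_sum (@perp_tail m Phi))// ?subrr//; exact: eigen_sum_eigenproj.
Qed.

Lemma tail_diff m l u : (m <= l)%N -> eigen_sum l (tail m u - tail l u).
Proof.
move=> ml; rewrite /tail opprB addrC addrA subrK.
exists (fun k => if (k <= m)%N then 0 else eigenproj k u).
  by move=> k _; case: ifP => _; [exact: eigen0|exact: eigenproj_eigen].
rewrite (@big_cat_nat _ _ _ m.+1) //= [RHS](@big_cat_nat _ _ _ m.+1)//=.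
rewrite [X in _ = X + _]big_nat [X in _ = X + _]big1 ?add0r; last first.
  by move=> k /= km; rewrite ifT.
rewrite addrC addKr big_nat [RHS]big_nat; apply: eq_bigr => k /andP[mk _].
by rewrite leqNgt mk.
Qed.

Lemma perpW m l v : (m <= l)%N -> perp l v -> perp m v.
Proof. by move=> ml pv k phi km; apply: pv; exact: leq_trans ml. Qed.

Lemma pythagoras x y : b y x = 0 -> a y x = 0 -> s (x + y) (x + y) = s x x + s y y.
Proof.
by move=> hb ha; rewrite /s !(psd_lin psda) !(psd_lin psdb) (psdC psdb x y)
  (psdC psda x y) ha hb; ring.
Qed.

Lemma tail_pythagoras m l u : (m <= l)%N ->
  s (tail m u) (tail m u) =
  s (tail m u - tail l u) (tail m u - tail l u) + s (tail l u) (tail l u).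
Proof.
move=> ml; have Md := tail_diff u ml.
have := pythagoras (perp_eigen_sum (@perp_tail l u) Md) (perp_eigen_sum_a (@perp_tail l u) Md).
by move: (tail m u) (tail l u) => x y; rewrite subrK.
Qed.

(** The norms of the tails decrease, so by Pythagoras the tails form a Cauchy
    sequence. Their limit is orthogonal to every eigenspace; its Rayleigh quotient
    would exceed every eigenvalue, so it is a null vector. *)
Lemma a_tail_cvg0 u e : 0 < e ->
  exists N : nat, forall m, (N <= m)%N -> a (tail m u) (tail m u) <= e.
Proof.
pose x m := s (tail m u) (tail m u).
have x0 m : 0 <= x m by exact: psd_ge0.
have hasinf : has_inf (range x).
  by split; [exists (x 0%N), 0%N|exists 0 => _ [m _ <-]].
have [|w wcv] := @complete (tail ^~ u).
  move: e => _ e e0; have [_ [N _ <-] xN] := inf_adherent e0 hasinf.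
  have key k l : (N <= k)%N -> (k <= l)%N ->
      s (tail k u - tail l u) (tail k u - tail l u) <= e.
    move=> Nk kl; have := tail_pythagoras u kl; have := tail_pythagoras u Nk.
    have := psd_ge0 psds (tail N u - tail k u).
    have : inf (range x) <= x l by apply: ge_inf; [case: hasinf|exists l].
    by rewrite -!/(x _); lra.
  exists N => k l Nk Nl; have [kl|lk] := leqP k l; first exact: key.
  have := key l k Nl (ltnW lk).
  by rewrite -opprB (psdNl psds) (psdNr psds) opprK.
have pw m : perp m w.
  by apply: (perp_closed m).2 wcv; exists m => k /perpW; apply; exact: perp_tail.
have bw : b w w = 0.
  apply/eqP; apply: contrapT => /negP bw; have bp : 0 < b w w by rewrite lt_def bw b0.
  have [k] := mu_unbounded (a w w / b w w); rewrite ltr_pdivrMr// ltNge => /negP; apply.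
  by apply: le_trans (perp_rayleigh (pw k)); rewrite ler_wpM2r// ltW.
move=> e0; have [N HN] := fcvg_sqr psda (fcvg_a wcv) e0.
by exists N => m /HN; rewrite (null_form bw) subr0 ger0_norm.
Qed.

Definition deficit_form u := a u u - mu 1 * b (tail 0 u) (tail 0 u).

Lemma mu_gt0 k : 0 < mu k.+1.
Proof. by rewrite -mu0; apply: (homo_ltn lt_trans mu_lt). Qed.

Lemma a_tail0 u : a (tail 0 u) (tail 0 u) = a u u.
Proof.
have h v : a (eigenproj 0 u) v = 0 by rewrite eigenproj_eigen mu0 mul0r.
rewrite /tail big_nat1; move: (eigenproj 0 u) h => p h.
rewrite !(psd_lin psda) (psdC psda u p) !h; ring.
Qed.

(** Both expansions come from telescoping, by the identities that relate
    consecutive tails. *)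
Lemma deficit_sum_b m u : deficit_form u =
  \sum_(2 <= j < m.+2) (mu j - mu j.-1) * b (tail j.-1 u) (tail j.-1 u) +
  (a (tail m.+1 u) (tail m.+1 u) - mu m.+1 * b (tail m.+1 u) (tail m.+1 u)).
Proof.
elim: m => [|m IH].
  rewrite big_geq// add0r /deficit_form -a_tail0 a_tailS b_tailS; ring.
rewrite big_nat_recr//= IH a_tailS b_tailS; ring.
Qed.

Lemma deficit_sum_a m u : deficit_form u =
  mu 1 * (\sum_(2 <= j < m.+2) ((mu j.-1)^-1 - (mu j)^-1) * a (tail j.-1 u) (tail j.-1 u)) +
  mu 1 * (a (tail m.+1 u) (tail m.+1 u) / mu m.+1 - b (tail m.+1 u) (tail m.+1 u)).
Proof.
elim: m => [|m IH].
  rewrite big_geq// mulr0 add0r /deficit_form -a_tail0 a_tailS b_tailS.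
  by field; rewrite gt_eqF// mu_gt0.
rewrite big_nat_recr//= IH a_tailS b_tailS.
by field; rewrite !gt_eqF// mu_gt0.
Qed.

Lemma remainder_ge m u : mu m.+1 * b (tail m u) (tail m u) <= a (tail m u) (tail m u).
Proof. exact/perp_rayleigh/perp_tail. Qed.

Lemma remainder_b_ge0 m u :
  0 <= a (tail m u) (tail m u) - mu m * b (tail m u) (tail m u).
Proof.
rewrite subr_ge0; apply: le_trans (remainder_ge m u).
by rewrite ler_wpM2r// ltW.
Qed.

Lemma remainder_b_eq0 m u :
  a (tail m u) (tail m u) - mu m * b (tail m u) (tail m u) = 0 ->
  b (tail m u) (tail m u) = 0.
Proof.
move=> /eqP; rewrite subr_eq0 => /eqP e; have := remainder_ge m u; rewrite e.
have := b0 (tail m u); have := mu_lt m; move: (b _ _) => x; nra.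
Qed.

Lemma remainder_a_ge0 m u :
  0 <= mu 1 * (a (tail m.+1 u) (tail m.+1 u) / mu m.+1 - b (tail m.+1 u) (tail m.+1 u)).
Proof.
apply: mulr_ge0; first exact: ltW (mu_gt0 0).
rewrite subr_ge0 ler_pdivlMr ?mu_gt0// mulrC -subr_ge0.
exact: remainder_b_ge0.
Qed.

Lemma remainder_a_eq0 m u :
  mu 1 * (a (tail m.+1 u) (tail m.+1 u) / mu m.+1 - b (tail m.+1 u) (tail m.+1 u)) = 0 ->
  b (tail m.+1 u) (tail m.+1 u) = 0.
Proof.
move=> /eqP; rewrite mulf_eq0 gt_eqF ?mu_gt0//= subr_eq0 => /eqP e.
apply: remainder_b_eq0; rewrite -e mulrC divfK ?subrr// gt_eqF// mu_gt0//.
Qed.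

(** A null tail is orthogonal to everything for both forms, so that it can be
    absorbed into any eigenspace. *)
Lemma tail_eq0_eigen_sum m u : b (tail m u) (tail m u) = 0 -> eigen_sum m u.
Proof.
move=> tb; have ta := null_form tb.
have et : eigen (mu 0) (tail m u).
  by move=> v; rewrite (psd_null psda v ta) (psd_null psdb v tb) mulr0.
exists (fun k => if k == 0%N then tail m u + eigenproj 0 u else eigenproj k u).
  move=> k _; case: eqP => [->|_]; last exact: eigenproj_eigen.
  have := (eigen_closed (mu 0)).1 1 _ _ et (eigenproj_eigen 0 u).
  by rewrite scale1r.
transitivity (tail m u + \sum_(0 <= k < m.+1) eigenproj k u); first by rewrite /tail subrK.
by move: (tail m u) => t; rewrite !big_nat_recl//= addrA.
Qed.

Lemma deficit_b_cvg u :
  \sum_(2 <= j < n) (mu j - mu j.-1) * b (tail j.-1 u) (tail j.-1 u)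
    @[n --> \oo] --> deficit_form u.
Proof.
apply/cvgrPdist_le => e e0; have [N HN] := a_tail_cvg0 u e0.
exists N.+2 => // -[//|[//|n]] /= Nn.
rewrite (deficit_sum_b n u) addrC addKr ger0_norm ?remainder_b_ge0//.
apply: le_trans (HN n.+1 _); last by rewrite ltnW// ltnW.
by rewrite gerBl mulr_ge0 ?b0 ?ltW ?mu_gt0.
Qed.

Lemma deficit_a_cvg u :
  mu 1 * (\sum_(2 <= j < n) ((mu j.-1)^-1 - (mu j)^-1) * a (tail j.-1 u) (tail j.-1 u))
    @[n --> \oo] --> deficit_form u.
Proof.
apply/cvgrPdist_le => e e0; have [N HN] := a_tail_cvg0 u e0.
exists N.+2 => // -[//|[//|n]] /= Nn.
rewrite (deficit_sum_a n u) addrC addKr ger0_norm ?remainder_a_ge0//.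
apply: le_trans (HN n.+1 _); last by rewrite ltnW// ltnW.
rewrite mulrBr; apply: (@le_trans _ _ (mu 1 * (a (tail n.+1 u) (tail n.+1 u) / mu n.+1))).
  by rewrite gerBl mulr_ge0 ?b0 ?ltW ?mu_gt0.
by rewrite mulrCA ler_piMr// ler_pdivrMr ?mu_gt0// mul1r mu_homo.
Qed.

(** Any eigenvector of the eigenvalue that follows mu_m will do: it is orthogonal
    to the first m + 1 eigenspaces, so its tail of order m keeps its norm. *)
Lemma extremal_exists m : exists phi,
  [/\ eigen_sum m.+1 phi, 0 < b (tail m phi) (tail m phi) & 0 < a (tail m phi) (tail m phi)].
Proof.
have [phi ephi bphi] : exists2 phi, eigen (mu m.+1) phi & b phi phi <> 0.
  by apply/mu_spec; exists m.+1.
have tb : b (tail m phi) phi = b phi phi.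
  rewrite /tail (psdBl psdb) (psd_suml psdb) big_nat big1 ?subr0// => k /andP[_ km].
  apply: (eigen_orth _ (eigenproj_eigen k phi) ephi) => e.
  by rewrite e ltnn in km.
exists phi; split.
- exists (fun k => if k == m.+1 then phi else 0).
    by move=> k _; case: eqP => [->//|_]; exact: eigen0.
  rewrite big_nat_recr//= eqxx big_nat big1 ?add0r// => k /andP[_ km].
  by rewrite ltn_eqF.
- rewrite lt_def b0 andbT; apply/eqP => t0; apply: bphi.
  by rewrite -tb (psd_null psdb).
- rewrite lt_def a0 andbT; apply/eqP => t0; apply: bphi.
  have := psd_null psda phi t0; rewrite (psdC psda) ephi (psdC psdb) tb => /eqP.
  by rewrite mulf_eq0 gt_eqF ?mu_gt0//= => /eqP.
Qed.

Lemma deficit_b_ge m u :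
  \sum_(2 <= j < m.+2) (mu j - mu j.-1) * b (tail j.-1 u) (tail j.-1 u) <= deficit_form u.
Proof. by rewrite (deficit_sum_b m u) lerDl remainder_b_ge0. Qed.

Lemma deficit_a_ge m u :
  mu 1 * (\sum_(2 <= j < m.+2) ((mu j.-1)^-1 - (mu j)^-1) * a (tail j.-1 u) (tail j.-1 u))
    <= deficit_form u.
Proof. by rewrite (deficit_sum_a m u) lerDl remainder_a_ge0. Qed.

Lemma deficit_b_eq m u : deficit_form u =
  \sum_(2 <= j < m.+2) (mu j - mu j.-1) * b (tail j.-1 u) (tail j.-1 u) <-> eigen_sum m.+1 u.
Proof.
split=> [|Mu]; rewrite (deficit_sum_b m u).
  move=> /eqP; rewrite -subr_eq0 addrC addKr => /eqP/remainder_b_eq0.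
  exact: tail_eq0_eigen_sum.
by rewrite (tail_eigen_sum Mu) (null_form (tail_eigen_sum Mu)) mulr0 subr0 addr0.
Qed.

Lemma deficit_a_eq m u : deficit_form u =
  mu 1 * (\sum_(2 <= j < m.+2) ((mu j.-1)^-1 - (mu j)^-1) * a (tail j.-1 u) (tail j.-1 u))
  <-> eigen_sum m.+1 u.
Proof.
split=> [|Mu]; rewrite (deficit_sum_a m u).
  move=> /eqP; rewrite -subr_eq0 addrC addKr => /eqP/remainder_a_eq0.
  exact: tail_eq0_eigen_sum.
by rewrite (tail_eigen_sum Mu) (null_form (tail_eigen_sum Mu)) mul0r subr0 mulr0 addr0.
Qed.

Lemma deficit_b_sharp m c : mu m.+2 - mu m.+1 < c -> exists phi, deficit_form phi <
  \sum_(2 <= j < m.+2) (mu j - mu j.-1) * b (tail j.-1 phi) (tail j.-1 phi) +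
  c * b (tail m.+1 phi) (tail m.+1 phi).
Proof.
move=> hc; have [phi [Mphi bphi _]] := extremal_exists m.+1; exists phi.
rewrite ((deficit_b_eq m.+1 phi).2 Mphi) big_nat_recr//=.
by rewrite ltrD2l ltr_pM2r.
Qed.

Lemma deficit_a_sharp m c : mu 1 * ((mu m.+1)^-1 - (mu m.+2)^-1) < c ->
  exists phi, deficit_form phi <
  mu 1 * (\sum_(2 <= j < m.+2) ((mu j.-1)^-1 - (mu j)^-1) * a (tail j.-1 phi) (tail j.-1 phi)) +
  c * a (tail m.+1 phi) (tail m.+1 phi).
Proof.
move=> hc; have [phi [Mphi _ aphi]] := extremal_exists m.+1; exists phi.
rewrite ((deficit_a_eq m.+1 phi).2 Mphi) big_nat_recr//= mulrDr mulrA.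
by rewrite ltrD2l ltr_pM2r.
Qed.

End spectral.

(** * The Sobolev space as a vector space with two forms *)

Section W12_space.
Context {R : realType} {n : nat}.

(** Bundling the hypotheses on the domain lets the vector space structure of its
    Sobolev space be inferred. *)
Record domain := Domain {
  domain_set :> set 'rV[R]_n;
  open_domain : open domain_set;
  leb_domain : (leb R n domain_set < +oo)%E }.

Variable D : domain.
Implicit Types u v : 'rV[R]_n -> R.

Let mD : measurable (D : set _). Proof. by apply: open_measurable_rv; exact: open_domain. Qed.

Lemma weak_gradient_0 : weak_gradient D (fun=> 0) (fun=> 0).
Proof.
move=> i; split=> [|phi _].
  rewrite (_ : (fun _ => _) = fun=> 0); last by apply/funext => x; rewrite mxE.
  exact (sqint_cst mD (leb_domain D) 0).
under eq_Rintegral do rewrite mul0r.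
by under [in RHS]eq_Rintegral do rewrite mxE mul0r; rewrite Rintegral_cst// mul0r oppr0.
Qed.

Lemma W12_0 : W12 D (fun=> 0).
Proof.
split; first exact (sqint_cst mD (leb_domain D) 0).
by exists (fun=> 0); exact: weak_gradient_0.
Qed.

Definition W12_pred : {pred 'rV[R]_n -> R} := fun u => `[< W12 D u >].

Lemma W12_submod_closed : submod_closed W12_pred.
Proof.
split=> [|c u v]; first by apply/asboolP; exact: W12_0.
by move=> /asboolP Wu /asboolP Wv; apply/asboolP; exact (W12_lin (@open_domain D) (leb_domain D) c Wu Wv).
Qed.

HB.instance Definition _ := GRing.isSubmodClosed.Build R ('rV[R]_n -> R) W12_pred W12_submod_closed.

Record W12_space := W12_Space { W12_fun :> 'rV[R]_n -> R; _ : W12_fun \in W12_pred }.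

HB.instance Definition _ := [isSub for W12_fun].
HB.instance Definition _ := [Choice of W12_space by <:].
HB.instance Definition _ := [SubChoice_isSubLmodule of W12_space by <:].

Lemma W12_spaceP (u : W12_space) : W12 D u.
Proof. by case: u => u /= /asboolP. Qed.

Lemma W12_spaceE u : W12 D u -> {w : W12_space | W12_fun w = u}.
Proof. by move=> /asboolP Wu; exists (W12_Space Wu). Qed.

Definition mass_form (u v : W12_space) : R := ip (leb R n) D u v.
Definition dirichlet_form (u v : W12_space) : R := grad_ip D u v.

Lemma W12_funD (u v : W12_space) : W12_fun (u + v) = (fun x => u x + v x).
Proof. by []. Qed.
Lemma W12_funB (u v : W12_space) : W12_fun (u - v) = (fun x => u x - v x).
Proof. by []. Qed.
Lemma W12_funL c (u v : W12_space) : W12_fun (c *: u + v) = (fun x => c * u x + v x).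
Proof. by []. Qed.
Lemma W12_fun_sum (I : Type) (r : seq I) (F : I -> W12_space) :
  W12_fun (\sum_(i <- r) F i) = (fun x => \sum_(i <- r) F i x).
Proof.
apply/funext => x; elim: r => [|i r IH]; first by rewrite !big_nil.
by rewrite !big_cons W12_funD IH.
Qed.

Lemma psd_mass_form : psd_form mass_form.
Proof.
split=> [c u v w|u v|u]; last exact: ip_ge0; last exact: ipC.
have sq (z : W12_space) : sqint (leb R n) D z := W12_sq (W12_spaceP z).
by rewrite /mass_form W12_funL ipDl ?ipZl//; exact: sqint_scale.
Qed.

Lemma psd_dirichlet_form : psd_form dirichlet_form.
Proof.
split=> [c u v w|u v|u]; last exact: grad_ip_ge0; last exact: grad_ipC.
rewrite /dirichlet_form W12_funL.
exact (grad_ip_lin (@open_domain D) (leb_domain D) c (W12_spaceP u) (W12_spaceP v) (W12_spaceP w)).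
Qed.

Lemma W12_space_complete (w : nat -> W12_space) :
  (forall e, 0 < e -> exists N : nat, forall k l, (N <= k)%N -> (N <= l)%N ->
     mass_form (w k - w l) (w k - w l) + dirichlet_form (w k - w l) (w k - w l) <= e) ->
  exists x, fcvg (fun y z => mass_form y z + dirichlet_form y z) w x.
Proof.
move=> wC; have Ww k := W12_spaceP (w k).
have [u Wu wu] := W12_complete (@open_domain D) (leb_domain D) Ww wC.
by have [u' u'E] := W12_spaceE Wu; exists u'; rewrite /fcvg /mass_form /dirichlet_form;
  move: wu; rewrite -u'E.
Qed.

Lemma mass_form_ae (u v w : W12_space) : ae_eq (leb R n) (D : set _) u v -> mass_form u w = mass_form v w.
Proof.
have sq (z : W12_space) : sqint (leb R n) D z := W12_sq (W12_spaceP z).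
exact: ip_ae.
Qed.

Lemma mass_form_eq0 (u : W12_space) : mass_form u u = 0 -> ae_eq (leb R n) (D : set _) u (cst 0).
Proof. by apply: ip_eq0 => //; exact: W12_sq (W12_spaceP u). Qed.

Lemma dirichlet_form_null (u : W12_space) : mass_form u u = 0 -> dirichlet_form u u = 0.
Proof.
move=> /mass_form_eq0 u0; have oD := @open_domain D; have lD := leb_domain D.
have Wu := W12_spaceP u.
have m0 : measurable_fun D (fun=> 0 : R) by exact: measurable_cst.
have wG0 : weak_gradient D u (fun=> 0).
  have [mu _] := W12_sq Wu.
  apply: (weak_gradient_ae oD lD mu (sqint_cst mD lD 0)) weak_gradient_0.
  by move: u0; apply: filterS => x /[apply] ->.
rewrite /dirichlet_form grad_ipE// big1// => i _.
have [G2 _] := wG0 i; have g2 := wgrad_sq i Wu.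
rewrite (ip_ae mD g2 G2 g2 (weak_gradient_unique oD lD i (wgradP Wu) wG0)).
rewrite /ip; under eq_Rintegral do rewrite mxE mul0r.
by rewrite Rintegral_cst// mul0r.
Qed.

End W12_space.

(** * The expansion of the deficit on bounded convex domains *)

Lemma inf_attained (R : realType) (A : set R) (x : R) : A x -> lbound A x -> inf A = x.
Proof.
move=> Ax lx; apply/le_anti/andP; split; last by apply: lb_le_inf => //; exists x.
by apply: ge_inf => //; exists x.
Qed.

Section neumann.
Context {R : realType} {n : nat}.
Variables (D : @domain R n) (M : R) (mu : nat -> R).
Hypotheses (cD : segment_convex D) (DM : (D : set _) `<=` cube M) (M0 : 0 <= M).

Let mD : measurable (D : set 'rV[R]_n).
Proof. by apply: open_measurable_rv; exact: open_domain. Qed.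
Let oD := @open_domain R n D.
Let lD := leb_domain D.
Let X : lmodType R := W12_space D.
Let a : X -> X -> R := @dirichlet_form R n D.
Let b : X -> X -> R := @mass_form R n D.
Let sq (u : X) : sqint (leb R n) D u := W12_sq (W12_spaceP u).

(** The mesh d is chosen so that the Poincare factor n d^2 2^n is at most e. *)
Lemma form_compactness e : 0 < e -> exists (I : finType) (l : I -> X -> R) (K : R),
  [/\ forall i u v, l i (u - v) = l i u - l i v,
      forall i u, l i u ^+ 2 <= K * b u u &
      forall u, b u u <= e * a u u + \sum_i l i u ^+ 2].
Proof.
move=> e0; pose C : R := n%:R * 2 ^+ n; have C0 : 0 <= C by rewrite mulr_ge0.
pose d := Num.sqrt (e / (C + 1)).
have C1 : 0 < C + 1 by rewrite ltr_wpDl.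
have d0 : 0 < d by rewrite sqrtr_gt0 divr_gt0.
have d2 : C * d ^+ 2 <= e.
  rewrite sqr_sqrtr; last by rewrite divr_ge0// ltW.
  by rewrite mulrA ler_pdivrMr// mulrC; apply: ler_wpM2l; [exact: ltW|lra].
pose k := Num.truncn (2 * M / d).
have kM : 2 * M / d < k.+1%:R.
  have q0 : 0 <= 2 * M / d by rewrite divr_ge0 ?mulr_ge0// ltW.
  by have /andP[] := truncn_itv q0.
exists _, (fun f (u : X) => cell_mean D M d (k := k) f u), 1; split.
- by move=> f u v; rewrite W12_funB; exact (cell_meanB M oD lD d f (sq u) (sq v)).
- by move=> f u; rewrite mul1r; exact (cell_mean_le oD lD DM d0 kM f (sq u)).
- move=> u; apply: le_trans (cell_poincare oD lD cD DM d0 kM (W12_spaceP u)) _.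
  rewrite lerD2r ler_wpM2r ?grad_ip_ge0//.
  by rewrite mulrAC.
Qed.

Let w := fine (leb R n D).
Let intg (u : X) : (leb R n).-integrable D (EFin \o u).
Proof. by apply: sqint_integrable => //; exact: sq. Qed.

Lemma sqnorm_subc (u : X) c : sqnorm D (fun x => u x - c) =
  sqnorm D u - 2 * c * (\int[leb R n]_(x in D) u x) + c ^+ 2 * w.
Proof.
have sc := sqint_cst mD lD c; have [_ iu2] := sq u.
have i1 : (leb R n).-integrable D (EFin \o (fun x => 2 * c * u x)).
  have := integrableZl mD (2 * c) (intg u).
  by congr integrable; apply/funext => x /=; rewrite EFinM.
rewrite /sqnorm -RintegralZl// -Rintegral_cst// -RintegralB// -RintegralD//.
- by apply: eq_Rintegral => x _ /=; ring.
- have := integrableB mD iu2 i1.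
  by congr integrable; apply/funext => x /=; rewrite EFinB.
- exact (integrable_cst mD lD (c ^+ 2)).
Qed.

(** The Poincare inequality on the whole domain bounds the variance of u by its
    energy. *)
Lemma dirichlet0_constant (u : X) : w != 0 -> a u u = 0 ->
  ae_eq (leb R n) (D : set _) u (cst (average D u)).
Proof.
move=> w0 u0; have wp : 0 < w by rewrite lt_def w0 fine_ge0.
have dD (x y : 'rV[R]_n) i : (D : set _) x -> (D : set _) y -> `|x 0 i - y 0 i| <= 2 * M.
  move=> /DM/(_ i) xM /DM/(_ i) yM; apply: le_trans (ler_normB _ _) _; lra.
have := poincare_convex oD lD cD (sq u) (wgradP (W12_spaceP u)) mD (@subset_refl _ _) cD dD.
have g0 : \int[leb R n]_(x in D) dotv (wgrad D u x) (wgrad D u x) = 0 := u0.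
rewrite g0 mulr0 addr0 -/w => H.
have s0 : sqnorm D (fun x => u x - average D u) = 0.
  apply/le_anti; rewrite Rintegral_ge0 ?andbT; last by move=> x _; exact: sqr_ge0.
  rewrite sqnorm_subc /average -/w -(pmulr_rle0 _ wp); move: H; rewrite /sqnorm.
  set p := \int[leb R n]_(x in D) (u x ^+ 2); set q := \int[leb R n]_(x in D) u x => H.
  rewrite -subr_le0 in H; apply: le_trans H; rewrite le_eqVlt; apply/orP; left; apply/eqP.
  by field.
have := Rintegral_sqr_eq0 mD (sqint_sub mD (sq u) (sqint_cst mD lD (average D u))) s0.
by apply: filterS => x /[apply] /eqP; rewrite subr_eq0 => /eqP.
Qed.

Lemma neumann_eigenspaceE la (phi : X) : neumann_eigenspace D la phi <-> eigen a b la phi.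
Proof.
split=> [[_ H] v|H]; first exact: (H v (W12_spaceP v)).
split=> [|v Wv]; first exact: W12_spaceP.
by have [v' <-] := W12_spaceE Wv; exact: H.
Qed.

Lemma neumann_eigenvalueE la :
  neumann_eigenvalue D la <-> exists2 phi, eigen a b la phi & b phi phi <> 0.
Proof.
split=> [[phi ephi nphi]|[phi ephi bphi]].
  have [Wphi _] := ephi; have [f fE] := W12_spaceE Wphi.
  rewrite -fE in ephi nphi.
  by exists f; [exact/neumann_eigenspaceE|move=> /mass_form_eq0].
exists phi; first exact/neumann_eigenspaceE.
move=> phi0; apply: bphi; rewrite -(psd0l (@psd_mass_form R n D) phi).
exact: mass_form_ae.
Qed.

Lemma eigensumE m Phi : eigensum D mu m Phi <-> exists2 P : X, eigen_sum a b mu m P & W12_fun P = Phi.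
Proof.
split=> [[e ee ->]|[P [e ee ->] <-]].
  have [f fe] : exists f : nat -> X, forall k, (k <= m)%N -> W12_fun (f k) = e k.
    have fe (k : nat) : exists f : X, (k <= m)%N -> W12_fun f = e k.
      have [km|] := boolP (k <= m)%N; last by exists 0.
      by have [Wk _] := ee k km; have [f fE] := W12_spaceE Wk; exists f.
    by have [g ge] := choice fe; exists g.
  exists (\sum_(0 <= k < m.+1) f k).
    exists f => // k km; apply/neumann_eigenspaceE; rewrite fe//; exact: ee.
  rewrite W12_fun_sum; apply/funext => x; rewrite big_nat [RHS]big_nat.
  by apply: eq_bigr => k /= km; rewrite fe.
exists (fun k => W12_fun (e k)); first by move=> k /ee/neumann_eigenspaceE.
by rewrite W12_fun_sum.
Qed.

Hypothesis hmu : neumann_spectrum D mu.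

Let mu0 : mu 0%N = 0. Proof. by case: hmu. Qed.
Let mu_lt k : mu k < mu k.+1. Proof. by case: hmu. Qed.
Let mu_spec la : (exists2 phi, eigen a b la phi & b phi phi <> 0) <-> exists k, mu k = la.
Proof. by rewrite -neumann_eigenvalueE; case: hmu. Qed.

Let pa : psd_form a := @psd_dirichlet_form R n D.
Let pb : psd_form b := @psd_mass_form R n D.
Let nab u : b u u = 0 -> a u u = 0 := @dirichlet_form_null R n D u.
Let complete := @W12_space_complete R n D.
Let T m (u : X) : X := tail mu pa pb complete m u.

(** The infimum is attained at the sum of the projections. *)
Lemma dist2E m (u : X) : dist2 D mu m u = b (T m u) (T m u).
Proof.
have sqB (P : X) : sqnorm D (fun x => u x - P x) = b (u - P) (u - P).
  by rewrite /b /mass_form W12_funB /ip /sqnorm; apply: eq_Rintegral => x _; rewrite expr2.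
apply: inf_attained.
  exists (W12_fun (\sum_(0 <= k < m.+1) eigenproj mu pa pb complete k u)); last by rewrite sqB.
  apply/eigensumE; eexists; last by [].
  exact: eigen_sum_eigenproj.
move=> _ [_ /eigensumE[P MP <-] <-]; rewrite sqB.
exact: tail_min_b.
Qed.

Lemma gdist2E m (u : X) : gdist2 D mu m u = a (T m u) (T m u).
Proof.
have sqB (P : X) : dirichlet D (fun x => u x - P x) = a (u - P) (u - P).
  by rewrite dirichletE /a /dirichlet_form W12_funB.
apply: inf_attained.
  exists (W12_fun (\sum_(0 <= k < m.+1) eigenproj mu pa pb complete k u)); last by rewrite sqB.
  apply/eigensumE; eexists; last by [].
  exact: eigen_sum_eigenproj.
move=> _ [_ /eigensumE[P MP <-] <-]; rewrite sqB.
exact: tail_min_a.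
Qed.

(** The eigenspace of 0 consists of functions that are constant almost everywhere
    and, 0 being an eigenvalue, it contains one whose constant is not 0. The tail of
    order 0 is orthogonal to it, so it has mean zero and equals u minus its average. *)
Lemma deficitE (u : X) : deficit D mu u = deficit_form mu pa pb complete u.
Proof.
rewrite /deficit /deficit_form dirichletE; congr (_ - _ * _).
have [phi ephi bphi] : exists2 phi, eigen a b 0 phi & b phi phi <> 0.
  by apply/mu_spec; exists 0%N.
have int_null (v : X) : ae_eq (leb R n) (D : set _) v (cst 0) -> b v v = 0.
  move=> v0; rewrite -(psd0l pb v); exact: mass_form_ae.
have w0 : w != 0.
  apply/eqP => w0; apply: bphi; have [mphi _] := sq phi.
  have lD0 : leb R n D = 0%E by apply/eqP; rewrite -fine_eq0 ?ge0_fin_numE// -/w w0.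
  rewrite /b /mass_form /ip /Rintegral null_set_integral//.
  exact/measurable_EFinP/measurable_funM.
have phi0 : a phi phi = 0 by rewrite ephi mul0r.
have phiE := dirichlet0_constant w0 phi0.
have avphi : average D phi != 0.
  by apply: contra_notN bphi => /eqP av0; apply: int_null; rewrite -av0.
set p := eigenproj mu pa pb complete 0 u.
have TE : T 0 u = u - p by rewrite /T /tail big_nat1.
have ep : eigen a b (mu 0) p by exact: eigenproj_eigen.
have p0 : a p p = 0 by rewrite ep mu0 mul0r.
have pE := dirichlet0_constant w0 p0.
have tphi : b (u - p) phi = 0.
  by apply: eigenproj_orth => v; rewrite ephi mu0.
have mf (v : X) : measurable_fun D v by case: (sq v).
have avt : \int[leb R n]_(x in D) (u x - p x) = 0.
  have E : b (u - p) phi = average D phi * \int[leb R n]_(x in D) (u x - p x).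
    rewrite -RintegralZl//; last exact: (intg (u - p)).
    apply: Rintegral_ae => //.
    - by apply: measurable_funM; [exact: (mf (u - p))|exact: mf].
    - by apply: measurable_funM; [exact: measurable_cst|exact: (mf (u - p))].
    - by move: phiE; apply: filterS => x /[apply] ->; rewrite mulrC.
  by move/eqP: tphi; rewrite E mulf_eq0 (negPf avphi) => /eqP.
have avu : average D u = average D p.
  rewrite /average; congr (_ * _); apply/eqP; rewrite -subr_eq0 -RintegralB//.
  by rewrite avt.
rewrite -/(T 0 u) TE avu; apply: Rintegral_ae => //.
- by apply: measurable_funX; apply: measurable_funB; [exact: mf|exact: measurable_cst].
- by apply: measurable_funM; exact: (mf (u - p)).
- by move: pE; apply: filterS => x /[apply] /= <-; rewrite expr2.
Qed.

Let cpt := form_compactness.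

Let dist_sumE (u : X) k : \sum_(2 <= j < k) (mu j - mu j.-1) * dist2 D mu j.-1 u =
  \sum_(2 <= j < k) (mu j - mu j.-1) * b (T j.-1 u) (T j.-1 u).
Proof. by apply: eq_bigr => j _; rewrite dist2E. Qed.

Let gdist_sumE (u : X) k :
  \sum_(2 <= j < k) ((mu j.-1)^-1 - (mu j)^-1) * gdist2 D mu j.-1 u =
  \sum_(2 <= j < k) ((mu j.-1)^-1 - (mu j)^-1) * a (T j.-1 u) (T j.-1 u).
Proof. by apply: eq_bigr => j _; rewrite gdist2E. Qed.

Let eigensumP m (u : X) : eigensum D mu m u <-> eigen_sum a b mu m u.
Proof.
rewrite eigensumE; split=> [[P MP PE]|]; last by exists u.
suff <- : P = u by [].
exact: val_inj.
Qed.

Theorem deficit_expansion :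
  (forall u : 'rV[R]_n -> R, W12 D u ->
     (\sum_(2 <= j < k) (mu j - mu j.-1) * dist2 D mu j.-1 u)
       @[k --> \oo] --> deficit D mu u) /\
  (forall u : 'rV[R]_n -> R, W12 D u ->
     (mu 1%N * \sum_(2 <= j < k) ((mu j.-1)^-1 - (mu j)^-1) * gdist2 D mu j.-1 u)
       @[k --> \oo] --> deficit D mu u).
Proof.
split=> _ /W12_spaceE[u <-]; rewrite deficitE.
- under eq_fun do rewrite dist_sumE.
  exact (@deficit_b_cvg _ _ _ _ _ pa pb complete cpt nab mu0 mu_lt mu_spec u).
- under eq_fun do rewrite gdist_sumE.
  exact (@deficit_a_cvg _ _ _ _ _ pa pb complete cpt nab mu0 mu_lt mu_spec u).
Qed.

Theorem deficit_dist2_sharp m : (2 <= m)%N ->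
  [/\ forall u : 'rV[R]_n -> R, W12 D u ->
        \sum_(2 <= j < m.+1) (mu j - mu j.-1) * dist2 D mu j.-1 u <= deficit D mu u,
      forall c : R, mu m - mu m.-1 < c ->
        ~ forall u : 'rV[R]_n -> R, W12 D u ->
          \sum_(2 <= j < m) (mu j - mu j.-1) * dist2 D mu j.-1 u
            + c * dist2 D mu m.-1 u <= deficit D mu u &
      forall u : 'rV[R]_n -> R, W12 D u ->
        deficit D mu u = \sum_(2 <= j < m.+1) (mu j - mu j.-1) * dist2 D mu j.-1 u
        <-> eigensum D mu m u].
Proof.
case: m => [//|[//|m]] _; split=> [_ /W12_spaceE[u <-]|c hc H|_ /W12_spaceE[u <-]].
- by rewrite deficitE dist_sumE; exact: deficit_b_ge pa pb complete cpt mu0 mu_lt mu_spec m.+1 u.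
- have [phi] := deficit_b_sharp pa pb complete cpt nab mu0 mu_lt mu_spec hc.
  rewrite ltNge => /negP; apply; have := H phi (W12_spaceP phi).
  by rewrite deficitE dist_sumE dist2E.
- rewrite deficitE dist_sumE eigensumP.
  exact: deficit_b_eq pa pb complete cpt nab mu0 mu_lt mu_spec m.+1 u.
Qed.

Theorem deficit_gdist2_sharp m : (2 <= m)%N ->
  [/\ forall u : 'rV[R]_n -> R, W12 D u ->
        mu 1%N * \sum_(2 <= j < m.+1) ((mu j.-1)^-1 - (mu j)^-1) * gdist2 D mu j.-1 u
          <= deficit D mu u,
      forall c : R, mu 1%N * ((mu m.-1)^-1 - (mu m)^-1) < c ->
        ~ forall u : 'rV[R]_n -> R, W12 D u ->
          mu 1%N * (\sum_(2 <= j < m) ((mu j.-1)^-1 - (mu j)^-1) * gdist2 D mu j.-1 u)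
            + c * gdist2 D mu m.-1 u <= deficit D mu u &
      forall u : 'rV[R]_n -> R, W12 D u ->
        deficit D mu u =
          mu 1%N * \sum_(2 <= j < m.+1) ((mu j.-1)^-1 - (mu j)^-1) * gdist2 D mu j.-1 u
        <-> eigensum D mu m u].
Proof.
case: m => [//|[//|m]] _; split=> [_ /W12_spaceE[u <-]|c hc H|_ /W12_spaceE[u <-]].
- by rewrite deficitE gdist_sumE; exact: deficit_a_ge pa pb complete cpt mu0 mu_lt mu_spec m.+1 u.
- have [phi] := deficit_a_sharp pa pb complete cpt nab mu0 mu_lt mu_spec hc.
  rewrite ltNge => /negP; apply; have := H phi (W12_spaceP phi).
  by rewrite deficitE gdist_sumE gdist2E.
- rewrite deficitE gdist_sumE eigensumP.
  exact: deficit_a_eq pa pb complete cpt nab mu0 mu_lt mu_spec m.+1 u.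
Qed.

End neumann.

(** * The Euclidean ball *)

Section euclidean_ball.
Context {R : realType} {n : nat}.
Variable r : R.
Hypothesis r0 : 0 < r.

Lemma eballE : eball n r = [set x | dotv x x < r ^+ 2].
Proof.
apply/funext => x; rewrite /eball /= /enorm.
by rewrite -[X in _ < X](ger0_norm (ltW r0)) -sqrtr_sqr ltr_sqrt ?exprn_gt0.
Qed.

Lemma open_eball : open (eball n r).
Proof.
rewrite eballE; apply: (@open_comp _ _ (fun x : 'rV[R]_n => dotv x x) [set y | y < r ^+ 2]).
  move=> x _; apply: (@cvg_big _ _ +%R 0 xpredT (@add_continuous _) _ (nbhs x) _
    (fun (i : 'I_n) (y : 'rV[R]_n) => y 0 i * y 0 i) (fun i => x 0 i * x 0 i)
    (nbhs_filter x)) => i _.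
  by apply: cvgM; exact: coord_continuous.
exact: open_lt.
Qed.

Lemma convex_eball : segment_convex (eball n r).
Proof.
rewrite eballE => x h t /= xr yr /andP[t0 t1].
apply: (@le_lt_trans _ _ ((1 - t) * dotv x x + t * dotv (x + h) (x + h))).
  rewrite /dotv !mulr_sumr -big_split/=; apply: ler_sum => i _; rewrite !mxE.
  rewrite -subr_ge0.
  have -> : forall p q : R, (1 - t) * (p * p) + t * ((p + q) * (p + q)) -
    (p + t * q) * (p + t * q) = t * (1 - t) * q ^+ 2 by move=> p q; ring.
  by rewrite mulr_ge0 ?sqr_ge0// mulr_ge0// subr_ge0.
have [->|tn0] := eqVneq t 0; first by rewrite subr0 mul1r mul0r addr0.
have tp : 0 < t by rewrite lt_def tn0.
have s0 : 0 <= 1 - t by rewrite subr_ge0.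
have := ler_wpM2l s0 (ltW xr); have := yr; rewrite -(ltr_pM2l tp).
move=> *; lra.
Qed.

Lemma eball_cube : eball n r `<=` cube r.
Proof.
rewrite eballE => x /= xr i.
have : (x 0 i) ^+ 2 <= r ^+ 2.
  apply: le_trans (ltW xr); rewrite /dotv (bigD1 i)//= -expr2 lerDl.
  by apply: sumr_ge0 => j _; rewrite -expr2 sqr_ge0.
by rewrite -[leLHS]real_normK ?num_real// ler_sqr// nnegrE ltW.
Qed.

Lemma leb_eball_lty : (leb R n (eball n r) < +oo)%E.
Proof.
apply: le_lt_trans (leb_cube_lty n r); apply: le_measure; rewrite ?inE.
- by apply: open_measurable_rv; exact: open_eball.
- exact: measurable_cube.
- exact: eball_cube.
Qed.

Definition ball_domain : @domain R n := Domain open_eball leb_eball_lty.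

End euclidean_ball.

Theorem theorem1p3 (R : realType) (N : nat) (r : R) (mu : nat -> R)
    (hN : (2 <= N)%N) (hr : 0 < r)
    (hmu : neumann_spectrum (eball N r) mu) :
  let B := eball N r in
  (forall u : 'rV[R]_N -> R, W12 B u ->
     (\sum_(2 <= j < n) (mu j - mu j.-1) * dist2 B mu j.-1 u)
       @[n --> \oo] --> deficit B mu u) /\
  (forall u : 'rV[R]_N -> R, W12 B u ->
     (mu 1%N * \sum_(2 <= j < n) ((mu j.-1)^-1 - (mu j)^-1) * gdist2 B mu j.-1 u)
       @[n --> \oo] --> deficit B mu u) /\
  (forall m : nat, (2 <= m)%N ->
     (forall u : 'rV[R]_N -> R, W12 B u ->
        \sum_(2 <= j < m.+1) (mu j - mu j.-1) * dist2 B mu j.-1 u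
          <= deficit B mu u) /\
     (forall c : R, mu m - mu m.-1 < c ->
        ~ forall u : 'rV[R]_N -> R, W12 B u ->
          \sum_(2 <= j < m) (mu j - mu j.-1) * dist2 B mu j.-1 u
            + c * dist2 B mu m.-1 u <= deficit B mu u) /\
     (forall u : 'rV[R]_N -> R, W12 B u ->
        deficit B mu u =
          \sum_(2 <= j < m.+1) (mu j - mu j.-1) * dist2 B mu j.-1 u
        <-> eigensum B mu m u)) /\
  (forall m : nat, (2 <= m)%N ->
     (forall u : 'rV[R]_N -> R, W12 B u ->
        mu 1%N * \sum_(2 <= j < m.+1)
                   ((mu j.-1)^-1 - (mu j)^-1) * gdist2 B mu j.-1 u
          <= deficit B mu u) /\
     (forall c : R, mu 1%N * ((mu m.-1)^-1 - (mu m)^-1) < c ->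
        ~ forall u : 'rV[R]_N -> R, W12 B u ->
          mu 1%N * (\sum_(2 <= j < m)
                     ((mu j.-1)^-1 - (mu j)^-1) * gdist2 B mu j.-1 u)
            + c * gdist2 B mu m.-1 u <= deficit B mu u) /\
     (forall u : 'rV[R]_N -> R, W12 B u ->
        deficit B mu u =
          mu 1%N * \sum_(2 <= j < m.+1)
                     ((mu j.-1)^-1 - (mu j)^-1) * gdist2 B mu j.-1 u
        <-> eigensum B mu m u)).
Proof.
move=> B; pose D := @ball_domain R N r hr.
have cD : segment_convex D := convex_eball hr.
have DM : (D : set _) `<=` cube r := eball_cube hr.
have [c1 c2] := @deficit_expansion R N D r mu cD DM (ltW hr) hmu.
split; first exact: c1.
split; first exact: c2.
split=> m m2.
- by have [h1 h2 h3] := @deficit_dist2_sharp R N D r mu cD DM (ltW hr) hmu m m2.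
- by have [h1 h2 h3] := @deficit_gdist2_sharp R N D r mu cD DM (ltW hr) hmu m m2.
Qed.
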